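(* Let $0\le\alpha<1/2$. For any $r>0$, the set $\Phi^\alpha(r):=\{\phi\in H:U^\alpha(\phi)\le r\}$ is compact in $H$. In particular, $U^\alpha$ is lower semi-continuous in $H$.
   Context: Notation. $H=L^2(0,1)$ with its usual inner product; $e_k(\xi)=\sqrt2\sin(k\pi\xi)$, $k\in\mathbb N=\{1,2,\dots\}$, an orthonormal basis of $H$; $A=-\Delta$ with Dirichlet boundary conditions, so $Ae_k=(k\pi)^2e_k$; for $r\in\mathbb R$, $H^r=D(A^{r/2})$ is the completion of $\mathrm{span}\{e_k\}$ under $\|u\|_{H^r}^2=\sum_k(k\pi)^{2r}\langle u,e_k\rangle^2$; $S(t)=e^{-At}$; $D=\partial_\xi$; for $v\in L^1(0,1)$, $S(t)Dv$ is defined by $\langle S(t)Dv,e_k\rangle=-e^{-\pi^2k^2t}\int_0^1v\,e_k'\,d\xi$. Quasi-potential. For $T>0$ and $u\in C([0,T];H^{-\alpha})$, $I_T(u)=\frac12\int_0^T\|A^{-\alpha/2}\mathcal H(u)(t)\|_H^2\,dt$, where $\mathcal H(u)=\partial_tu+Au-\frac12D(u^2)$. This means $I_T(u)=\frac12\int_0^T\|f(t)\|_H^2dt$ if $u\in L^\infty([0,T];H)$ and there is a (necessarily unique) $f=A^{-\alpha/2}\mathcal H(u)\in L^2([0,T];H)$ such that $u(t)=S(t)u(0)+\frac12\int_0^tS(t-s)D(u^2(s))\,ds+\int_0^tS(t-s)A^{\alpha/2}f(s)\,ds$ on $[0,T]$, and $I_T(u)=+\infty$ otherwise. The quasi-potential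 is $$U^\alpha(\phi)=\inf\{I_T(u):T>0,\ u\in C([0,T];H^{-\alpha}),\ u(0)=0,\ u(T)=\phi\}.$$ *)

(* Defs.v *)
From HB Require Import structures.
From mathcomp Require Import all_boot all_order all_algebra.
From mathcomp Require Import all_classical all_reals all_analysis.
From mathcomp Require Import measurable_realfun.

Set Implicit Arguments.
Unset Strict Implicit.
Unset Printing Implicit Defensive.

Import Order.TTheory GRing.Theory Num.Theory.
Import numFieldNormedType.Exports.

Local Open Scope classical_set_scope.
Local Open Scope ring_scope.

Definition mu01 (R : realType) : {measure set (measurableTypeR R) -> \bar R} :=
  mrestr lebesgue_measure (measurable_itv `]0%R, 1%R[).

(** The space H = L^2(0, 1): classes modulo equality a.e. on ]0, 1[. Elements
    coerce to functions R -> R through a representative. *)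
Definition L2 (R : realType) : Type := LspaceType2 (mu01 R).

Definition L2norm (R : realType) (f : R -> R) : R :=
  fine 'N[mu01 R]_2[EFin \o f]%E.

Definition inner (R : realType) (f g : R -> R) : R :=
  \int[mu01 R]_x (f x * g x).

Section L2_metric.
Context (R : realType).

HB.instance Definition _ := gen_eqMixin (L2 R).
HB.instance Definition _ := gen_choiceMixin (L2 R).

Definition L2dist (f g : L2 R) : R := L2norm ((f : R -> R) \- (g : R -> R)).

Let L2_measurable (f : L2 R) : measurable_fun setT (f : R -> R).
Proof. by rewrite /aqEqMfun_to_fun; exact: (@measurable_funPT _ _ _ _ (repr (f : {mfun_(mu01 R), measurableTypeR R >-> measurableTypeR R}))%qT). Qed.

Let L2_finite (f : L2 R) : finite_norm (mu01 R) 2%:R%:E f.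
Proof. exact: Lebesgue_finite. Qed.

Let two1 : (1 <= 2%:R%:E :> \bar R)%E. Proof. exact: (lee1n 2). Qed.

Let Lnorm_sub_lty (f g : L2 R) :
  ('N[mu01 R]_2%:R%:E[EFin \o ((f : R -> R) \- (g : R -> R))%R] < +oo)%E.
Proof.
have mN : measurable_fun setT (\- (g : R -> R)).
  exact: measurableT_comp (@L2_measurable g).
apply: le_lt_trans (eminkowski (mu01 R) (@L2_measurable f) mN two1) _.
apply: lte_add_pinfty; first exact: L2_finite.
have -> : EFin \o (\- (g : R -> R)) = (\- (EFin \o (g : R -> R)))%E by [].
by rewrite oppe_Lnorm; exact: L2_finite.
Qed.

Let Lnorm_sub_fin (f g : L2 R) :
  'N[mu01 R]_2%:R%:E[EFin \o ((f : R -> R) \- (g : R -> R))%R]%E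
    \is a fin_num.
Proof. by rewrite ge0_fin_numE ?Lnorm_ge0//; exact: Lnorm_sub_lty. Qed.

Let measurable_sub (f g : L2 R) :
  measurable_fun setT ((f : R -> R) \- (g : R -> R)).
Proof. exact: measurable_funB. Qed.

Let L2distxx f : L2dist f f = 0.
Proof.
rewrite /L2dist /L2norm.
have -> : EFin \o ((f : R -> R) \- (f : R -> R)) = cst 0%E.
  by apply/funext => x /=; rewrite subrr.
by rewrite Lnorm0.
Qed.

Let L2dist_positivity f g : L2dist f g = 0 -> f = g.
Proof.
rewrite /L2dist /L2norm => /eqP; rewrite fine_eq0; last exact: Lnorm_sub_fin.
move=> /eqP /(@Lnorm_eq0_eq0 _ _ _ _ _ _).
have /measurable_EFinP mfg := @measurable_sub f g.
move=> /(_ mfg) /(_ (lt_le_trans lte01 two1)) fg0.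
have fg : (f : R -> R) = (g : R -> R) %[ae mu01 R].
  apply: filterS fg0 => x /(_ I) /= [] /eqP.
  by rewrite subr_eq0 => /eqP.
have : f == g %[mod {mfun_(mu01 R), measurableTypeR R >-> measurableTypeR R}]%qT.
  by apply/ae_eqP.
rewrite !reprK => /eqP.
clear; case: f => f [[f2]]; case: g => g [[g2]] /= fg.
by subst g; rewrite (Prop_irrelevance f2 g2).
Qed.

Let L2dist_sym f g : L2dist f g = L2dist g f.
Proof.
rewrite /L2dist /L2norm -[in LHS]oppe_Lnorm; congr (fine _); congr Lnorm.
by apply/funext => x /=; rewrite opprB.
Qed.

Let L2distE (f g : L2 R) : (L2dist f g)%:E =
  'N[mu01 R]_2%:R%:E[EFin \o ((f : R -> R) \- (g : R -> R))%R]%E.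
Proof. by rewrite /L2dist /L2norm fineK//; exact: Lnorm_sub_fin. Qed.

Let L2dist_triangle g f h : L2dist f h <= L2dist f g + L2dist g h.
Proof.
rewrite -lee_fin EFinD !L2distE.
apply: le_trans (eminkowski (mu01 R) (@measurable_sub f g)
  (@measurable_sub g h) two1).
rewrite le_eqVlt; apply/orP; left; apply/eqP; congr Lnorm.
by apply/funext => x /=; rewrite addrA subrK.
Qed.

HB.instance Definition _ := isMetric.Build R (L2 R)
  L2distxx L2dist_positivity L2dist_sym L2dist_triangle.

End L2_metric.

Section quasi_potential.
Context (R : realType).
Local Notation leb := (@lebesgue_measure R).

(** Modes are counted from 0: [k] stands for the wave number k + 1. *)
Definition freq (k : nat) : R := k.+1%:R * pi.

Definition ebasis (k : nat) (x : R) : R := Num.sqrt 2 * sin (freq k * x).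

(** A generalised function is identified with the sequence of its coefficients
    along [ebasis]; [coef] embeds H, and the completion H^r of the span of the
    basis is the set of sequences of finite [Hnorm r]. *)
Definition coef (phi : L2 R) (k : nat) : R := inner phi (ebasis k).

Definition Hnorm (r : R) (c : nat -> R) : \bar R :=
  sqrte (\sum_(0 <= k <oo) (freq k `^ (2 * r) * c k ^+ 2)%:E)%E.

Definition Hspace (r : R) : set (nat -> R) :=
  [set c | (Hnorm r c < +oo)%E].

(** [u] belongs to C([0, T]; H^r); values outside [0, T] are irrelevant. *)
Definition continuous_Hspace (r T : R) (u : R -> nat -> R) : Prop :=
  forall t, t \in `[0, T] -> Hspace r (u t) /\
    (fun s => Hnorm r (u s \- u t)) @ within `[0, T] (nbhs t) --> 0%E.

Definition Apow (r : R) (c : nat -> R) (k : nat) : R :=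
  (freq k ^+ 2) `^ r * c k.

Definition heat (t : R) (c : nat -> R) (k : nat) : R :=
  expR (- (freq k ^+ 2 * t)) * c k.

(** S(t) D v for v in L^1(0, 1) *)
Definition heatD (t : R) (v : R -> R) (k : nat) : R :=
  - expR (- (freq k ^+ 2 * t)) * inner v (ebasis k)^`()%classic.

(** H is separable, so by Pettis' theorem this is strong measurability. *)
Definition measurable_L2 (T : R) (f : R -> L2 R) : Prop :=
  forall h : L2 R, measurable_fun `[0, T] (fun t => inner (f t) h).

(** L^oo([0, T]; H) *)
Definition Linfty_L2 (T : R) (f : R -> L2 R) : Prop :=
  measurable_L2 T f /\
  exists M : R, \forall t \ae leb, t \in `[0, T] -> L2norm (f t) <= M.

Definition sqr_int_L2 (T : R) (f : R -> L2 R) : \bar R :=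
  \int[leb]_(t in `[0%R, T]) (L2norm (f t) ^+ 2)%:E.

(** L^2([0, T]; H) *)
Definition Lsqr_L2 (T : R) (f : R -> L2 R) : Prop :=
  measurable_L2 T f /\ (sqr_int_L2 T f < +oo)%E.

(** The mild equation, the H-valued integrals being taken coefficientwise. For
    [v] in L^oo([0, T]; H), [f] in L^2([0, T]; H) and alpha < 1 both integrands
    are Bochner integrable in H, with norms bounded by multiples of
    (t - s)^(-3/4) and (t - s)^(-alpha/2) * |f(s)|. *)
Definition mild_solution (alpha T : R) (u : R -> nat -> R)
    (v f : R -> L2 R) : Prop :=
  forall t, t \in `[0, T] -> forall k : nat,
    u t k = heat t (u 0) k
      + 2^-1 * \int[leb]_(s in `[0, t]) heatD (t - s) (fun x => v s x ^+ 2) k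
      + \int[leb]_(s in `[0, t])
          heat (t - s) (Apow (alpha / 2) (coef (f s))) k.

(** [f] is A^(-alpha/2) H(u): [u] has a (necessarily a.e. unique) version [v]
    in L^oo([0, T]; H), and the mild equation holds with forcing
    [f] in L^2([0, T]; H). *)
Definition is_forcing (alpha T : R) (u : R -> nat -> R) (f : R -> L2 R)
    : Prop :=
  Lsqr_L2 T f /\
  exists v : R -> L2 R, [/\ Linfty_L2 T v,
    \forall t \ae leb, t \in `[0, T] -> u t = coef (v t) &
    mild_solution alpha T u v f].

(** The forcing is unique up to a.e. equality, so the infimum selects its value
    if it exists, and is +oo otherwise. *)
Definition action (alpha T : R) (u : R -> nat -> R) : \bar R :=
  ereal_inf [set ((2^-1)%:E * sqr_int_L2 T f)%E | f in is_forcing alpha T u].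

Definition quasi_potential (alpha : R) (phi : nat -> R) : \bar R :=
  ereal_inf [set y | exists T u, [/\ 0 < T, continuous_Hspace (- alpha) T u,
    u 0 = (fun=> 0), u T = phi & y = action alpha T u]].

Definition sublevel (alpha r : R) : set (L2 R) :=
  [set phi : L2 R | (quasi_potential alpha (coef phi) <= r%:E)%E].

End quasi_potential.

(* Main.v *)
Require Import Defs.
From HB Require Import structures.
From mathcomp Require Import all_boot all_order all_algebra.
From mathcomp Require Import all_classical all_reals all_analysis.
From mathcomp Require Import measurable_realfun.
From mathcomp Require Import ring lra zify.
Import Order.TTheory GRing.Theory Num.Theory.
Import numFieldNormedType.Exports.
Local Open Scope classical_set_scope.
Local Open Scope ring_scope.

Set Implicit Arguments.
Unset Strict Implicit.
Unset Printing Implicit Defensive.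

(** On sine coefficients, a path of finite action that starts at 0 is a
    trajectory: a solution of the scalar equations
    [u_k' = - lam_k * u_k + convect u k + lam_k ^ (alpha / 2) * F_k] with forcing
    of finite energy, the sum over [k] of the integrals of [F_k ^ 2]
    ([forcing_trajectory] and [trajectory_quasi_potential] translate in both
    directions). The theorem rests on three facts about trajectories.

    The first is an a priori bound. The quadratic term does no work, because
    [u^2 * u'] is an exact derivative ([nl_cancel]), and for [alpha < 1/2] the work
    of the forcing is dominated by its energy and the dissipation. Hence the norm
    of [u t] in H and the total dissipation are bounded by the energy of the
    forcing, whatever the length of the time interval ([trajectory_energy],
    [trajectory_dissipation]). Inserted in the mild formula this bounds [u t] in
    H^(3/8) ([trajectory_weighted]), which embeds compactly into H. In particular
    the points that can be reached with bounded action form a relatively compact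
    set ([sublevel_weighted]).

    The second is that the time interval may be taken to be fixed. On a long
    interval the dissipation bound provides a time in the last [M] units at which
    the H^1 norm is small ([regular_time]); the value at that time can be reached
    from 0 in unit time at small cost ([trajectory_to_H1]), so the earlier part of
    the path is replaced by rest followed by this short connection
    ([trajectory_truncate]). A path that is too short is preceded by rest.

    The third is that, on a fixed interval, trajectories with forcings of bounded
    energy are compact ([trajectory_limit]): their coefficients are
    equicontinuous, the bound in H^(3/8) gives convergence in H and thereby
    convergence of the quadratic terms, and a limit of primitives of functions of
    bounded square integral is again such a primitive, with no larger bound
    ([primitive_limit]).

    If [phi_n] converges to [phi] and is reached with action at most [r], the last
    two facts produce a path to [phi] of action at most [r + d], for every [d > 0]
    ([quasi_potential_cvg]). So the sublevel sets are closed, which is lower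
    semicontinuity, and by the first fact they are compact. *)

(** * Real-valued integrals and square-integrable functions *)

Section real_integrals.
Context d (T : measurableType d) (R : realType).
Variables (mu : {measure set T -> \bar R}) (D : set T).
Hypothesis mD : measurable D.
Implicit Types f g h : T -> R.

Definition intg f := mu.-integrable D (EFin \o f).

Lemma intg_measurable f : intg f -> measurable_fun D f.
Proof. by move=> /measurable_int /measurable_EFinP. Qed.

Lemma intg_le f g : measurable_fun D f -> intg g ->
  (forall x, D x -> `|f x| <= g x) -> intg f.
Proof.
move=> mf ig fg; apply: (le_integrable mD _ _ ig); first exact/measurable_EFinP.
by move=> x Dx /=; rewrite lee_fin (le_trans (fg x Dx))// ler_norm.
Qed.

Lemma intgD f g : intg f -> intg g -> intg (fun x => f x + g x).
Proof. by move=> fi gi; exact: (integrableD mD fi gi). Qed.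

Lemma intgZ k f : intg f -> intg (fun x => k * f x).
Proof. by move=> fi; exact: (integrableZl mD k fi). Qed.

Lemma intgN f : intg f -> intg (fun x => - f x).
Proof. by move=> fi; exact: (integrableN fi). Qed.

Lemma intgB f g : intg f -> intg g -> intg (fun x => f x - g x).
Proof. by move=> fi gi; apply: intgD => //; exact: intgN. Qed.

Lemma intg0 : intg (fun=> 0).
Proof. exact: integrable0. Qed.

Lemma intg_sum (I : Type) (s : seq I) (F : I -> T -> R) :
  (forall i, intg (F i)) -> intg (fun x => \sum_(i <- s) F i x).
Proof.
move=> Fi; elim: s => [|i s ih].
  by under eq_fun do rewrite big_nil; exact: intg0.
by under eq_fun do rewrite big_cons; exact: intgD.
Qed.

Lemma Rintegral_sum (I : Type) (s : seq I) (F : I -> T -> R) :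
  (forall i, intg (F i)) ->
  \int[mu]_(x in D) (\sum_(i <- s) F i x) = \sum_(i <- s) \int[mu]_(x in D) F i x.
Proof.
move=> Fi; elim: s => [|i s ih].
  under eq_Rintegral do rewrite big_nil.
  by rewrite big_nil /Rintegral integral0.
under eq_Rintegral do rewrite big_cons.
by rewrite RintegralD ?big_cons ?ih//; [exact: Fi|exact: intg_sum].
Qed.

Lemma intg_eq f g : (forall x, D x -> f x = g x) -> intg f -> intg g.
Proof.
move=> fg; apply: eq_integrable => // x /set_mem Dx /=; by rewrite fg.
Qed.

Lemma Rintegral_eq f g : (forall x, D x -> f x = g x) ->
  \int[mu]_(x in D) f x = \int[mu]_(x in D) g x.
Proof. by move=> fg; apply: eq_Rintegral => x /set_mem; exact: fg. Qed.

Lemma EFin_Rintegral f : intg f ->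
  (\int[mu]_(x in D) f x)%:E = (\int[mu]_(x in D) (f x)%:E)%E.
Proof. by move=> fi; rewrite /Rintegral fineK//; exact: integrable_fin_num. Qed.

Lemma Rintegral_dominated (f_ : nat -> T -> R) f g :
  (forall n, measurable_fun D (f_ n)) ->
  (forall x, D x -> f_ n x @[n --> \oo] --> f x) ->
  intg g -> (forall n x, D x -> `|f_ n x| <= g x) ->
  intg f /\ \int[mu]_(x in D) f_ n x @[n --> \oo] --> \int[mu]_(x in D) f x.
Proof.
move=> mf ff gi fg.
have mlim : measurable_fun D f by exact: (measurable_fun_cvg mf ff).
have [] := @dominated_convergence _ T R mu D mD (fun n => EFin \o f_ n)
  (EFin \o f) (EFin \o g).
- by move=> n; exact/measurable_EFinP.
- exact/measurable_EFinP.
- by apply/aeW => x Dx /=; apply: cvg_EFin; [exact: nearW|exact: ff].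
- exact: gi.
- by apply/aeW => x n Dx /=; rewrite lee_fin fg.
move=> fi _ h; split=> //; rewrite /Rintegral.
apply: fine_cvg; rewrite fineK; last exact: integrable_fin_num.
exact: h.
Qed.

Lemma Rintegral_fatou (f_ : nat -> T -> R) f C :
  (forall n, intg (f_ n)) -> (forall n x, D x -> 0 <= f_ n x) ->
  (forall x, D x -> f_ n x @[n --> \oo] --> f x) ->
  (forall n, \int[mu]_(x in D) f_ n x <= C) ->
  intg f /\ \int[mu]_(x in D) f x <= C.
Proof.
move=> fi f0 ff fC.
have mlim : measurable_fun D f.
  by apply: (measurable_fun_cvg _ ff) => n; exact: intg_measurable.
have iE n : (\int[mu]_(x in D) (f_ n x)%:E <= C%:E)%E.
  by rewrite -EFin_Rintegral// lee_fin.
have h : (\int[mu]_(x in D) (f x)%:E <= C%:E)%E.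
  have H1 n : measurable_fun D (EFin \o f_ n).
    by apply/measurable_EFinP; exact: intg_measurable.
  have H2 n x : D x -> (0 <= (EFin \o f_ n) x)%E.
    by move=> Dx /=; rewrite lee_fin f0.
  have := @fatou _ T R mu D mD (fun n => EFin \o f_ n) H1 H2.
  have -> : (\int[mu]_(x in D) limn_einf (fun n => (EFin \o f_ n) x) =
     \int[mu]_(x in D) (f x)%:E)%E.
    apply: eq_integral => x /set_mem Dx.
    have hx : (fun n => (f_ n x)%:E) @ \oo --> (f x)%:E.
      by apply: cvg_EFin; [exact: nearW|exact: ff].
    by have [] := cvg_limn_einf_sup hx.
  move=> /le_trans; apply.
  rewrite limn_einf_lim; apply: lime_le; first exact: is_cvg_einfs.
  apply: nearW => n; apply: le_trans (iE n).
  by apply: ereal_inf_lbound; exists n => /=.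
have f0' x : D x -> 0 <= f x.
  by move=> Dx; apply: (cvgr_to_ge (ff x Dx)); apply: nearW => n; exact: f0.
have fint : intg f.
  apply/integrableP; split; first exact/measurable_EFinP.
  apply: le_lt_trans (ltry C); apply: le_trans h.
  rewrite le_eqVlt; apply/orP; left; apply/eqP.
  by apply: eq_integral => x /set_mem Dx /=; rewrite ger0_norm// f0'.
by split=> //; rewrite -lee_fin EFin_Rintegral.
Qed.

Lemma intg_ae f g : measurable_fun D g -> ae_eq mu D f g -> intg f -> intg g.
Proof.
move=> mg fg fi; apply/integrableP; split; first exact/measurable_EFinP.
have /integrableP[mf] := fi; apply: le_lt_trans.
rewrite le_eqVlt; apply/orP; left; apply/eqP; apply: ae_eq_integral => //.
- by apply: measurableT_comp => //; exact/measurable_EFinP.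
- by apply: measurableT_comp.
- by move: fg; apply: filterS => x /= h /h ->.
Qed.

Lemma Rintegral_ae f g : measurable_fun D f -> measurable_fun D g ->
  ae_eq mu D f g -> \int[mu]_(x in D) f x = \int[mu]_(x in D) g x.
Proof.
move=> mf mg fg; congr fine; apply: ae_eq_integral => //.
- exact/measurable_EFinP.
- exact/measurable_EFinP.
- by move: fg; apply: filterS => x /= h /h ->.
Qed.

Definition sqint f := measurable_fun D f /\ intg (fun x => f x ^+ 2).

Lemma sqint_mul f g : sqint f -> sqint g -> intg (fun x => f x * g x).
Proof.
move=> [mf fi] [mg gi]; apply: (intg_le _ (intgD fi gi)).
  exact: measurable_funM.
move=> x _; rewrite ler_norml.
have := sqr_ge0 (f x - g x); have := sqr_ge0 (f x + g x).
have := sqr_ge0 (f x); have := sqr_ge0 (g x); rewrite !expr2.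
by move=> *; apply/andP; split; nra.
Qed.

Lemma sqintZ k f : sqint f -> sqint (fun x => k * f x).
Proof.
move=> [mf fi]; split; first exact: measurable_funM.
by under eq_fun do rewrite exprMn; exact: intgZ.
Qed.

Lemma sqintD f g : sqint f -> sqint g -> sqint (fun x => f x + g x).
Proof.
move=> sf sg; split; first by apply: measurable_funD; [exact: sf.1|exact: sg.1].
have h := intgD (intgD sf.2 (intgZ 2 (sqint_mul sf sg))) sg.2.
by apply: intg_eq h => x _; ring.
Qed.

Lemma sqintN f : sqint f -> sqint (fun x => - f x).
Proof.
move=> /(sqintZ (-1)) [h1 h2]; split.
  by under eq_fun do rewrite -mulN1r.
by under eq_fun do rewrite -mulN1r.
Qed.

Lemma sqintB f g : sqint f -> sqint g -> sqint (fun x => f x - g x).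
Proof. by move=> sf sg; apply: sqintD => //; exact: sqintN. Qed.

Lemma sqint0 : sqint (fun=> 0).
Proof. by split => //; under eq_fun do rewrite expr0n/=; exact: intg0. Qed.

Lemma sqint_sum (I : Type) (s : seq I) (F : I -> T -> R) :
  (forall i, sqint (F i)) -> sqint (fun x => \sum_(i <- s) F i x).
Proof.
move=> Fi; elim: s => [|i s ih].
  by under eq_fun do rewrite big_nil; exact: sqint0.
by under eq_fun do rewrite big_cons; exact: sqintD.
Qed.

Lemma sqint_bounded f g (M : R) : sqint f -> measurable_fun D g ->
  (forall x, D x -> `|g x| <= M) -> sqint (fun x => f x * g x).
Proof.
move=> [mf fi] mg gM; split; first exact: measurable_funM.
apply: (intg_le _ (intgZ (M ^+ 2) fi)).
  by apply: measurable_funX; exact: measurable_funM.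
move=> x Dx; rewrite ger0_norm ?sqr_ge0// exprMn mulrC ler_wpM2r ?sqr_ge0//.
have := gM x Dx; rewrite ler_norml => /andP[? ?]; rewrite !expr2; nra.
Qed.

Lemma sqint_cauchy_schwarz f g : sqint f -> sqint g ->
  (\int[mu]_(x in D) (f x * g x)) ^+ 2 <=
  \int[mu]_(x in D) (f x ^+ 2) * \int[mu]_(x in D) (g x ^+ 2).
Proof.
move=> sf sg; have fg := sqint_mul sf sg.
set a := \int[mu]_(x in D) (f x ^+ 2); set b := \int[mu]_(x in D) (f x * g x).
set c := \int[mu]_(x in D) (g x ^+ 2).
have a0 : 0 <= a by apply: Rintegral_ge0 => x _; exact: sqr_ge0.
have c0 : 0 <= c by apply: Rintegral_ge0 => x _; exact: sqr_ge0.
have H t : 0 <= a + (2 * t) * b + t ^+ 2 * c.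
  rewrite -(RintegralZl _ mD fg) -(RintegralZl _ mD sg.2).
  rewrite -(RintegralD mD sf.2 (intgZ _ fg)).
  rewrite -RintegralD //; [|exact: intgD sf.2 (intgZ _ fg)|exact: intgZ sg.2].
  apply: Rintegral_ge0 => x _.
  have -> : f x ^+ 2 + 2 * t * (f x * g x) + t ^+ 2 * g x ^+ 2 =
     (f x + t * g x) ^+ 2 by ring.
  exact: sqr_ge0.
have [c00|cN0] := eqVneq c 0.
  have : b = 0.
    apply/eqP; apply: contraT => bN0.
    have := H (- (a + 1) / (2 * b)); rewrite c00.
    have -> : 2 * (- (a + 1) / (2 * b)) * b = - (a + 1) by field.
    by rewrite mulr0 addr0; lra.
  by move=> ->; rewrite c00 expr0n/= mulr0.
have cp : 0 < c by rewrite lt_neqAle eq_sym cN0.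
have := H (- b / c).
have -> : a + 2 * (- b / c) * b + (- b / c) ^+ 2 * c = (a * c - b ^+ 2) / c.
  by field.
by rewrite pmulr_lge0 ?invr_gt0// subr_ge0.
Qed.

Lemma sqint_add_le f g : sqint f -> sqint g ->
  \int[mu]_(x in D) ((f x + g x) ^+ 2) <=
  2 * \int[mu]_(x in D) (f x ^+ 2) + 2 * \int[mu]_(x in D) (g x ^+ 2).
Proof.
move=> sf sg; have h := sqintD sf sg.
rewrite -(RintegralZl _ mD sf.2) -(RintegralZl _ mD sg.2).
rewrite -(RintegralD mD (intgZ _ sf.2) (intgZ _ sg.2)).
apply: le_Rintegral => //; first exact: h.2.
  by apply: intgD; apply: intgZ; [exact: sf.2|exact: sg.2].
by move=> x _; have := sqr_ge0 (f x - g x); rewrite !expr2; nra.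
Qed.

(** Along a rapidly convergent subsequence the increments [a k] satisfy
    [|a k| <= 2^-k + 2^k * (a k)^2], and the sum over [k] of the right-hand side
    is integrable; so the subsequence converges almost everywhere, and Fatou's
    lemma turns this into convergence in the mean of the whole sequence. *)
Lemma sqint_complete (f_ : nat -> T -> R) :
  (forall n, sqint (f_ n)) ->
  (forall e : R, 0 < e -> exists N, forall m n, (N <= m)%N -> (N <= n)%N ->
    \int[mu]_(x in D) ((f_ m x - f_ n x) ^+ 2) <= e) ->
  exists2 f, sqint f & forall e : R, 0 < e -> exists N, forall n, (N <= n)%N ->
    \int[mu]_(x in D) ((f_ n x - f x) ^+ 2) <= e.
Proof.
move=> sf cf.
have /choice[N0 HN0] : forall k : nat, exists N, forall m n, (N <= m)%N ->
    (N <= n)%N -> \int[mu]_(x in D) ((f_ m x - f_ n x) ^+ 2) <= (2^-1 ^+ k) ^+ 2.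
  by move=> k; apply: cf; rewrite !exprn_gt0// invr_gt0.
pose phi k := (\sum_(i < k.+1) (N0 i + 1))%N.
have phiN k : (N0 k <= phi k)%N.
  by rewrite /phi big_ord_recr /= addnA; lia.
have phiS k : (phi k < phi k.+1)%N.
  by rewrite /phi [X in (_ < X)%N]big_ord_recr /=; lia.
have phik k : (k <= phi k)%N.
  by elim: k => // k ih; exact: leq_ltn_trans ih (phiS k).
have phimono k l : (k <= l)%N -> (phi k <= phi l)%N.
  move=> /subnK <-; elim: (l - k)%N => // m ih.
  by rewrite addSn (leq_trans ih)// ltnW.
pose a k x := f_ (phi k.+1) x - f_ (phi k) x.
have sa k : sqint (a k) by exact: sqintB.
have ia k : \int[mu]_(x in D) (a k x ^+ 2) <= (2^-1 ^+ k) ^+ 2.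
  by apply: HN0 => //; apply: leq_trans (phiN k) _ => //; exact: phimono.
have geo n : \sum_(k < n) (2^-1 : R) ^+ k <= 2.
  have -> : \sum_(k < n) (2^-1 : R) ^+ k = 2 - 2 * 2^-1 ^+ n.
    elim: n => [|n ih]; first by rewrite big_ord0 expr0 mulr1 subrr.
    by rewrite big_ord_recr /= ih exprS; lra.
  by rewrite gerBl mulr_ge0// exprn_ge0.
pose h x := (\sum_(0 <= k <oo) (2 ^+ k * a k x ^+ 2)%:E)%E.
have mterm k : measurable_fun D (fun x => (2 ^+ k * a k x ^+ 2)%:E).
  by apply/measurable_EFinP; apply: intg_measurable; apply: intgZ; exact: (sa k).2.
have term0 k x : D x -> (0 <= (2 ^+ k * a k x ^+ 2)%:E)%E.
  by move=> _; rewrite lee_fin mulr_ge0 ?sqr_ge0// exprn_ge0.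
have hint : mu.-integrable D h.
  apply/integrableP; split.
    apply: (@ge0_emeasurable_sum _ _ _ D _ predT) => // k x Dx _; exact: term0.
  under eq_integral => x xD.
    rewrite gee0_abs; last by apply: nneseries_ge0 => k _ _; apply/term0/set_mem.
    over.
  rewrite (integral_nneseries mu mD mterm term0).
  apply: (@le_lt_trans _ _ 2%:E); last exact: ltry.
  apply: lime_le.
    by apply: is_cvg_nneseries => k _ _; apply: integral_ge0 => x; exact: term0.
  apply: nearW => n; rewrite big_mkord.
  have -> : (\sum_(k < n) \int[mu]_(x in D) (2 ^+ k * a k x ^+ 2)%:E =
     (\sum_(k < n) 2 ^+ k * \int[mu]_(x in D) (a k x ^+ 2))%:E)%E.
    rewrite -sumEFin; apply: eq_bigr => k _.
    by rewrite -(RintegralZl _ mD (sa k).2) EFin_Rintegral//; apply: intgZ; exact: (sa k).2.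
  rewrite lee_fin; apply: (@le_trans _ _ (\sum_(k < n) 2^-1 ^+ k)).
    apply: ler_sum => k _; apply: le_trans (ler_wpM2l _ (ia k)) _.
      by rewrite exprn_ge0.
    by rewrite expr2 mulrA -exprMn divff// expr1n mul1r.
  exact: geo.
have [N [mN muN subN]] := integrable_ae mD hint.
have hfin x : D x -> ~ N x -> h x \is a fin_num.
  by move=> Dx Nx; apply: contrapT => hx; apply: Nx; apply: subN => /(_ Dx).
pose g n x := f_ (phi n) x * \1_(~` N) x.
have gcvg x : D x -> cvgn (g ^~ x).
  move=> Dx; have [Nx|Nx] := pselect (N x).
    rewrite (_ : g ^~ x = fun=> 0); first exact: is_cvg_cst.
    by apply/funext => n; rewrite /g indicE memNset ?mulr0//; apply.
  rewrite (_ : g ^~ x = (fun n => f_ (phi n) x)); last first.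
    by apply/funext => n; rewrite /g indicE mem_set ?mulr1.
  have -> : (fun n => f_ (phi n) x) =
      (fun n => f_ (phi 0%N) x + series (fun k => a k x) n).
    apply/funext => n; rewrite /series /= /a.
    by rewrite (telescope_sumr (fun k => f_ (phi k) x))// addrC subrK.
  apply: is_cvgD; first exact: is_cvg_cst.
  apply: normed_cvg; apply: nondecreasing_is_cvgn.
    by apply: nondecreasing_series => k _ _; exact: normr_ge0.
  exists (2 + fine (h x)) => _ [n _ <-]; rewrite /series /=.
  apply: (@le_trans _ _ (\sum_(0 <= k < n) (2^-1 ^+ k + 2 ^+ k * a k x ^+ 2))).
    apply: ler_sum => k _.
    have p0 : 0 < (2 : R) ^+ k by rewrite exprn_gt0.
    have : 0 <= (2 ^+ k * `|a k x| - 1) ^+ 2 / 2 ^+ k.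
      by rewrite divr_ge0 ?sqr_ge0// ltW.
    have -> : (2 ^+ k * `|a k x| - 1) ^+ 2 / 2 ^+ k =
       2 ^+ k * `|a k x| ^+ 2 - 2 * `|a k x| + (2 ^+ k)^-1.
      by field; rewrite gt_eqF.
    rewrite real_normK ?num_real// exprVn.
    by have := normr_ge0 (a k x); lra.
  rewrite big_split /=; apply: lerD.
    by rewrite big_mkord; exact: geo.
  rewrite -lee_fin fineK; last exact: hfin.
  rewrite -sumEFin; apply: nneseries_lim_ge => k _ _; exact: term0.
pose f x := limn (g ^~ x).
have gf x : D x -> g ^~ x @ \oo --> f x by move=> /gcvg.
have mg n : measurable_fun D (g n).
  apply: measurable_funM; first exact: (sf _).1.
  by apply: measurable_indic; exact: measurableC.
have mf : measurable_fun D f by exact: measurable_fun_cvg gf.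
have gae n : ae_eq mu D (f_ (phi n)) (g n).
  exists N; split=> // x /= /not_implyP[Dx]; apply: contra_notP => Nx.
  by rewrite /g indicE mem_set ?mulr1.
have key m e : (forall k, (m <= k)%N ->
    \int[mu]_(x in D) ((f_ (phi k) x - f_ m x) ^+ 2) <= e) ->
    intg (fun x => (f x - f_ m x) ^+ 2) /\
    \int[mu]_(x in D) ((f x - f_ m x) ^+ 2) <= e.
  move=> Hm.
  have aek k : ae_eq mu D (fun x => (f_ (phi k) x - f_ m x) ^+ 2)
      (fun x => (g k x - f_ m x) ^+ 2).
    by move: (gae k); apply: filterS => x /= + Dx => /(_ Dx) ->.
  have mk k : measurable_fun D (fun x => (g k x - f_ m x) ^+ 2).
    by apply: measurable_funX; apply: measurable_funB => //; exact: (sf _).1.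
  have ik k : intg (fun x => (g k x - f_ m x) ^+ 2).
    by apply: (intg_ae _ (aek k)) => //; exact: (sqintB (sf _) (sf _)).2.
  apply: (@Rintegral_fatou (fun k x => (g (k + m)%N x - f_ m x) ^+ 2)).
  - by move=> k; exact: ik.
  - by move=> k x _; exact: sqr_ge0.
  - move=> x Dx.
    have h1 : (fun k => g (k + m)%N x - f_ m x) @ \oo --> f x - f_ m x.
      apply: cvgB; last exact: cvg_cst.
      by move: (gf x Dx); rewrite -(cvg_shiftn m).
    under eq_fun do rewrite expr2.
    by rewrite expr2; exact: (cvgM h1 h1).
  - move=> k; rewrite -(Rintegral_ae _ _ (aek _))//; first by apply: Hm; lia.
    by apply: intg_measurable; exact: (sqintB (sf _) (sf _)).2.
have [m1 Hm1] := cf 1 ltr01.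
have [i1 _] := key m1 1 (fun k km => Hm1 _ _ (leq_trans km (phik k)) (leqnn _)).
have s1 : sqint f.
  have s2 : sqint (fun x => f x - f_ m1 x).
    by split => //; apply: measurable_funB => //; exact: (sf _).1.
  have := sqintD s2 (sf m1); rewrite /sqint.
  by under eq_fun do rewrite subrK; under [X in intg X]eq_fun do rewrite subrK.
exists f => // e e0; have [M HM] := cf e e0; exists M => n Mn.
have [_] := key n e (fun k nk => HM _ _ (leq_trans Mn (leq_trans nk (phik k))) Mn).
by under eq_Rintegral do rewrite -sqrrN opprB.
Qed.

End real_integrals.

(** * Integrals over time intervals *)

Section time_integrals.
Context (R : realType).
Local Notation leb := (@lebesgue_measure R).
Implicit Types (f g p q y F : R -> R) (a b c t T : R).

Lemma intg_subitv a b a' b' f : a <= a' -> b' <= b ->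
  intg leb `[a, b] f -> intg leb `[a', b'] f.
Proof.
move=> aa bb; apply: integrableS => //; apply: subset_itvScc; rewrite ?bnd_simp//.
Qed.

Lemma intg_patch (I : set (measurableTypeR R)) f : measurable I ->
  intg leb I f -> intg leb setT (f \_ I).
Proof.
move=> mI fi; have := (@integrable_mkcond _ _ _ leb I (EFin \o f) mI).1 fi.
by apply: eq_integrable => // x _; rewrite /= restrict_EFin.
Qed.

Lemma intg_continuous a b f : {within `[a, b], continuous f} -> intg leb `[a, b] f.
Proof.
by move=> cf; apply: continuous_compact_integrable => //; exact: segment_compact.
Qed.

Lemma Rintegral_FTC F f a b : a <= b -> (forall x : R, is_derive x (1 : R) F (f x)) ->
  continuous f -> \int[leb]_(x in `[a, b]) f x = F b - F a.
Proof.
rewrite le_eqVlt => /predU1P[<- _ _|ab dF cf].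
  by rewrite set_itv1 Rintegral_set1 subrr.
have cF : continuous F.
  move=> x; apply: differentiable_continuous; apply/derivable1_diffP.
  exact: ex_derive.
rewrite /Rintegral (@continuous_FTC2 _ f F)//.
- exact: continuous_subspaceT.
- split; first by move=> x _; exact: ex_derive.
  + exact/cvg_at_right_filter/cF.
  + exact/cvg_at_left_filter/cF.
- by move=> x _; rewrite derive1E; exact: derive_val.
Qed.

Lemma primitive_continuous T f : 0 <= T -> intg leb `[0, T] f ->
  {within `[0, T], continuous (fun t => \int[leb]_(s in `[0, t]) f s)}.
Proof. by move=> T0 fi; exact: (parameterized_integral_continuous T0 fi). Qed.

Lemma within_continuous_measurable a b f : {within `[a, b], continuous f} ->
  measurable_fun `[a, b] f.
Proof. by move=> cf; apply: subspace_continuous_measurable_fun. Qed.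

Lemma within_continuous_bounded a b f : {within `[a, b], continuous f} ->
  exists M, forall x, x \in `[a, b] -> `|f x| <= M.
Proof.
move=> cf; have [ab|ba] := leP a b; last first.
  by exists 0 => x; rewrite in_itv /= => /andP[ax xb]; have := le_trans ax xb; lra.
have [c1 _ h1] := EVT_max ab cf.
have [c2 _ h2] := EVT_min ab cf.
exists (`|f c1| + `|f c2|) => x xab; rewrite ler_norml; apply/andP; split.
  have := h2 x xab; have := ler_norm (- f c2); rewrite normrN.
  have := normr_ge0 (f c1); lra.
have := h1 x xab; have := ler_norm (f c1); have := normr_ge0 (f c2); lra.
Qed.

Lemma intg_mul_continuous a b f g : intg leb `[a, b] f ->
  {within `[a, b], continuous g} -> intg leb `[a, b] (fun x => f x * g x).
Proof.
move=> fi cg; have [M gM] := within_continuous_bounded cg.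
have fi' : intg leb `[a, b] (fun x => M * `|f x|).
  apply: intgZ => //.
  by have := @integrable_norm _ _ _ leb `[a, b]%classic f fi.
apply: (intg_le _ _ fi') => //.
  apply: measurable_funM; first exact: intg_measurable fi.
  exact: within_continuous_measurable.
by move=> x xab; rewrite normrM mulrC ler_wpM2r ?gM.
Qed.

(** Integration by parts for primitives of integrable functions: both sides
    are the integral of [p s * q r] over the square [[0, t]], cut along its
    diagonal. *)
Lemma primitive_mul p q t : 0 <= t -> intg leb `[0, t] p -> intg leb `[0, t] q ->
  \int[leb]_(s in `[0, t]) (p s * \int[leb]_(r in `[0, s]) q r) +
  \int[leb]_(s in `[0, t]) (q s * \int[leb]_(r in `[0, s]) p r) =
  \int[leb]_(s in `[0, t]) p s * \int[leb]_(s in `[0, t]) q s.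
Proof.
move=> t0 pi qi.
pose I : set (measurableTypeR R) := `[0, t]%classic.
have mI : measurable I by exact: measurable_itv.
pose p' := p \_ I; pose q' := q \_ I.
have pi' : intg leb setT p'.
  exact: intg_patch.
have qi' : intg leb setT q'.
  exact: intg_patch.
pose D := [set z : R * R | z.2 <= z.1].
have mD : measurable D.
  rewrite (_ : D = (fun z => z.1 - z.2) @^-1` `[0, +oo[%classic); last first.
    by apply/seteqP; split=> z; rewrite /D /= in_itv /= andbT subr_ge0.
  rewrite -[X in measurable X]setTI.
  have : measurable_fun setT (fun z : R * R => z.1 - z.2).
    by apply: measurable_funB; [exact: measurable_fst|exact: measurable_snd].
  by apply => //; exact: measurable_itv.
pose f (z : R * R) : R := p' z.1 * q' z.2 * \1_D z.
have mf : measurable_fun setT f.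
  apply: measurable_funM; last exact: measurable_indic.
  apply: measurable_funM.
    by apply: (measurableT_comp _ measurable_fst); exact: intg_measurable pi'.
  by apply: (measurableT_comp _ measurable_snd); exact: intg_measurable qi'.
have fint : (leb \x leb)%E.-integrable setT (EFin \o f).
  apply/integrable12ltyP; first exact/measurable_EFinP.
  have H s : (\int[leb]_r `|(EFin \o f) (s, r)| <=
      (`|p' s| * \int[leb]_r `|q' r|)%:E)%E.
    rewrite EFinM EFin_Rintegral//; last exact: (integrable_norm qi').
    rewrite -ge0_integralZl//; first last.
    - by move: qi' => /integrable_norm /measurable_int.
    apply: ge0_le_integral => //.
    - apply/measurable_EFinP; apply: measurableT_comp => //.
      by apply: measurableT_comp => //; exact: pair1_measurable.
    - apply/measurable_EFinP; apply: measurable_funM => //.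
      by apply: measurableT_comp => //; exact: intg_measurable qi'.
    - move=> r _; rewrite /f /= lee_fin !normrM ler_piMr ?mulr_ge0//.
      by rewrite indicE; case: (_ \in _); rewrite ?normr1 ?normr0.
  apply: (@le_lt_trans _ _ (\int[leb]_s (`|p' s| * \int[leb]_r `|q' r|)%:E)%E).
    apply: ge0_le_integral => //.
    - by move=> s _; exact: integral_ge0.
    - apply: (@measurable_fun_fubini_tonelli_F _ _ _ _ _ leb
         (fun z => `|(f z)%:E|)%E) => //.
      by apply/measurable_EFinP; exact: measurableT_comp.
    - apply/measurable_EFinP; apply: measurable_funM => //.
      by apply: measurableT_comp => //; exact: intg_measurable pi'.
  rewrite -EFin_Rintegral ?ltry//.
  under eq_fun do rewrite mulrC.
  by apply: intgZ => //; exact: (integrable_norm pi').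
have := Fubini fint.
have L1 s : (\int[leb]_r (EFin \o f) (s, r) =
    (p' s * \int[leb]_(r in `[0, s]) q r)%:E)%E.
  rewrite /p' patchE; case: ifPn => [/set_mem|] sI; last first.
    rewrite mul0r; apply: integral0_eq => r _.
    by rewrite /f /= /p' patchE (negbTE sI) !mul0r.
  have ts : s <= t by move: sI; rewrite /I /= in_itv /= => /andP[].
  rewrite EFinM EFin_Rintegral//; last exact: intg_subitv qi.
  rewrite -integralZl//; last exact: intg_subitv qi.
  rewrite [RHS]integral_mkcond; apply: eq_integral => r _.
  rewrite /f /= /p' patchE mem_set//= patchE /q' patchE indicE /D /=.
  case: ifPn => [/set_mem|] rI; last first.
    case: ifPn => [/set_mem /=|]; rewrite ?mulr0 ?mul0r//.
    rewrite in_itv /= => /andP[r0 rs]; exfalso; move/negP: rI; apply.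
    by apply/mem_set; rewrite /I /= in_itv /= r0 (le_trans rs ts).
  have r0 : 0 <= r by move: rI; rewrite /I /= in_itv /= => /andP[].
  have [rs|sr] := leP r s.
    by rewrite !mem_set ?mulr1 //= in_itv /= r0.
  rewrite !memNset ?mulr0//=; first by rewrite in_itv /= r0 leNgt sr.
  by apply/negP; rewrite -ltNge.
have L2 r : (\int[leb]_s (EFin \o f) (s, r) =
    (q' r * (\int[leb]_(s in `[0, t]) p s - \int[leb]_(s in `[0, r]) p s))%:E)%E.
  rewrite /q' patchE; case: ifPn => [/set_mem|] rI; last first.
    rewrite mul0r; apply: integral0_eq => x _.
    by rewrite /f /= /q' patchE (negbTE rI) mulr0 mul0r.
  move: (rI); rewrite /I /= in_itv /= => /andP[r0 rt].
  rewrite Rintegral_itvB//; try by rewrite bnd_simp.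
  rewrite Rintegral_itv_obnd_cbnd; last first.
    by apply: integrableS pi => //; apply: subset_itv; rewrite bnd_simp.
  have pr : intg leb `[r, t] p by exact: intg_subitv pi.
  rewrite EFinM EFin_Rintegral// -integralZl//.
  rewrite [RHS]integral_mkcond; apply: eq_integral => x _.
  rewrite /f /= /q' patchE mem_set//= patchE /p' patchE indicE /D /=.
  case: ifPn => [/set_mem|] xI; last first.
    case: ifPn => [/set_mem /=|]; rewrite ?mulr0 ?mul0r//.
    rewrite in_itv /= => /andP[rx xt]; exfalso; move/negP: xI; apply.
    by apply/mem_set; rewrite /I /= in_itv /= xt (le_trans r0 rx).
  have xt : x <= t by move: xI; rewrite /I /= in_itv /= => /andP[].
  have [rs|sr] := leP r x.
    by rewrite !mem_set ?mulr1 //= 1?mulrC// in_itv /= rs.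
  rewrite !memNset ?mulr0//=; first by rewrite in_itv /= leNgt sr.
  by apply/negP; rewrite -ltNge.
have E1 : (\int[leb]_s \int[leb]_r (EFin \o f) (s, r) =
   \int[leb]_(s in I) (p s * \int[leb]_(r in `[0, s]) q r)%:E)%E.
  under eq_integral do rewrite L1.
  rewrite [RHS]integral_mkcond; apply: eq_integral => s _.
  by rewrite /p' !patchE; case: ifP => //; rewrite mul0r.
have E2 : (\int[leb]_r \int[leb]_s (EFin \o f) (s, r) =
   \int[leb]_(r in I) (q r * (\int[leb]_(s in `[0, t]) p s -
        \int[leb]_(s in `[0, r]) p s))%:E)%E.
  under eq_integral do rewrite L2.
  rewrite [RHS]integral_mkcond; apply: eq_integral => s _.
  by rewrite /q' !patchE; case: ifP => //; rewrite mul0r.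
rewrite E1 E2 => /(congr1 fine) E.
have {}E : \int[leb]_(s in I) (p s * \int[leb]_(r in `[0, s]) q r) =
  \int[leb]_(r in I) (q r * (\int[leb]_(s in `[0, t]) p s -
        \int[leb]_(s in `[0, r]) p s)) by [].
rewrite -/I E.
under eq_Rintegral do rewrite mulrBr.
have qP : intg leb I (fun r => q r * \int[leb]_(s in `[0, r]) p s).
  exact: intg_mul_continuous qi (primitive_continuous t0 pi).
rewrite RintegralB//; last first.
  by under eq_fun do rewrite mulrC; exact: intgZ qi.
by rewrite subrK RintegralZr// mulrC.
Qed.

End time_integrals.

(** * Linear scalar equations with an integrable forcing *)

Section scalar_ode.
Context (R : realType).
Local Notation leb := (@lebesgue_measure R).
Implicit Types (f g p q y F : R -> R) (a b c t T lam : R).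

Lemma within_continuousM (A : set R) f g : {within A, continuous f} ->
  {within A, continuous g} -> {within A, continuous (fun x => f x * g x)}.
Proof. by move=> cf cg x; apply: cvgM; [exact: cf|exact: cg]. Qed.

Lemma within_continuousX2 (A : set R) f : {within A, continuous f} ->
  {within A, continuous (fun x => f x ^+ 2)}.
Proof. by move=> cf; exact: within_continuousM. Qed.

Lemma pushforward_shift c (A : set R) : measurable A ->
  pushforward leb (fun x : R => x + c : measurableTypeR R) A = leb A.
Proof.
move=> mA; apply/esym/lebesgue_measure_unique => //=.
  exact: measurable_funD.
move=> _ _ [[a b]] _ <-; rewrite /pushforward /=.
rewrite (_ : _ @^-1` _ = [set` `]a - c, b - c]]); last first.
  by apply/seteqP; split=> x; rewrite /= !in_itv /= ltrBlDr lerBrDr.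
rewrite !lebesgue_measure_itv/= !lte_fin ltrD2r; case: ifP => // _.
by rewrite -!EFinB; congr (_%:E); ring.
Qed.

Lemma Rintegral_shift c a b f : intg leb `[a, b] f ->
  intg leb `[a + c, b + c] (fun x => f (x - c)) /\
  \int[leb]_(x in `[a + c, b + c]) f (x - c) = \int[leb]_(x in `[a, b]) f x.
Proof.
move=> fi.
pose I : set (measurableTypeR R) := `[a + c, b + c]%classic.
have mI : measurable I by exact: measurable_itv.
pose phi : measurableTypeR R -> measurableTypeR R := fun x => x + c.
have mphi : measurable_fun setT phi by exact: measurable_funD.
have preI : phi @^-1` I = `[a, b]%classic.
  by apply/seteqP; split=> x; rewrite /I /= !in_itv /= !lerD2r.
pose fI := f \_ (`[a, b]%classic : set (measurableTypeR R)).
have fIi : intg leb setT fI by apply: intg_patch.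
pose g : measurableTypeR R -> \bar R := EFin \o (fun x => fI (x - c)).
have mg : measurable_fun setT g.
  apply/measurable_EFinP.
  apply: (@measurableT_comp _ _ _ _ _ _ fI _ (fun x : R => x - c)).
    exact: intg_measurable fIi.
  exact: measurable_funB.
have gphi : g \o phi = EFin \o fI.
  by apply/funext => x; rewrite /g /= addrK.
have gi : leb.-integrable (phi @^-1` I) (g \o phi).
  rewrite gphi preI; apply: integrableS fIi => //.
have gI x : I x -> g x = (f (x - c))%:E.
  move=> Ix; rewrite /g /fI /= patchE mem_set//.
  by move: Ix; rewrite /I /= !in_itv /= lerBrDr lerBlDr.
have eqm A : measurable A -> A `<=` I ->
  leb A = pushforward leb phi A.
  by move=> mA _; rewrite pushforward_shift.
have E : (\int[leb]_(x in I) g x = \int[leb]_(x in `[a, b]) (EFin \o fI) x)%E.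
  rewrite -preI -gphi -(integral_pushforward mphi mg gi mI).
  exact: eq_measure_integral eqm.
have E1 : (\int[leb]_(x in I) g x = \int[leb]_(x in I) (f (x - c))%:E)%E.
  by apply: eq_integral => x /set_mem /gI.
have E2 : (\int[leb]_(x in `[a, b]) (EFin \o fI) x =
    \int[leb]_(x in `[a, b]) (f x)%:E)%E.
  by apply: eq_integral => x xI; rewrite /fI /= patchE xI.
split; last by rewrite /Rintegral -E1 E E2.
have mf : measurable_fun I (fun x => f (x - c)).
  have : measurable_fun I g by apply: measurable_funS mg.
  by move=> /measurable_EFinP; apply: eq_measurable_fun => x /set_mem /gI [].
apply/integrableP; split; first exact/measurable_EFinP.
have mag : measurable_fun setT (abse \o g) by exact: measurableT_comp.
have H : (\int[leb]_(x in I) (abse \o g) x =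
    \int[leb]_(x in phi @^-1` I) ((abse \o g) \o phi) x)%E.
  transitivity (\int[pushforward leb phi]_(x in I) (abse \o g) x)%E.
    exact: eq_measure_integral eqm.
  apply: ge0_integral_pushforward => //; last by move=> x _; exact: abse_ge0.
  exact: measurable_funS mag.
have -> : (\int[leb]_(x in I) `|(EFin \o (fun y : R => f (y - c)%R)) x| =
  \int[leb]_(x in I) (abse \o g) x)%E.
  by apply: eq_integral => x /set_mem Ix; exact/esym/(congr1 abse (gI x Ix)).
rewrite H preI; have /integrableP[_] := fi; apply: le_lt_trans.
rewrite le_eqVlt; apply/orP; left; apply/eqP; apply: eq_integral => x xI.
by rewrite /= addrK /fI patchE xI.
Qed.

Lemma is_derive_expM lam (x : R) :
  is_derive x (1 : R) (fun s => expR (lam * s)) (lam * expR (lam * x)).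
Proof.
have h : is_derive x (1:R) (fun s => lam * s) lam.
  have := is_deriveZ lam (is_derive_id x (1 : R)).
  by rewrite /GRing.scale /= mulr1.
have := @is_derive1_comp _ (@expR R) (fun s => lam * s) x _ _ (is_derive_expR _) h.
by rewrite mulrC.
Qed.

Lemma continuous_expM lam : continuous (fun s : R => expR (lam * s)).
Proof.
move=> x; apply: differentiable_continuous; apply/derivable1_diffP.
exact: (@ex_derive _ _ _ _ _ _ _ (is_derive_expM lam x)).
Qed.

Lemma Rintegral_expM lam t : 0 <= t ->
  \int[leb]_(s in `[0, t]) (lam * expR (lam * s)) = expR (lam * t) - 1.
Proof.
move=> t0; rewrite (Rintegral_FTC t0 (is_derive_expM lam)).
- by rewrite mulr0 expR0.
- move=> x; apply: cvgM; first exact: cvg_cst.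
  exact: continuous_expM.
Qed.

Lemma intg_expM_mul lam a b f : intg leb `[a, b] f ->
  intg leb `[a, b] (fun s => expR (lam * s) * f s).
Proof.
move=> fi; have : intg leb `[a, b] (fun s => f s * expR (lam * s)).
  apply: intg_mul_continuous => //; apply: continuous_subspaceT.
  exact: continuous_expM.
by apply: intg_eq => // s _; exact: mulrC.
Qed.

Lemma Rintegral_mild lam t g : intg leb `[0, t] g ->
  \int[leb]_(s in `[0, t]) (expR (- (lam * (t - s))) * g s) =
  expR (- lam * t) * \int[leb]_(s in `[0, t]) (expR (lam * s) * g s).
Proof.
move=> gi; rewrite -RintegralZl//; last exact: intg_expM_mul.
apply: eq_Rintegral => s _; rewrite mulrA -expRD; congr (expR _ * _); ring.
Qed.

(** Variation of constants. As [y] is only the primitive of an integrable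
    function, the product rule for [expR (lam * t) * y t] is [primitive_mul]. *)
Lemma mild_of_ode T lam y g : intg leb `[0, T] g -> intg leb `[0, T] y ->
  (forall t, t \in `[0, T] -> y t = \int[leb]_(s in `[0, t]) (g s - lam * y s)) ->
  forall t, t \in `[0, T] ->
    y t = \int[leb]_(s in `[0, t]) (expR (- (lam * (t - s))) * g s).
Proof.
move=> gi yi hy t tT; move: (tT); rewrite in_itv /= => /andP[t0 t1].
have gt : intg leb `[0, t] g by exact: intg_subitv gi.
have yt : intg leb `[0, t] y by exact: intg_subitv yi.
rewrite Rintegral_mild//.
pose h s := g s - lam * y s.
have hi : intg leb `[0, t] h by apply: intgB => //; exact: intgZ.
pose p (s : R) := lam * expR (lam * s).
have pi : intg leb `[0, t] p.
  apply: intg_continuous; apply: continuous_subspaceT => x.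
  by apply: cvgM; [exact: cvg_cst|exact: continuous_expM].
have E := primitive_mul t0 pi hi.
have E1 : \int[leb]_(s in `[0, t]) (p s * \int[leb]_(r in `[0, s]) h r) =
    \int[leb]_(s in `[0, t]) (p s * y s).
  apply: Rintegral_eq => s /=; rewrite in_itv /= => /andP[s0 s1].
  by rewrite hy// in_itv /= s0 (le_trans s1).
have E2 : \int[leb]_(s in `[0, t]) (h s * \int[leb]_(r in `[0, s]) p r) =
    \int[leb]_(s in `[0, t]) (expR (lam * s) * h s - h s).
  apply: Rintegral_eq => s /=; rewrite in_itv /= => /andP[s0 s1].
  by rewrite Rintegral_expM// mulrBr mulr1 mulrC.
have ehi := intg_expM_mul lam hi.
rewrite E1 E2 Rintegral_expM// RintegralB// -(hy t tT) in E.
have pyi : intg leb `[0, t] (fun s => p s * y s).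
  have : intg leb `[0, t] (fun s => lam * (expR (lam * s) * y s)).
    by apply: intgZ => //; exact: intg_expM_mul.
  by apply: intg_eq => // s _; rewrite /p mulrA.
have E3 : \int[leb]_(s in `[0, t]) (p s * y s) +
    \int[leb]_(s in `[0, t]) (expR (lam * s) * h s) =
    \int[leb]_(s in `[0, t]) (expR (lam * s) * g s).
  by rewrite -RintegralD//; apply: Rintegral_eq => s _; rewrite /p /h; ring.
have : expR (lam * t) * y t = \int[leb]_(s in `[0, t]) (expR (lam * s) * g s).
  by rewrite -E3; have := hy t tT; rewrite -/h; lra.
by move=> <-; rewrite mulrA -expRD mulNr addNr expR0 mul1r.
Qed.

Lemma ode_of_mild T lam y g : 0 <= T -> intg leb `[0, T] g ->
  (forall t, t \in `[0, T] ->
    y t = \int[leb]_(s in `[0, t]) (expR (- (lam * (t - s))) * g s)) ->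
  {within `[0, T], continuous y} /\
  forall t, t \in `[0, T] -> y t = \int[leb]_(s in `[0, t]) (g s - lam * y s).
Proof.
move=> T0 gi hy.
pose G s := expR (lam * s) * g s.
have Gi : intg leb `[0, T] G by exact: intg_expM_mul.
pose Y t := \int[leb]_(s in `[0, t]) G s.
have hY t : t \in `[0, T] -> y t = expR (- lam * t) * Y t.
  move=> tT; rewrite hy// Rintegral_mild//.
  by move: tT; rewrite in_itv /= => /andP[t0 t1]; exact: intg_subitv gi.
have cY := primitive_continuous T0 Gi.
have cy : {within `[0, T], continuous y}.
  have : {within `[0, T], continuous (fun t => expR (- lam * t) * Y t)}.
    apply: within_continuousM; last exact: cY.
    apply: continuous_subspaceT; exact: continuous_expM.
  apply: subspace_eq_continuous => x xT.
  by rewrite /from_subspace /= -hY//; move: xT; rewrite inE.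
split=> // t tT; move: (tT); rewrite in_itv /= => /andP[t0 t1].
have gt : intg leb `[0, t] g by exact: intg_subitv gi.
have yt : intg leb `[0, t] y.
  by apply: (@intg_subitv _ 0 T) => //; exact: intg_continuous.
have Gt : intg leb `[0, t] G by exact: intg_subitv Gi.
pose p (s : R) := - lam * expR (- lam * s).
have pi : intg leb `[0, t] p.
  apply: intg_continuous; apply: continuous_subspaceT => x.
  by apply: cvgM; [exact: cvg_cst|exact: continuous_expM].
have E := primitive_mul t0 pi Gt.
have E1 : \int[leb]_(s in `[0, t]) (p s * \int[leb]_(r in `[0, s]) G r) =
    \int[leb]_(s in `[0, t]) (- lam * y s).
  apply: Rintegral_eq => s /=; rewrite in_itv /= => /andP[s0 s1].
  by rewrite hY ?in_itv /= ?s0 ?(le_trans s1)// /p mulrA.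
have E2 : \int[leb]_(s in `[0, t]) (G s * \int[leb]_(r in `[0, s]) p r) =
    \int[leb]_(s in `[0, t]) (g s - G s).
  apply: Rintegral_eq => s /=; rewrite in_itv /= => /andP[s0 s1].
  rewrite Rintegral_expM// mulrBr mulr1 /G mulrAC -expRD mulNr subrr expR0.
  by rewrite mul1r.
rewrite E1 E2 Rintegral_expM// (RintegralB _ gt Gt)// in E.
rewrite (RintegralB _ gt)//; last exact: intgZ.
rewrite RintegralZl// in E; rewrite RintegralZl//.
have := hY t tT; rewrite /Y; lra.
Qed.

(** The formula for the derivative of [y ^ 2], as [primitive_mul] of the
    derivative of [y] with itself. *)
Lemma ode_energy T lam y g : 0 <= T -> intg leb `[0, T] g ->
  {within `[0, T], continuous y} ->
  (forall t, t \in `[0, T] -> y t = \int[leb]_(s in `[0, t]) (g s - lam * y s)) ->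
  y T ^+ 2 + 2 * lam * \int[leb]_(s in `[0, T]) (y s ^+ 2) =
  2 * \int[leb]_(s in `[0, T]) (g s * y s).
Proof.
move=> T0 gi cy hy; have yi := intg_continuous cy.
pose h s := g s - lam * y s.
have hi : intg leb `[0, T] h by apply: intgB => //; exact: intgZ.
have TT : T \in `[0, T] by rewrite in_itv /= T0 lexx.
have := primitive_mul T0 hi hi.
rewrite -(hy T TT).
have -> : \int[leb]_(s in `[0, T]) (h s * \int[leb]_(r in `[0, s]) h r) =
    \int[leb]_(s in `[0, T]) (g s * y s - lam * (y s ^+ 2)).
  apply: Rintegral_eq => s /= sT; rewrite -(hy s sT) /h; ring.
rewrite RintegralB//; first last.
- by apply: intgZ => //; apply: intg_continuous; exact: within_continuousX2.
- exact: intg_mul_continuous.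
rewrite RintegralZl//; last first.
  by apply: intg_continuous; exact: within_continuousX2.
by rewrite expr2; lra.
Qed.

Lemma sqint_continuous a b y : {within `[a, b], continuous y} -> sqint leb `[a, b] y.
Proof.
move=> cy; split; first exact: within_continuous_measurable.
by apply: intg_continuous; exact: within_continuousX2.
Qed.

Lemma sqint_intg_itv a b g : sqint leb `[a, b] g -> intg leb `[a, b] g.
Proof.
move=> sg; have s1 : sqint leb `[a, b] (fun=> 1).
  by apply: sqint_continuous; apply: continuous_subspaceT => x; exact: cst_continuous.
have : intg leb `[a, b] (fun s => g s * 1) by exact: sqint_mul sg s1.
by apply: intg_eq => // s _; rewrite mulr1.
Qed.

(** Maximal regularity of the scalar equation [y' + lam y = g]: testing with
    [lam y] controls both the supremum and the integral of [lam y]. *)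
Lemma ode_maximal_regularity T lam y g : 0 <= T -> 0 < lam ->
  sqint leb `[0, T] g -> {within `[0, T], continuous y} ->
  (forall t, t \in `[0, T] -> y t = \int[leb]_(s in `[0, t]) (g s - lam * y s)) ->
  lam * y T ^+ 2 + lam ^+ 2 * \int[leb]_(s in `[0, T]) (y s ^+ 2) <=
  \int[leb]_(s in `[0, T]) (g s ^+ 2).
Proof.
move=> T0 lam0 sg cy hy.
have := ode_energy T0 (sqint_intg_itv sg) cy hy.
have sy := sqint_continuous cy.
have : \int[leb]_(s in `[0, T]) (2 * lam * (g s * y s)) <=
  \int[leb]_(s in `[0, T]) (g s ^+ 2 + lam ^+ 2 * y s ^+ 2).
  apply: le_Rintegral => //.
  - by apply: intgZ => //; exact: sqint_mul.
  - by apply: intgD => //; [exact: sg.2|apply: intgZ => //; exact: sy.2].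
  - by move=> s _; have := sqr_ge0 (g s - lam * y s); rewrite !expr2; nra.
rewrite RintegralZl//; last exact: sqint_mul.
rewrite (RintegralD _ sg.2)//; last by apply: intgZ => //; exact: sy.2.
rewrite RintegralZl//; last exact: sy.2.
move=> H /(congr1 (fun z => lam * z)); rewrite !expr2 in H *; lra.
Qed.

(** The semigroup gains one factor [lam], that is two derivatives. *)
Lemma mild_bound T lam g (G : R) : 0 <= T -> 0 < lam -> 0 <= G ->
  intg leb `[0, T] g -> (forall s, s \in `[0, T] -> `|g s| <= G) ->
  `|\int[leb]_(s in `[0, T]) (expR (- (lam * (T - s))) * g s)| <= G / lam.
Proof.
move=> T0 lam0 G0 gi gG; rewrite Rintegral_mild//.
rewrite normrM (ger0_norm (expR_ge0 _)).
have ei : intg leb `[0, T] (fun s => lam * expR (lam * s)).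
  apply: intg_continuous; apply: continuous_subspaceT => x.
  by apply: cvgM; [exact: cvg_cst|exact: continuous_expM].
have : `|\int[leb]_(s in `[0, T]) (expR (lam * s) * g s)| <=
   G / lam * (expR (lam * T) - 1).
  rewrite -Rintegral_expM// -RintegralZl//.
  have egi : intg leb `[0, T] (fun s => expR (lam * s) * g s) by exact: intg_expM_mul.
  apply: le_trans (le_normr_Rintegral _ egi) _ => //.
  apply: le_Rintegral => //; [exact: (integrable_norm egi)|exact: intgZ|].
  move=> s sT; rewrite normrM ger0_norm ?expR_ge0//.
  rewrite mulrA divfK ?gt_eqF// mulrC ler_wpM2r ?expR_ge0//; exact: gG.
move=> /(ler_wpM2l (expR_ge0 (- lam * T)))/le_trans; apply.
rewrite mulrCA mulrBr mulr1 -expRD mulNr addNr expR0.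
have := expR_ge0 (- (lam * T)).
have : 0 <= G / lam by rewrite divr_ge0// ltW.
by move=> *; nra.
Qed.

End scalar_ode.

(** * The sine system on the unit interval *)

Section unit_interval.
Context (R : realType).
Local Notation leb := (@lebesgue_measure R).
Local Notation mu := (mu01 R).
Local Notation ebasis := (@ebasis R).
Local Notation freq := (@freq R).
Implicit Types (f g h : R -> R).

Lemma ae_imply d (T : measurableType d) (m : {measure set T -> \bar R})
    (P Q : T -> Prop) :
  (forall x, P x -> Q x) -> {ae m, forall x, P x} -> {ae m, forall x, Q x}.
Proof.
move=> PQ [N [mN N0 sub]]; exists N; split => // x nq; apply: sub.
by apply: contra_not nq; exact: PQ.
Qed.

Lemma mu01_ae_in (P : R -> Prop) :
  (forall x, 0 < x < 1 -> P x) -> {ae mu, forall x, P x}.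
Proof.
move=> HP; exists (~` `]0, 1[%classic); split.
- by apply: measurableC; exact: measurable_itv.
- by rewrite /mu01 /= /mrestr setICl measure0.
- by move=> x /= nP; rewrite in_itv /=; apply: contra_not nP => /HP.
Qed.

Lemma mu01_integral (f : R -> \bar R) : measurable_fun setT f ->
  (\int[mu]_x f x = \int[leb]_(x in `]0%R, 1%R[) f x)%E.
Proof.
move=> mf; pose D : set (measurableTypeR R) := `]0, 1[%classic.
have mD : measurable D by exact: measurable_itv.
transitivity (\int[mu]_(x in D) f x)%E.
  rewrite [RHS]integral_mkcond; apply: ae_eq_integral => //.
    by apply/(measurable_restrictT _ mD); exact: measurable_funS mf.
  apply: mu01_ae_in => x x01 _.
  by rewrite patchE mem_set// /D /= in_itv.
apply: eq_measure_integral => A mA AD.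
by rewrite /mu01 /= /mrestr; congr (leb _); exact: setIidl AD.
Qed.

Lemma mu01_setT : mu setT = 1%E.
Proof.
rewrite /mu01 /= /mrestr setTI lebesgue_measure_itv /= lte_fin ltr01.
by rewrite -EFinB subr0.
Qed.

Lemma intg_mu01P f : measurable_fun setT f ->
  intg mu setT f <-> intg leb `]0, 1[ f.
Proof.
move=> mf; have mf' : measurable_fun setT (EFin \o f) by exact/measurable_EFinP.
have E : (\int[mu]_x `|(EFin \o f) x| = \int[leb]_(x in `]0%R, 1%R[) `|(EFin \o f) x|)%E.
  by apply: (mu01_integral (f := abse \o (EFin \o f))); exact: measurableT_comp.
split=> /integrableP[mf1 fi]; apply/integrableP; split => //.
- exact: measurable_funS mf'.
- by rewrite -E.
- by rewrite E.
Qed.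

Lemma Rintegral_mu01 f : measurable_fun setT f ->
  \int[mu]_x f x = \int[leb]_(x in `[0, 1]) f x.
Proof.
move=> mf; rewrite /Rintegral mu01_integral; last exact/measurable_EFinP.
rewrite (@integral_itv_bndoo R 0 1 (fun x => (f x)%:E) true false)//.
by apply: measurable_funS (_ : measurable_fun setT _) => //; exact/measurable_EFinP.
Qed.

Lemma continuous_measurableT f : continuous f -> measurable_fun setT f.
Proof. exact: continuous_measurable_fun. Qed.

Lemma intg_mu01_bounded f (M : R) : measurable_fun setT f ->
  (forall x, `|f x| <= M) -> intg mu setT f.
Proof.
move=> mf fM; apply: (@intg_le _ _ _ mu setT _ f (fun=> M)) => //.
apply/integrableP; split; first exact/measurable_EFinP.
apply: (@le_lt_trans _ _ (`|M|%:E * mu setT)%E).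
  by rewrite -integral_cst.
by rewrite mu01_setT mule1 ltry.
Qed.

Lemma sqint_mu01_bounded f (M : R) : measurable_fun setT f ->
  (forall x, `|f x| <= M) -> sqint mu setT f.
Proof.
move=> mf fM; split=> //; apply: (@intg_mu01_bounded _ (M ^+ 2)).
  exact: measurable_funX.
by move=> x; rewrite normrX ler_pXn2r// nnegrE; have := normr_ge0 (f x); have := fM x; lra.
Qed.

Lemma Rintegral_mu01_FTC F f : (forall x : R, is_derive x (1 : R) F (f x)) ->
  continuous f -> \int[mu]_x f x = F 1 - F 0.
Proof.
move=> dF cf; rewrite Rintegral_mu01; last exact: continuous_measurableT.
exact: Rintegral_FTC.
Qed.

Lemma is_derive_sinM (a x : R) :
  is_derive x (1 : R) (fun y => sin (a * y)) (a * cos (a * x)).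
Proof.
have h : is_derive x (1:R) (fun s => a * s) a.
  have := is_deriveZ a (is_derive_id x (1 : R)).
  by rewrite /GRing.scale /= mulr1.
have := @is_derive1_comp _ (@sin R) (fun s => a * s) x _ _ (is_derive_sin _) h.
by rewrite mulrC.
Qed.

Lemma continuous_sinM (a : R) : continuous (fun y => sin (a * y)).
Proof.
move=> x; apply: differentiable_continuous; apply/derivable1_diffP.
exact: (@ex_derive _ _ _ _ _ _ _ (is_derive_sinM a x)).
Qed.

Lemma continuous_cosM (a : R) : continuous (fun y => cos (a * y)).
Proof.
move=> x; apply: (@continuous_comp _ _ _ (fun y : R => a * y) (@cos R)).
  by apply: cvgM; [exact: cvg_cst|exact: cvg_id].
exact: continuous_cos.
Qed.

Lemma freq_gt0 k : 0 < freq k.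
Proof. by rewrite mulr_gt0// pi_gt0. Qed.

Lemma sin_natpi k : sin (k%:R * pi) = 0 :> R.
Proof.
elim: k => [|k ih]; first by rewrite mul0r sin0.
by rewrite -natr1 mulrDl mul1r sinDpi ih oppr0.
Qed.

Lemma Rintegral_cos_nat (n : nat) : (0 < n)%N ->
  \int[mu]_x cos (n%:R * pi * x) = 0.
Proof.
move=> n0; have a0 : n%:R * pi != 0 :> R.
  by rewrite mulf_neq0// ?gt_eqF ?pi_gt0// ltr0n.
have H : \int[mu]_x (n%:R * pi * cos (n%:R * pi * x)) = 0.
  rewrite (Rintegral_mu01_FTC (is_derive_sinM (n%:R * pi))).
    by rewrite mulr1 mulr0 sin0 subr0 sin_natpi.
  by move=> x; apply: cvgM; [exact: cvg_cst|exact: continuous_cosM].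
move: H; rewrite RintegralZl//; last first.
  apply: (@intg_mu01_bounded _ 1); last by move=> x; exact: cos_max.
  by apply: continuous_measurableT; exact: continuous_cosM.
by move=> /eqP; rewrite mulf_eq0 (negbTE a0) => /eqP.
Qed.

Lemma Rintegral_mu01_cst (c : R) : \int[mu]_x c = c.
Proof. by rewrite Rintegral_cst//= mu01_setT mulr1. Qed.

Lemma continuous_ebasis k : continuous (ebasis k).
Proof.
by move=> x; apply: cvgM; [exact: cvg_cst|exact: continuous_sinM].
Qed.

Lemma ebasis_bounded k x : `|ebasis k x| <= 2.
Proof.
rewrite /ebasis normrM ger0_norm ?sqrtr_ge0//.
have h : Num.sqrt 2 <= 2 :> R by rewrite -ler_sqr ?nnegrE ?sqrtr_ge0// sqr_sqrtr//; lra.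
have := sin_max (freq k * x); have := normr_ge0 (sin (freq k * x)).
have := sqrtr_ge0 (2 : R); nra.
Qed.

Lemma sqint_ebasis k : sqint mu setT (ebasis k).
Proof.
apply: (@sqint_mu01_bounded _ 2); last exact: ebasis_bounded.
by apply: continuous_measurableT; exact: continuous_ebasis.
Qed.

Lemma inner_ebasis i j : inner (ebasis i) (ebasis j) = (i == j)%:R.
Proof.
have icos (a : R) : intg mu setT (fun x => cos (a * x)).
  apply: (@intg_mu01_bounded _ 1); last by move=> x; exact: cos_max.
  by apply: continuous_measurableT; exact: continuous_cosM.
wlog ij : i j / (i <= j)%N.
  move=> W; have [/W//|/ltnW /W] := leqP i j.
  rewrite eq_sym => <-; rewrite /inner.
  by apply: eq_Rintegral => x _; rewrite mulrC.
have E : inner (ebasis i) (ebasis j) =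
    \int[mu]_x (cos ((j - i)%:R * pi * x) - cos ((j + i + 2)%:R * pi * x)).
  rewrite /inner; apply: eq_Rintegral => x _; rewrite /ebasis /freq.
  rewrite mulrACA -expr2 sqr_sqrtr//.
  have -> : (j - i)%:R * pi * x = j.+1%:R * pi * x - i.+1%:R * pi * x.
    by rewrite natrB// -!natr1; ring.
  have -> : (j + i + 2)%:R * pi * x = j.+1%:R * pi * x + i.+1%:R * pi * x.
    by rewrite !natrD -!natr1; ring.
  by rewrite cosB cosD; ring.
rewrite E RintegralB//; [|exact: icos|exact: icos].
rewrite [X in _ - X]Rintegral_cos_nat ?addnS// subr0.
have [->|ne] := eqVneq i j.
  rewrite -[RHS]Rintegral_mu01_cst; apply: eq_Rintegral => x _.
  by rewrite subnn !mul0r cos0.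
by rewrite Rintegral_cos_nat// subn_gt0 ltn_neqAle ne.
Qed.

Lemma bernoulli_ge (x : R) n : -1 <= x -> 1 + n%:R * x <= (1 + x) ^+ n.
Proof.
move=> x1; elim: n => [|n ih]; first by rewrite mul0r addr0 expr0.
rewrite exprS; apply: le_trans (ler_wpM2l _ ih); last by lra.
have n0 : (0 : R) <= n%:R by rewrite ler0n.
by rewrite -natr1; have := mulr_ge0 n0 (sqr_ge0 x); rewrite expr2; nra.
Qed.

(** Both bounds are Bernoulli's inequality, the second one after multiplication
    by [(1 + q ^ n) ^ (2 ^ n)]. They make [(1 - q ^ n) ^ (2 ^ n)] a polynomial
    approximation of the indicator function of [q < 1/2]. *)
Lemma step_poly_bounds (q : R) n : 0 <= q <= 1 ->
  1 - (2 * q) ^+ n <= (1 - q ^+ n) ^+ (2 ^ n) /\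
  0 <= (1 - q ^+ n) ^+ (2 ^ n) <= 1 /\
  ((0 < q) -> (1 - q ^+ n) ^+ (2 ^ n) <= (2 * q) ^- n).
Proof.
move=> /andP[q0 q1]; have qn0 : 0 <= q ^+ n by rewrite exprn_ge0.
have qn1 : q ^+ n <= 1 by rewrite exprn_ile1.
split; [|split].
- have := @bernoulli_ge (- q ^+ n) (2 ^ n) _; rewrite mulrN natrX -exprMn.
  by apply; lra.
- by rewrite exprn_ge0 ?exprn_ile1//; lra.
- move=> qp; have p0 : 0 < (2 * q) ^+ n by rewrite exprn_gt0 ?mulr_gt0.
  have B : (2 * q) ^+ n <= (1 + q ^+ n) ^+ (2 ^ n).
    have := @bernoulli_ge (q ^+ n) (2 ^ n) _; rewrite natrX -exprMn.
    move=> /(_ _)/le_trans h; apply: le_trans (h _ _ (lexx _)); lra.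
  have M : (1 - q ^+ n) ^+ (2 ^ n) * (1 + q ^+ n) ^+ (2 ^ n) <= 1.
    rewrite -exprMn; apply: exprn_ile1; nra.
  rewrite -[leLHS]mulr1 -[X in _ * X](divff (lt0r_neq0 p0)) mulrA.
  rewrite ler_pdivrMr// mulVf ?gt_eqF//; apply: le_trans M.
  by rewrite ler_wpM2l// exprn_ge0//; lra.
Qed.

Lemma step_poly_cvg (q : R) : 0 <= q <= 1 -> q != 2^-1 ->
  (fun n => (1 - q ^+ n) ^+ (2 ^ n)) @ \oo --> ((q < 2^-1)%R%:R : R).
Proof.
move=> q01 qh; have /andP[q0 q1] := q01.
have [lt|gt|eq] := ltgtP q 2^-1; last by rewrite eq eqxx in qh.
  apply: (@squeeze_cvgr _ _ _ _ (fun n => 1 - (2 * q) ^+ n) (cst 1)).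
  - apply: nearW => n; have [h1 [/andP[_ h2] _]] := step_poly_bounds n q01.
    by rewrite h1 h2.
  - rewrite -[X in _ --> X]subr0; apply: cvgB; first exact: cvg_cst.
    by apply: cvg_expr; rewrite ger0_norm; lra.
  - exact: cvg_cst.
apply: (@squeeze_cvgr _ _ _ _ (cst 0) (fun n => ((2 * q)^-1) ^+ n)).
- apply: nearW => n; have [_ [/andP[h2 _] h3]] := step_poly_bounds n q01.
  by rewrite h2 /= exprVn h3//; lra.
- exact: cvg_cst.
- apply: cvg_expr; rewrite ger0_norm ?invr_ge0; last by lra.
  by rewrite invf_lt1; lra.
Qed.

(** The sine system is complete.  If [g] is orthogonal to every [sin (k pi x)]
    then [g sin (pi x)] is orthogonal to every polynomial in [cos (pi x)].  The
    polynomials [(1 - q^n)^(2^n)] converge boundedly to the indicator function of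
    [q < 1/2]; for [q] affine in the cosine this set is an interval [0, a[.  So all
    primitives of [g sin (pi x)] vanish. *)
Lemma sine_complete g : sqint mu setT g -> (forall k, inner g (ebasis k) = 0) ->
  ae_eq mu setT g (fun=> 0).
Proof.
move=> sg g0.
have s20 : Num.sqrt 2 != 0 :> R by rewrite gt_eqF// sqrtr_gt0.
have bint f M : measurable_fun setT f -> (forall x, `|f x| <= M) ->
    intg mu setT (fun x => g x * f x).
  move=> mf fM; apply: sqint_mul => //.
  exact: (sqint_mu01_bounded mf fM).
have msin (a : R) : measurable_fun setT (fun x => sin (a * x)).
  by apply: continuous_measurableT; exact: continuous_sinM.
have mcos (a : R) : measurable_fun setT (fun x => cos (a * x)).
  by apply: continuous_measurableT; exact: continuous_cosM.
have msc (a : R) m : measurable_fun setT (fun x => sin (a * x) * cos (pi * x) ^+ m).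
  by apply: measurable_funM => //; exact: measurable_funX.
have bsc (a : R) m x : `|sin (a * x) * cos (pi * x) ^+ m| <= 1.
  rewrite normrM normrX mulr_ile1 ?exprn_ge0 ?sin_max//.
  by rewrite exprn_ile1 ?cos_max.
have S m k : \int[mu]_x (g x * (sin (k%:R * pi * x) * cos (pi * x) ^+ m)) = 0.
  elim: m k => [|m ih] k.
    case: k => [|k].
      rewrite -[RHS](@Rintegral_mu01_cst 0); apply: eq_Rintegral => x _.
      by rewrite !mul0r sin0 !(mul0r,mulr0).
    have := g0 k; rewrite /inner.
    under eq_Rintegral do rewrite /ebasis mulrCA.
    rewrite RintegralZl//; last first.
      by apply: (@bint _ 1) => // x; exact: sin_max.
    move=> /eqP; rewrite mulf_eq0 (negbTE s20) => /eqP H.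
    rewrite -[RHS]H; apply: eq_Rintegral => x _.
    by rewrite expr0 mulr1.
  case: k => [|k].
    rewrite -[RHS](@Rintegral_mu01_cst 0); apply: eq_Rintegral => x _.
    by rewrite !mul0r sin0 !(mul0r,mulr0).
  transitivity (\int[mu]_x
     (2^-1 * (g x * (sin (k.+2%:R * pi * x) * cos (pi * x) ^+ m)) +
      2^-1 * (g x * (sin (k%:R * pi * x) * cos (pi * x) ^+ m)))).
    apply: eq_Rintegral => x _.
    have -> : k.+2%:R * pi * x = k.+1%:R * pi * x + pi * x.
      by rewrite -(natr1 k.+1); ring.
    have -> : k%:R * pi * x = k.+1%:R * pi * x - pi * x.
      by rewrite -(natr1 k); ring.
    by rewrite sinD sinB exprS; field.
  have bi j : intg mu setT (fun x => g x * (sin (j%:R * pi * x) * cos (pi * x) ^+ m)).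
    exact: bint.
  rewrite RintegralD//; [|exact: intgZ|exact: intgZ].
  rewrite !RintegralZl//; [|exact: bi|exact: bi].
  by have := ih k; have := ih k.+2 => /= -> ->; rewrite !mulr0 addr0.
pose h x := g x * sin (pi * x).
have hint : intg mu setT h.
  by apply: (@bint _ 1) => // x; exact: sin_max.
have P (p : {poly R}) : \int[mu]_x (h x * p.[cos (pi * x)]) = 0.
  transitivity (\int[mu]_x (\sum_(i < size p)
     p`_i * (g x * (sin (1%:R * pi * x) * cos (pi * x) ^+ i)))).
    apply: eq_Rintegral => x _; rewrite horner_coef /h mulr_sumr.
    by apply: eq_bigr => i _; rewrite mul1r; ring.
  have bi (i : nat) : intg mu setT
     (fun x => g x * (sin (1%:R * pi * x) * cos (pi * x) ^+ i)) by exact: bint.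
  rewrite Rintegral_sum//; last by move=> i; exact: intgZ.
  apply: big1 => i _; rewrite RintegralZl//; last exact: bi.
  by have := S i 1%N => /= ->; rewrite mulr0.
have mh : measurable_fun setT h by exact: intg_measurable hint.
have mlt (a : R) : measurable_fun setT (fun x : R => (x < a)%R%:R : R).
  have -> : (fun x : R => (x < a)%R%:R) =
      (fun x => \1_(`]-oo, a[%classic : set R) x) :> (R -> R).
    apply/funext => x; rewrite indicE; have [h0|h0] := ltP x a.
      by rewrite mem_set//= in_itv.
    by rewrite memNset//= in_itv /= ltNge h0.
  exact: measurable_indic.
have Z (a : R) : 0 < a < 1 -> \int[mu]_x (h x * (x < a)%R%:R) = 0.
  move=> /andP[a0 a1].
  pose c := cos (pi * a).
  pose q x := 2^-1 - 4^-1 * (cos (pi * x) - c).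
  have qE x : 0 <= q x <= 1.
    rewrite /q /c; have := cos_geN1 (pi * x); have := cos_le1 (pi * x).
    by have := cos_geN1 (pi * a); have := cos_le1 (pi * a); lra.
  pose p n : {poly R} := (1 - ((2^-1 + 4^-1 * c)%:P - 4^-1 *: 'X) ^+ n) ^+ (2 ^ n).
  have pE n x : (p n).[cos (pi * x)] = (1 - q x ^+ n) ^+ (2 ^ n).
    rewrite /p !(hornerE, horner_exp) /q; congr ((1 - _ ^+ _) ^+ _); ring.
  (* a version of [h] vanishing where the cosine is not injective and at [a],
     where [q] takes the value 1/2 and the polynomials do not converge *)
  pose h' x := if (x == a) || (x <= 0) || (1 <= x) then 0 else h x.
  have hh' : {ae mu, forall x, h x = h' x}.
    exists (~` `]0, 1[%classic `|` [set a]); split.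
    - by apply: measurableU => //; apply: measurableC; exact: measurable_itv.
    - apply: null_set_setU => //.
      + by apply: measurableC; exact: measurable_itv.
      + by rewrite /mu01 /= /mrestr setICl measure0.
      + apply/eqP; rewrite eq_le measure_ge0 andbT.
        rewrite -(lebesgue_measure_set1 a) /mu01 /mrestr /=.
        by apply: le_measure; rewrite ?inE//; apply: measurableI.
    - move=> x /= nh; apply: contrapT => /not_orP[/= /contrapT].
      rewrite in_itv /= => /andP[x0 x1] /eqP xa; apply: nh.
      by rewrite /h' (negbTE xa) !leNgt x0 x1.
  have mh' : measurable_fun setT h'.
    apply: measurable_fun_ifT => //.
    apply: measurable_or; first apply: measurable_or.
    - exact: measurable_fun_eqr.
    - exact: measurable_fun_ler.
    - exact: measurable_fun_ler.
  have h'int : intg mu setT h'.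
    by apply: (@intg_ae _ _ _ mu setT measurableT h) => //; apply: ae_imply hh' => x ->.
  have cv x : setT x -> (fun n => h' x * (p n).[cos (pi * x)]) @ \oo -->
      h' x * (x < a)%R%:R.
    move=> _; under eq_fun do rewrite pE.
    rewrite /h'; case: ifPn => [_|].
      by rewrite mul0r; under eq_fun do rewrite mul0r; exact: cvg_cst.
    rewrite !negb_or -!ltNge => /andP[/andP[xa x0] x1].
    have ipi (y : R) : 0 < y -> y < 1 -> pi * y \in `[0, pi].
      move=> y0 y1; rewrite in_itv /=; have := pi_gt0 R => pi0.
      by apply/andP; split; [rewrite mulr_ge0// ltW|rewrite ger_pMr// ltW].
    have -> : (x < a) = (q x < 2^-1).
      rewrite /q gtrBl pmulr_rgt0// subr_gt0 /c.
      by rewrite ltr_cos ?ipi// ltr_pM2l// pi_gt0.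
    apply: cvgM; first exact: cvg_cst.
    apply: step_poly_cvg => //; rewrite /q.
    apply/eqP => E; have {}E : cos (pi * x) = cos (pi * a) by rewrite /c in E; lra.
    have := cos_inj (ipi _ x0 x1) (ipi _ a0 a1) E.
    by move/mulfI => /(_ (lt0r_neq0 (pi_gt0 R))) /eqP; apply/negP.
  have mp n : measurable_fun setT (fun x => (p n).[cos (pi * x)]).
    under eq_fun do rewrite pE; apply: measurable_funX.
    apply: measurable_funB => //; apply: measurable_funX.
    apply: measurable_funB => //; apply: measurable_funM => //.
    exact: measurable_funB.
  have bp n x : `|(p n).[cos (pi * x)]| <= 1.
    rewrite pE; have [_ [/andP[b1 b2] _]] := step_poly_bounds n (qE x).
    by rewrite ger0_norm.
  have bd n x : setT x -> `|h' x * (p n).[cos (pi * x)]| <= `|h' x|.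
    by move=> _; rewrite normrM ler_piMr.
  have [_] := @Rintegral_dominated _ _ _ mu setT measurableT
    (fun n x => h' x * (p n).[cos (pi * x)]) _ (fun x => `|h' x|)
    (fun n => measurable_funM mh' (mp n)) cv (integrable_norm h'int)
    bd.
  have -> : (fun n => \int[mu]_x (h' x * (p n).[cos (pi * x)])) = fun=> 0.
    apply/funext => n; rewrite -(P (p n)); apply: Rintegral_ae => //.
    - exact: (measurable_funM mh' (mp n)).
    - exact: (measurable_funM mh (mp n)).
    - by apply: ae_imply hh' => x ->.
  have -> : \int[mu]_x (h x * (x < a)%R%:R) = \int[mu]_x (h' x * (x < a)%R%:R).
    apply: Rintegral_ae => //.
      exact: (measurable_funM mh (mlt a)).
      exact: (measurable_funM mh' (mlt a)).
    by apply: ae_imply hh' => x ->.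
  by move=> /cvg_lim H; rewrite -H// lim_cst.
have {}Z (a : R) : \int[mu]_x (h x * (x < a)%R%:R) = 0.
  have [a0|a0] := leP a 0.
    rewrite -[RHS](@Rintegral_mu01_cst 0); apply: Rintegral_ae => //.
      exact: (measurable_funM mh (mlt a)).
    apply: mu01_ae_in => x /andP[x0 _] _.
    by rewrite ltNge (le_trans a0 (ltW x0)) mulr0.
  have [a1|a1] := ltP a 1; first by apply: Z; rewrite a0.
  rewrite -(P 1); apply: Rintegral_ae => //.
    exact: (measurable_funM mh (mlt a)).
    apply: (measurable_funM mh); under eq_fun do rewrite hornerC.
    exact: measurable_cst.
  apply: mu01_ae_in => x /andP[_ x1] _.
  by rewrite (lt_le_trans x1 a1) hornerC.
pose I : set (measurableTypeR R) := `]0, 1[%classic.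
have mI : measurable I by exact: measurable_itv.
pose f := h \_ I.
have fint : intg leb setT f by apply: intg_patch => //; apply/intg_mu01P.
have fx (x : R) : intg leb `]-oo, x] f by apply: integrableS fint.
have F0 (x : R) : \int[leb]_(t in `]-oo, x]) f t = 0.
  rewrite -Rintegral_itv_bndo_bndc; last by apply: integrableS fint.
  rewrite -(Z x) /Rintegral mu01_integral; last first.
    by apply/measurable_EFinP; exact: (measurable_funM mh (mlt x)).
  congr fine; rewrite integral_mkcond [RHS]integral_mkcond.
  apply: eq_integral => t _; rewrite !patchE /f patchE /I.
  have [tx|tx] := ltP t x.
    rewrite mem_set /= ?in_itv//= mulr1.
    by case: ifP.
  rewrite memNset /= ?in_itv/= ?ltNge ?tx// mulr0.
  by case: ifP.
have := FTC1Ny fx (open_integrable_locally openT fint).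
have -> : (fun x : R => \int[leb]_(t in `]-oo, x]) f t) = cst 0.
  by apply/funext => x; rewrite F0.
move=> [N [mN N0 sub]].
have muN : mu N = 0%E.
  apply/eqP; rewrite eq_le measure_ge0 andbT -N0 /mu01 /= /mrestr.
  by apply: le_measure; rewrite ?inE//; apply: measurableI.
exists (N `|` ~` I); split.
- by apply: measurableU => //; exact: measurableC.
- apply: null_set_setU => //; first exact: measurableC.
  by rewrite /mu01 /= /mrestr setICl measure0.
- move=> x /= ng; apply: contrapT => /not_orP[Nx /contrapT Ix]; apply: ng => _.
  have [_] : derivable (cst 0 : R -> R) x 1 /\ (cst 0 : R -> R)^`()%classic x = f x.
    by apply: contrapT => nd; apply: Nx; exact: sub.
  rewrite derive1_cst /f patchE mem_set// /h => /esym/eqP.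
  rewrite mulf_eq0 => /orP[/eqP//|].
  move: Ix; rewrite /I /= in_itv /= => /andP[x0 x1].
  rewrite gt_eqF// sin_gt0_pi// mulr_gt0 ?pi_gt0//=.
  by rewrite gtr_pMr// pi_gt0.
Qed.

End unit_interval.

(** * Elements of H and square-integrable functions *)

Section L2_elements.
Context (R : realType).
Local Notation mu := (mu01 R).
Implicit Types (f g h : R -> R) (phi psi : L2 R).

Lemma Lnorm2_sqr f : ('N[mu]_2%:R%:E[EFin \o f] `^ 2 =
  \int[mu]_x (f x ^+ 2)%:E)%E.
Proof.
rewrite powR_Lnorm ?pnatr_eq0//; apply: eq_integral => x _.
by rewrite /= powR_mulrn ?normr_ge0// real_normK ?num_real.
Qed.

Lemma L2norm_sqr f : sqint mu setT f -> L2norm f ^+ 2 = \int[mu]_x (f x ^+ 2).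
Proof.
move=> sf; rewrite /Rintegral -Lnorm2_sqr /L2norm.
have := Lnorm2_sqr f; set N := 'N[_]_ _[_]%E.
have N0 : (0 <= N)%E by exact: Lnorm_ge0.
move=> E; have : (N `^ 2)%E \is a fin_num.
  by rewrite E; exact: integrable_fin_num sf.2.
move: N0 {E}; case: N => [r r0 _|_|//]; last by rewrite poweRyr ?pnatr_eq0.
by rewrite /= powR_mulrn// -lee_fin.
Qed.

Lemma L2norm_ge0 f : 0 <= L2norm f.
Proof. by rewrite fine_ge0// Lnorm_ge0. Qed.

Lemma L2_measurable phi : measurable_fun setT (phi : R -> R).
Proof.
rewrite /aqEqMfun_to_fun.
exact: (@measurable_funPT _ _ _ _
  (repr (phi : {mfun_ mu, measurableTypeR R >-> measurableTypeR R}))%qT).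
Qed.

Lemma sqint_L2 phi : sqint mu setT phi.
Proof.
have mphi := L2_measurable phi; split=> //.
have fin : finite_norm mu 2%:R%:E phi by exact: Lebesgue_finite.
apply/integrableP; split; first by apply/measurable_EFinP; exact: measurable_funX.
have := Lnorm2_sqr phi; move: fin; rewrite /finite_norm.
set N := 'N[_]_ _[_]%E => fin E.
apply: (@le_lt_trans _ _ (\int[mu]_x ((phi : R -> R) x ^+ 2)%:E)%E).
  rewrite le_eqVlt; apply/orP; left; apply/eqP; apply: eq_integral => x _.
  by rewrite /= ger0_norm// sqr_ge0.
by rewrite -E poweR_lty.
Qed.

Lemma finite_norm2 f : sqint mu setT f -> finite_norm mu 2%:R%:E f.
Proof.
move=> sf; rewrite /finite_norm.
apply: (@lty_poweRy _ _ 2); first by rewrite pnatr_eq0.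
by rewrite Lnorm2_sqr -ge0_fin_numE ?(integrable_fin_num measurableT sf.2)//
  integral_ge0// => x _; rewrite lee_fin sqr_ge0.
Qed.

Lemma exists_L2 f : sqint mu setT f -> exists phi : L2 R, ae_eq mu setT f phi.
Proof.
move=> sf.
pose F : {mfun measurableTypeR R >-> measurableTypeR R} :=
  MeasurableFun.Pack (MeasurableFun.Class
    (isMeasurableFun.Build _ _ (measurableTypeR R) (measurableTypeR R) f sf.1)).
pose q : {mfun_ mu, measurableTypeR R >-> measurableTypeR R} := (\pi F)%qT.
have Fq : ae_eq mu setT f (repr q : R -> R).
  have : (repr q == F %[mod {mfun_ mu, measurableTypeR R >-> measurableTypeR R}])%qT.
    by rewrite reprK.
  rewrite eqmodE => /asboolP; apply: ae_imply => x h _.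
  by rewrite h.
have mq : measurable_fun setT (repr q : R -> R) by exact: (@measurable_funPT _ _ _ _ (repr q)).
have sq : sqint mu setT (repr q : R -> R).
  split => //; apply: (@intg_ae _ _ _ mu setT measurableT _ _ _ _ sf.2).
    exact: measurable_funX.
  by apply: ae_imply Fq => x /= /(_ I) -> _.
have fq : finite_norm mu 2%:R%:E q by exact: finite_norm2.
by exists (LebesgueSpace.Pack (LebesgueSpace.Class
  (isFinLebesgue.Build _ _ _ mu 2%:R%:E (lee1n 2) q fq))).
Qed.

Lemma L2distE phi psi : mdist phi psi ^+ 2 =
  \int[mu]_x (((phi : R -> R) x - (psi : R -> R) x) ^+ 2).
Proof.
rewrite -(@L2norm_sqr ((phi : R -> R) \- (psi : R -> R)))//.
apply: sqintB => //; exact: sqint_L2.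
Qed.

Lemma L2_ae_eq phi psi : ae_eq mu setT phi psi -> phi = psi.
Proof.
move=> h; apply: mdist_positivity; apply/eqP.
suff : mdist phi psi ^+ 2 = 0 by move=> /eqP; rewrite sqrf_eq0.
rewrite L2distE -[RHS](Rintegral_mu01_cst 0).
apply: Rintegral_ae => //.
  by apply: measurable_funX; apply: measurable_funB; exact: L2_measurable.
by apply: ae_imply h => x /(_ I) -> _; rewrite subrr expr0n.
Qed.

End L2_elements.

(** * Sine series *)

Section fourier_series.
Context (R : realType).
Local Notation mu := (mu01 R).
Local Notation ebasis := (@ebasis R).
Local Notation H := (sqint mu setT).
Implicit Types (f g h : R -> R) (c : nat -> R) (n k : nat) (M : R).

Lemma innerC f g : inner f g = inner g f.
Proof. by apply: eq_Rintegral => x _; rewrite mulrC. Qed.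

Lemma innerDl f g h : H f -> H g -> H h ->
  inner (fun x => f x + g x) h = inner f h + inner g h.
Proof.
move=> sf sg sh; rewrite /inner -RintegralD//; try exact: sqint_mul.
by apply: eq_Rintegral => x _; rewrite mulrDl.
Qed.

Lemma innerZl a f h : H f -> H h -> inner (fun x => a * f x) h = a * inner f h.
Proof.
move=> sf sh; rewrite /inner -RintegralZl//; last exact: sqint_mul.
by apply: eq_Rintegral => x _; rewrite mulrA.
Qed.

Lemma innerBl f g h : H f -> H g -> H h ->
  inner (fun x => f x - g x) h = inner f h - inner g h.
Proof.
move=> sf sg sh; rewrite /inner -RintegralB//; try exact: sqint_mul.
by apply: eq_Rintegral => x _; rewrite mulrBl.
Qed.

Lemma inner_ae f g h : H f -> H g -> H h -> ae_eq mu setT f g ->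
  inner f h = inner g h.
Proof.
move=> sf sg sh fg; apply: Rintegral_ae => //.
- exact: (measurable_funM sf.1 sh.1).
- exact: (measurable_funM sg.1 sh.1).
- by apply: ae_imply fg => x /(_ I) -> _.
Qed.

Lemma inner_sqr f : inner f f = \int[mu]_x (f x ^+ 2).
Proof. by []. Qed.

Lemma inner_ge0 f : 0 <= inner f f.
Proof. by apply: Rintegral_ge0 => x _; rewrite -expr2 sqr_ge0. Qed.

Lemma inner_cauchy_schwarz f g : H f -> H g ->
  inner f g ^+ 2 <= inner f f * inner g g.
Proof. by move=> sf sg; exact: sqint_cauchy_schwarz. Qed.

Definition sine_sum c n (x : R) : R := \sum_(k < n) c k * ebasis k x.

Lemma sqint_sine_sum c n : H (sine_sum c n).
Proof. by apply: sqint_sum => // k; apply: sqintZ => //; exact: sqint_ebasis. Qed.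

Lemma inner_sine_sum c n f : H f ->
  inner (sine_sum c n) f = \sum_(k < n) c k * inner f (ebasis k).
Proof.
move=> sf; elim: n => [|n ih].
  rewrite big_ord0 -[RHS](Rintegral_mu01_cst 0); apply: eq_Rintegral => x _.
  by rewrite /sine_sum big_ord0 mul0r.
rewrite big_ord_recr /= -ih -(innerC (ebasis n)) -innerZl//; last exact: sqint_ebasis.
rewrite -innerDl//; [|exact: sqint_sine_sum|by apply: sqintZ => //; exact: sqint_ebasis].
by apply: eq_Rintegral => x _; rewrite /sine_sum big_ord_recr.
Qed.

Lemma coef_sine_sum c n k :
  inner (sine_sum c n) (ebasis k) = if (k < n)%N then c k else 0.
Proof.
rewrite inner_sine_sum; last exact: sqint_ebasis.
under eq_bigr => i _ do rewrite inner_ebasis.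
case: ifPn => [kn|nk].
  rewrite (bigD1 (Ordinal kn))//= eqxx mulr1 big1 ?addr0// => i ik.
  rewrite (negbTE (_ : k != i :> nat)) ?mulr0//.
  by move: ik; apply: contraNneq => ki; apply/eqP/val_inj.
apply: big1 => i _; rewrite (negbTE (_ : k != i :> nat)) ?mulr0//.
by apply: contraNneq nk => ->; exact: ltn_ord.
Qed.

Lemma inner_sub_sine_sum c n f : H f ->
  inner (fun x => f x - sine_sum c n x) (fun x => f x - sine_sum c n x) =
  inner f f - 2 * \sum_(k < n) c k * inner f (ebasis k) + \sum_(k < n) c k ^+ 2.
Proof.
move=> sf; have ss := sqint_sine_sum c n.
have sd : H (fun x => f x - sine_sum c n x) by exact: sqintB.
rewrite innerBl// innerC innerBl// (innerC f (fun x => _)).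
rewrite -(innerC (fun x => f x - sine_sum c n x) (sine_sum c n)) innerBl//.
rewrite (innerC f (sine_sum c n)) !inner_sine_sum//.
under [X in _ - (_ - X)]eq_bigr => k _ do rewrite coef_sine_sum ltn_ord -expr2.
by ring.
Qed.

Lemma bessel f n : H f -> \sum_(k < n) inner f (ebasis k) ^+ 2 <= inner f f.
Proof.
move=> sf; have := inner_sub_sine_sum (fun k => inner f (ebasis k)) n sf.
have := inner_ge0 (fun x => f x - sine_sum (fun k => inner f (ebasis k)) n x).
move=> /[swap] ->; under eq_bigr do rewrite -expr2; lra.
Qed.

Lemma sine_sum_sub c m n : (m <= n)%N ->
  \int[mu]_x ((sine_sum c n x - sine_sum c m x) ^+ 2) =
  \sum_(k < n) c k ^+ 2 - \sum_(k < m) c k ^+ 2.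
Proof.
move=> mn; have ss := sqint_sine_sum c n.
have := inner_sub_sine_sum c m ss; rewrite /inner.
under eq_Rintegral do rewrite -expr2; move=> ->.
rewrite -/(inner _ _) inner_sine_sum//.
have -> : \sum_(k < m) c k * inner (sine_sum c n) (ebasis k) = \sum_(k < m) c k ^+ 2.
  by apply: eq_bigr => k _; rewrite coef_sine_sum (leq_trans (ltn_ord k) mn) expr2.
have -> : \sum_(k < n) c k * inner (sine_sum c n) (ebasis k) = \sum_(k < n) c k ^+ 2.
  by apply: eq_bigr => k _; rewrite coef_sine_sum ltn_ord expr2.
by ring.
Qed.

Lemma sums_nondecreasing c : nondecreasing_seq (fun n => \sum_(k < n) c k ^+ 2).
Proof.
apply/nondecreasing_seqP => n; rewrite big_ord_recr /= lerDl; exact: sqr_ge0.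
Qed.

Lemma riesz_fischer c M : (forall n, \sum_(k < n) c k ^+ 2 <= M) ->
  exists2 f, H f & (forall k, inner f (ebasis k) = c k) /\
    (fun n => \int[mu]_x ((sine_sum c n x - f x) ^+ 2)) @ \oo --> 0.
Proof.
move=> cM; have nd := sums_nondecreasing c.
have cv : cvgn (fun n => \sum_(k < n) c k ^+ 2).
  by apply: nondecreasing_is_cvgn => //; exists M => _ [n _ <-].
set s := (fun n => \sum_(k < n) c k ^+ 2) in nd cv.
have sl n : s n <= limn s by exact: nondecreasing_cvgn_le.
have tail (e : R) : 0 < e -> exists N, forall n, (N <= n)%N -> limn s - s n <= e.
  move=> e0; have /cvgrPdist_le/(_ e e0)[N _ HN] := cv.
  by exists N => n /HN /=; rewrite ger0_norm// subr_ge0.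
have Cauchy (e : R) : 0 < e -> exists N, forall m n, (N <= m)%N -> (N <= n)%N ->
    \int[mu]_x ((sine_sum c m x - sine_sum c n x) ^+ 2) <= e.
  move=> e0; have [N HN] := tail e e0; exists N => m n Nm Nn.
  wlog mn : m n Nm Nn / (n <= m)%N.
    move=> W; have [/W|/ltnW mn] := leqP n m; first exact.
    have := W n m Nn Nm mn; apply: le_trans; rewrite le_eqVlt; apply/orP; left.
    by apply/eqP; apply: eq_Rintegral => x _; rewrite -sqrrN opprB.
  rewrite sine_sum_sub//; have := HN n Nn; have := sl m.
  by rewrite /s; lra.
have [f sf Hf] := sqint_complete measurableT (sqint_sine_sum c) Cauchy.
have cvf : (fun n => \int[mu]_x ((sine_sum c n x - f x) ^+ 2)) @ \oo --> 0.
  apply/cvgrPdist_le => e e0; have [N HN] := Hf e e0; exists N => // n /HN.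
  rewrite sub0r normrN ger0_norm//.
  by apply: Rintegral_ge0 => x _; exact: sqr_ge0.
exists f => //; split => // k.
apply/eqP; rewrite -subr_eq0 -sqrf_eq0 eq_le sqr_ge0 andbT.
apply/ler_addgt0Pr => e e0; rewrite add0r.
have [N HN] := Hf e e0.
have ss := sqint_sine_sum c (N + k.+1).
have -> : inner f (ebasis k) - c k =
    - inner (fun x => sine_sum c (N + k.+1) x - f x) (ebasis k).
  rewrite innerBl//; last exact: sqint_ebasis.
  by rewrite coef_sine_sum ifT ?opprB// addnS ltnS leq_addl.
rewrite sqrrN; apply: le_trans (inner_cauchy_schwarz _ _) _.
- by apply: sqintB.
- exact: sqint_ebasis.
- by rewrite inner_ebasis eqxx mulr1; apply: HN; rewrite leq_addr.
Qed.

(** Parseval: the Riesz-Fischer limit of the sine series of [f] has the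
    coefficients of [f], so it is [f] by completeness. *)
Lemma sine_series_cvg f : H f ->
  (fun n => \int[mu]_x ((sine_sum (fun k => inner f (ebasis k)) n x - f x) ^+ 2))
    @ \oo --> 0.
Proof.
move=> sf; have bf n := bessel n sf.
have [g sg [gE gcv]] := @riesz_fischer (fun k => inner f (ebasis k)) _ bf.
have fg : ae_eq mu setT (fun x => g x - f x) (fun=> 0).
  apply: sine_complete; first exact: sqintB.
  by move=> k; rewrite innerBl ?gE ?subrr//; exact: sqint_ebasis.
apply: cvg_trans gcv; apply: near_eq_cvg; apply: nearW => n.
have ss := sqint_sine_sum (fun k => inner f (ebasis k)) n.
apply: Rintegral_ae => //.
- by apply: measurable_funX; apply: measurable_funB; [exact: ss.1|exact: sg.1].
- by apply: measurable_funX; apply: measurable_funB; [exact: ss.1|exact: sf.1].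
- by apply: ae_imply fg => x /(_ I)/eqP; rewrite subr_eq0 => /eqP -> _.
Qed.

Lemma inner_cvg (f_ : nat -> R -> R) f g : (forall n, H (f_ n)) -> H f -> H g ->
  (fun n => \int[mu]_x ((f_ n x - f x) ^+ 2)) @ \oo --> 0 ->
  (fun n => inner (f_ n) g) @ \oo --> inner f g.
Proof.
move=> sfn sf sg cv; apply/cvgrPdist_le => e e0.
have p0 : 0 < e ^+ 2 / (inner g g + 1).
  by rewrite divr_gt0 ?exprn_gt0// ltr_wpDl// inner_ge0.
have /cvgrPdist_le/(_ _ p0)[N _ HN] := cv; exists N => // n /HN /=.
rewrite sub0r normrN ger0_norm; last by apply: Rintegral_ge0 => x _; exact: sqr_ge0.
move=> h; rewrite distrC -innerBl//.
rewrite -ler_sqr ?nnegrE//; last exact: ltW.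
rewrite real_normK ?num_real//.
apply: le_trans (inner_cauchy_schwarz _ sg) _; first exact: sqintB.
apply: le_trans (ler_wpM2r (inner_ge0 g) h) _.
rewrite mulrAC ler_pdivrMr; last by rewrite ltr_wpDl// inner_ge0.
by rewrite ler_wpM2l ?sqr_ge0// lerDl.
Qed.

Lemma parseval f g : H f -> H g ->
  (fun n => \sum_(k < n) inner f (ebasis k) * inner g (ebasis k)) @ \oo -->
  inner f g.
Proof.
move=> sf sg.
have -> : (fun n => \sum_(k < n) inner f (ebasis k) * inner g (ebasis k)) =
    (fun n => inner (sine_sum (fun k => inner f (ebasis k)) n) g).
  by apply/funext => n; rewrite inner_sine_sum.
apply: inner_cvg => //; [|exact: sine_series_cvg].
by move=> n; exact: sqint_sine_sum.
Qed.

Lemma coef_inj f g : H f -> H g ->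
  (forall k, inner f (ebasis k) = inner g (ebasis k)) -> ae_eq mu setT f g.
Proof.
move=> sf sg fg; have : ae_eq mu setT (fun x => f x - g x) (fun=> 0).
  apply: sine_complete; first exact: sqintB.
  by move=> k; rewrite innerBl ?fg ?subrr//; exact: sqint_ebasis.
by apply: ae_imply => x h _; move: (h I) => /eqP; rewrite subr_eq0 => /eqP.
Qed.

Lemma inner_le_of_coef f M : H f ->
  (forall n, \sum_(k < n) inner f (ebasis k) ^+ 2 <= M) -> inner f f <= M.
Proof.
move=> sf hM; apply: (cvgr_to_le (parseval sf sf)); apply: nearW => n.
by under eq_bigr do rewrite -expr2; exact: hM.
Qed.

Lemma exists_coef c M : (forall n, \sum_(k < n) c k ^+ 2 <= M) ->
  exists phi : L2 R, coef phi = c.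
Proof.
move=> cM; have [f sf [fc _]] := riesz_fischer cM.
have [phi fphi] := exists_L2 sf; exists phi; apply/funext => k.
by rewrite -(fc k) /coef; apply/esym/inner_ae => //;
  [exact: sqint_L2|exact: sqint_ebasis].
Qed.

Fact coef0_exists : exists phi : L2 R, coef phi = fun=> 0.
Proof.
apply: (@exists_coef _ 0) => n; rewrite big1// => k _; exact: expr0n.
Qed.

(** The inverse of [coef] on square-summable sequences, which lets the whole
    argument be run on sequences of coefficients; other sequences are sent to
    the zero element. *)
Definition of_coef c : L2 R :=
  xget (projT1 (cid coef0_exists)) [set phi : L2 R | coef phi = c].

Lemma of_coefK c M : (forall n, \sum_(k < n) c k ^+ 2 <= M) -> coef (of_coef c) = c.
Proof.
by move=> /exists_coef[phi h]; rewrite /of_coef; case: xgetP => // /(_ phi).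
Qed.

Lemma coef_injective : injective (@coef R).
Proof.
move=> phi psi h; apply: L2_ae_eq; apply: coef_inj; try exact: sqint_L2.
by move=> k; exact: (congr1 (fun c => c k) h).
Qed.

Lemma of_coef_coef : cancel (@coef R) of_coef.
Proof.
move=> phi; apply: coef_injective; apply: (@of_coefK _ (inner phi phi)) => n.
by apply: bessel; exact: sqint_L2.
Qed.

End fourier_series.

(** * Convolution of sequences in weighted spaces *)

Section weighted_convolution.
Context (R : realType).
Implicit Types (a b c h p : nat -> R) (m n k j N : nat) (M Z : R).

Lemma sum_injective_le (D : pred nat) (s : nat -> nat) h M N :
  (forall m m', D m -> D m' -> s m = s m' -> m = m') ->
  (forall j, 0 <= h j) -> (forall n, \sum_(j < n) h j <= M) ->
  \sum_(m < N | D m) h (s m) <= M.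
Proof.
move=> sinj h0 hM; pose K := (\sum_(m < N) s m).+1.
have sK (m : 'I_N) : (s m < K)%N by rewrite ltnS (bigD1 m)//= leq_addr.
apply: le_trans (hM K).
apply: (@le_trans _ _ (\sum_(m < N | D m) \sum_(j < K) (s m == j)%:R * h j)).
  rewrite le_eqVlt; apply/orP; left; apply/eqP; apply: eq_bigr => m _.
  rewrite (bigD1 (Ordinal (sK m)))//= eqxx mul1r big1 ?addr0// => j jm.
  rewrite (negbTE (_ : s m != j)) ?mul0r//.
  by move: jm; apply: contraNneq => jm; apply/eqP/val_inj.
rewrite exchange_big /=; apply: ler_sum => j _.
rewrite -mulr_suml -[leRHS]mul1r ler_wpM2r//.
have [[m Dm sm]|H] := pselect (exists2 m : 'I_N, D m & s m = j); last first.
  rewrite big1// => m Dm; apply/eqP; rewrite pnatr_eq0 eqb0.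
  by apply/eqP => sm; apply: H; exists m.
rewrite (bigD1 m)//= sm eqxx big1 ?addr0// => i /andP[Di im].
apply/eqP; rewrite pnatr_eq0 eqb0; move: im; apply: contraNN => /eqP E.
by apply/eqP/val_inj; apply: sinj => //; rewrite E.
Qed.

Lemma finite_cauchy_schwarz N (D : pred nat) (x y : nat -> R) :
  (\sum_(k < N | D k) x k * y k) ^+ 2 <=
  (\sum_(k < N | D k) x k ^+ 2) * (\sum_(k < N | D k) y k ^+ 2).
Proof.
set X := \sum_(k < N | D k) x k ^+ 2; set Y := \sum_(k < N | D k) y k ^+ 2.
set S := \sum_(k < N | D k) x k * y k.
have X0 : 0 <= X by apply: sumr_ge0 => k _; exact: sqr_ge0.
have Y0 : 0 <= Y by apply: sumr_ge0 => k _; exact: sqr_ge0.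
have H t : 0 <= X - 2 * t * S + t ^+ 2 * Y.
  have -> : X - 2 * t * S + t ^+ 2 * Y = \sum_(k < N | D k) (x k - t * y k) ^+ 2.
    rewrite /X /S /Y !mulr_sumr -sumrB -big_split /=.
    by apply: eq_bigr => k _; ring.
  by apply: sumr_ge0 => k _; exact: sqr_ge0.
have [Y00|YN0] := eqVneq Y 0.
  have : S = 0.
    apply/eqP; apply: contraT => SN0.
    have := H ((X + 1) / (2 * S)); rewrite Y00.
    have -> : 2 * ((X + 1) / (2 * S)) * S = X + 1 by field.
    by rewrite mulr0 addr0; lra.
  by move=> ->; rewrite Y00 expr0n/= mulr0.
have Yp : 0 < Y by rewrite lt_neqAle eq_sym YN0.
have := H (S / Y).
have -> : X - 2 * (S / Y) * S + (S / Y) ^+ 2 * Y = (X * Y - S ^+ 2) / Y by field.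
by rewrite pmulr_lge0 ?invr_gt0// subr_ge0.
Qed.

(** The condition under which the Cauchy-Schwarz inequality bounds convolutions
    of two sequences of weights [p] and [q] in the mean square. The injection [s]
    stands for the three index patterns [k + m], [k - m] and [m - k] that occur
    in products of trigonometric functions. *)
Definition convolution_weights p q Z := forall n (D : pred nat) (s : nat -> nat),
  (forall k k', D k -> D k' -> s k = s k' -> k = k') ->
  \sum_(k < n | D k) (p k * q (s k))^-1 <= Z.

Lemma convolution_weights_sqr p Z : (forall k, 0 < p k) ->
  (forall n, \sum_(k < n) (p k ^+ 2)^-1 <= Z) -> convolution_weights p p Z.
Proof.
move=> p0 pZ n D s sinj.
apply: (@le_trans _ _ (\sum_(k < n | D k)
    (2^-1 * (p k ^+ 2)^-1 + 2^-1 * (p (s k) ^+ 2)^-1))).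
  apply: ler_sum => k _; rewrite invfM -!exprVn.
  have := sqr_ge0 ((p k)^-1 - (p (s k))^-1); rewrite !expr2; nra.
rewrite big_split /= -!mulr_sumr.
have h1 : \sum_(k < n | D k) (p k ^+ 2)^-1 <= Z.
  apply: (@sum_injective_le D id (fun j => (p j ^+ 2)^-1)) => // j.
  by rewrite invr_ge0 sqr_ge0.
have h2 : \sum_(k < n | D k) (p (s k) ^+ 2)^-1 <= Z.
  apply: (@sum_injective_le D s (fun j => (p j ^+ 2)^-1)) => // j.
  by rewrite invr_ge0 sqr_ge0.
by lra.
Qed.

Lemma convolution_weights_l p Z : (forall k, 0 < p k) ->
  (forall n, \sum_(k < n) (p k)^-1 <= Z) -> convolution_weights p (fun=> 1) Z.
Proof.
move=> p0 pZ n D s _; under eq_bigr do rewrite mulr1.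
apply: (@sum_injective_le D id (fun j => (p j)^-1)) => // j.
by rewrite invr_ge0 ltW.
Qed.

Lemma convolution_weights_r p Z : (forall k, 0 < p k) ->
  (forall n, \sum_(k < n) (p k)^-1 <= Z) -> convolution_weights (fun=> 1) p Z.
Proof.
move=> p0 pZ n D s sinj; under eq_bigr do rewrite mul1r.
apply: (@sum_injective_le D s (fun j => (p j)^-1)) => // j.
by rewrite invr_ge0 ltW.
Qed.

(** Convolution-type sums of two sequences in weighted spaces: the
    Cauchy-Schwarz inequality loses the factor [1 / (p k * q (s k m))], whose
    sum over [k] is bounded by the choice of the weights. *)
Lemma weighted_convolution_le p q Z a b Ma Mb (D : nat -> pred nat)
    (s : nat -> nat -> nat) n N :
  (forall k, 0 < p k) -> (forall k, 0 < q k) -> convolution_weights p q Z ->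
  (forall k m m', D k m -> D k m' -> s k m = s k m' -> m = m') ->
  (forall k k' m, D k m -> D k' m -> s k m = s k' m -> k = k') ->
  (forall n, \sum_(k < n) p k * a k ^+ 2 <= Ma) ->
  (forall n, \sum_(k < n) q k * b k ^+ 2 <= Mb) ->
  \sum_(m < N) (\sum_(k < n | D k m) a k * b (s k m)) ^+ 2 <= Z * Ma * Mb.
Proof.
move=> p0 q0 pqZ injm injk aM bM.
have Z0 : 0 <= Z by have := @pqZ 0%N xpredT id (fun _ _ _ _ e => e); rewrite big_ord0.
have Mb0 : 0 <= Mb by have := bM 0%N; rewrite big_ord0.
pose p' k := Num.sqrt (p k); pose q' k := Num.sqrt (q k).
have p2 k : p' k ^+ 2 = p k by rewrite sqr_sqrtr// ltW.
have q2 k : q' k ^+ 2 = q k by rewrite sqr_sqrtr// ltW.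
have pn0 k : p' k != 0 by rewrite gt_eqF// sqrtr_gt0.
have qn0 k : q' k != 0 by rewrite gt_eqF// sqrtr_gt0.
have W m : \sum_(k < n | D k m) ((p' k)^-1 * (q' (s k m))^-1) ^+ 2 <= Z.
  under eq_bigr do rewrite -invfM exprVn exprMn p2 q2.
  by apply: (@pqZ n (D^~ m) (s^~ m)) => k k' h h'; exact: injk.
apply: (@le_trans _ _ (\sum_(m < N) Z *
   \sum_(k < n | D k m) (p k * a k ^+ 2) * (q (s k m) * b (s k m) ^+ 2))).
  apply: ler_sum => m _.
  have -> : \sum_(k < n | D k m) a k * b (s k m) = \sum_(k < n | D k m)
      ((p' k)^-1 * (q' (s k m))^-1) * ((p' k * a k) * (q' (s k m) * b (s k m))).
    apply: eq_bigr => k _; have := pn0 k; have := qn0 (s k m) => *; field.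
    by apply/andP.
  apply: le_trans (finite_cauchy_schwarz n (D^~ m)
     (fun k => (p' k)^-1 * (q' (s k m))^-1)
     (fun k => (p' k * a k) * (q' (s k m) * b (s k m)))) _.
  have -> : \sum_(k < n | D k m) (p k * a k ^+ 2) * (q (s k m) * b (s k m) ^+ 2)
     = \sum_(k < n | D k m) ((p' k * a k) * (q' (s k m) * b (s k m))) ^+ 2.
    by apply: eq_bigr => k _; rewrite !exprMn p2 q2.
  by apply: ler_wpM2r (W m); apply: sumr_ge0 => k _; exact: sqr_ge0.
rewrite -mulr_sumr -mulrA ler_wpM2l//.
rewrite (exchange_big_dep xpredT)//=.
apply: (@le_trans _ _ (\sum_(k < n) p k * a k ^+ 2 * Mb)).
  apply: ler_sum => k _; rewrite -mulr_sumr ler_wpM2l//.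
    by rewrite mulr_ge0 ?sqr_ge0// ltW.
  apply: (@sum_injective_le (D k) (s k) (fun j => q j * b j ^+ 2)) => //.
    by move=> m m' ? ?; exact: injm.
  by move=> j; rewrite mulr_ge0 ?sqr_ge0// ltW.
by rewrite -mulr_suml ler_wpM2r.
Qed.

(** For [m >= 1] the term [(m + 1)^(-5/4)] is at most
    [4 * (m^(-1/4) - (m + 1)^(-1/4))], and this telescopes. *)
Lemma riemann_sum_bound n : \sum_(k < n) (k.+1%:R `^ (5 / 4))^-1 <= 5 :> R.
Proof.
have H m : \sum_(k < m.+1) (k.+1%:R `^ (5 / 4))^-1 <= 5 - 4 * m.+1%:R `^ (- 4^-1) :> R.
  elim: m => [|m ih].
    by rewrite big_ord_recr big_ord0 /= !powR1; lra.
  rewrite big_ord_recr /=; apply: le_trans (lerD ih (lexx _)) _.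
  set N : R := m.+1%:R; have N0 : 0 < N by rewrite ltr0n.
  have -> : m.+2%:R = N + 1 :> R by rewrite /N -natr1.
  have N1 : 0 < N + 1 by rewrite addr_gt0.
  set x := N `^ (- 4^-1); set y := (N + 1) `^ (- 4^-1).
  have x0 : 0 < x by rewrite powR_gt0.
  have y0 : 0 < y by rewrite powR_gt0.
  have xN : x ^+ 4 * N = 1.
    rewrite /x -powR_mulrn ?powR_ge0// -powRrM mulNr mulVf// powRN powRr1 ?ltW//.
    by rewrite mulVf ?gt_eqF.
  have yN : y ^+ 4 * (N + 1) = 1.
    rewrite /y -powR_mulrn ?powR_ge0// -powRrM mulNr mulVf// powRN powRr1 ?ltW//.
    by rewrite mulVf ?gt_eqF.
  have -> : ((N + 1) `^ (5 / 4))^-1 = y / (N + 1).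
    rewrite -powRN; have -> : - (5 / 4) = - 4^-1 + - 1 :> R by field.
    rewrite powRD; last by apply/implyP => _; rewrite gt_eqF.
    by rewrite [X in _ * X]powRN powRr1// ltW.
  suff : y * (1 + (4 * (N + 1))^-1) <= x.
    have -> : y * (1 + (4 * (N + 1))^-1) = y + 4^-1 * (y / (N + 1)).
      by field; rewrite gt_eqF.
    by lra.
  (* by fourth powers, with [h = 1 / (N + 1)], the claim becomes
     [(1 - h) * (1 + h / 4) ^ 4 <= 1] *)
  rewrite leNgt; apply/negP => lt.
  pose h := (N + 1)^-1.
  have h0 : 0 < h by rewrite invr_gt0.
  have hN : h * (N + 1) = 1 by rewrite mulVf ?gt_eqF.
  have {}lt : x < y * (1 + h / 4).
    by move: lt; rewrite invfM -/h [4^-1 * h]mulrC.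
  have lt4 : x ^+ 4 < (y * (1 + h / 4)) ^+ 4.
    by rewrite ltrXn2r// ?nnegrE ltW.
  have y4 : y ^+ 4 = h.
    by apply: (mulIf (lt0r_neq0 N1)); rewrite yN hN.
  have x4 : x ^+ 4 * N < (y * (1 + h / 4)) ^+ 4 * N by rewrite ltr_pM2r.
  rewrite xN exprMn y4 in x4.
  have hN' : h * N = 1 - h by rewrite -hN; ring.
  have : h * (1 + h / 4) ^+ 4 * N = (1 - h) * (1 + h / 4) ^+ 4 by rewrite -hN'; ring.
  move=> E; rewrite E in x4.
  have h1 : h < 1 by rewrite invf_lt1//; lra.
  have : (1 - h) * (1 + h / 4) ^+ 4 = 1 - h ^+ 2 * (5 / 8 + 5 / 16 * h
     + 15 / 256 * h ^+ 2 + 1 / 256 * h ^+ 3) by field.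
  have : 0 <= h ^+ 2 * (5 / 8 + 5 / 16 * h + 15 / 256 * h ^+ 2 + 1 / 256 * h ^+ 3).
    have h2 : 0 <= h ^+ 2 by exact: sqr_ge0.
    have h3 : 0 <= h ^+ 3 by rewrite exprn_ge0// ltW.
    by apply: mulr_ge0; lra.
  by lra.
case: n => [|m]; first by rewrite big_ord0.
by apply: le_trans (H m) _; rewrite gerBl mulr_ge0// powR_ge0.
Qed.

End weighted_convolution.

(** * Products of sine series *)

Section quadratic_term.
Context (R : realType).
Local Notation mu := (mu01 R).
Local Notation ebasis := (@ebasis R).
Local Notation freq := (@freq R).
Local Notation H := (sqint mu setT).
Implicit Types (f g h : R -> R) (c : nat -> R) (n k m N : nat) (M : R).

Definition weighted_le (w : nat -> R) M c := forall n, \sum_(k < n) w k * c k ^+ 2 <= M.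

(** [wt] is the weight of H^(3/8) and [pw] that of H^(5/16). The exponents leave
    room on three sides: [1 / pw ^ 2] is summable, so that products of elements of
    H^(5/16) are in H; [pw / wt] tends to 0, so that H^(3/8) embeds compactly
    into H^(5/16); and [wt k / k ^ 2] is summable and [wt * lam ^ alpha <= lam] for
    [alpha < 1/2], so that trajectories of bounded action are bounded in
    H^(3/8). *)
Definition pw k : R := k.+1%:R `^ (5 / 8).
Definition wt k : R := k.+1%:R `^ (3 / 4).

Lemma natS_ge1 k : 1 <= k.+1%:R :> R.
Proof. by rewrite ler1n. Qed.

Lemma pw_ge1 k : 1 <= pw k.
Proof. by rewrite -(powRr0 k.+1%:R) ler_powR ?natS_ge1//; lra. Qed.

Lemma pw_gt0 k : 0 < pw k.
Proof. exact: lt_le_trans ltr01 (pw_ge1 k). Qed.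

Lemma wt_ge1 k : 1 <= wt k.
Proof. by rewrite -(powRr0 k.+1%:R) ler_powR ?natS_ge1//; lra. Qed.

Lemma wt_gt0 k : 0 < wt k.
Proof. exact: lt_le_trans ltr01 (wt_ge1 k). Qed.

Lemma pw_le_wt k : pw k <= wt k.
Proof. by rewrite ler_powR ?natS_ge1//; lra. Qed.

Lemma wt_le_nat k : wt k <= k.+1%:R.
Proof. by rewrite -[leRHS]powRr1// ler_powR ?natS_ge1//; lra. Qed.

Lemma sum_pw n : \sum_(k < n) (pw k ^+ 2)^-1 <= 5.
Proof.
apply: le_trans (riemann_sum_bound R n); rewrite le_eqVlt; apply/orP; left.
apply/eqP; apply: eq_bigr => k _; rewrite /pw -powR_mulrn ?powR_ge0// -powRrM.
by congr ((_ `^ _)^-1); field.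
Qed.

Lemma sum_wt n : \sum_(k < n) wt k / k.+1%:R ^+ 2 <= 5.
Proof.
apply: le_trans (riemann_sum_bound R n); rewrite le_eqVlt; apply/orP; left.
apply/eqP; apply: eq_bigr => k _; rewrite /wt -powR_mulrn// -powRN.
rewrite -powRD; last by apply/implyP => _; rewrite pnatr_eq0.
by rewrite -powRN; congr (_ `^ _); field.
Qed.

Definition decay k : R := k.+1%:R `^ (- (1 / 8)).

Lemma decay_ge0 k : 0 <= decay k. Proof. exact: powR_ge0. Qed.

Lemma pw_decay n k : (n <= k)%N -> pw k <= decay n * wt k.
Proof.
move=> nk; have -> : pw k = decay k * wt k.
  rewrite /decay /wt -powRD; last by apply/implyP => _; rewrite pnatr_eq0.
  by congr (_ `^ _); field.
rewrite ler_wpM2r ?(ltW (wt_gt0 k))// /decay !powRN lef_pV2 ?posrE ?powR_gt0//.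
by rewrite ge0_ler_powR ?nnegrE// ler_nat.
Qed.

Lemma decay_cvg : decay @ \oo --> 0.
Proof.
apply/cvgrPdist_le => e e0.
have /cvgrPdist_le/(_ _ (powR_gt0 8 e0))[N _ HN] := @cvg_harmonic R.
exists N => // n /HN; rewrite !sub0r !normrN !ger0_norm ?decay_ge0 ?invr_ge0//= => h.
have : (n.+1%:R^-1 : R) `^ (1 / 8) <= (e `^ 8) `^ (1 / 8).
  by rewrite ge0_ler_powR ?nnegrE ?invr_ge0 ?powR_ge0//; lra.
rewrite -[X in _ <= X -> _]powRrM [8 * _]mulrCA divff// mulr1 powRr1 ?(ltW e0)// => h2.
apply: le_trans h2.
by rewrite /decay powRN -(powR_inv1 (ltW (ltr0Sn R n))) -powRrM mulN1r powRN.
Qed.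

Lemma cvg_sum_filter (S : Type) (X : set_system S) {FX : Filter X} N
    (G : nat -> S -> R) (l : nat -> R) :
  (forall m, G m @ X --> l m) ->
  (fun s => \sum_(m < N) G m s) @ X --> \sum_(m < N) l m.
Proof.
move=> Fl; elim: N => [|N ih].
  by under eq_fun do rewrite big_ord0; rewrite big_ord0; exact: cvg_cst.
under eq_fun do rewrite big_ord_recr; rewrite big_ord_recr /=.
by apply: cvgD; [exact: ih|exact: Fl].
Qed.

(** The cosine coefficients of a product, up to normalisation. *)
Definition quad f g m : R := \int[mu]_x (f x * g x * cos (freq m * x)).

Lemma measurable_cosfreq m : measurable_fun setT (fun x : R => cos (freq m * x)).
Proof. by apply: continuous_measurableT; exact: continuous_cosM. Qed.

Lemma sqint_cos f m : H f -> H (fun x => f x * cos (freq m * x)).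
Proof.
move=> sf; apply: (@sqint_bounded _ _ _ mu setT measurableT _ _ 1) => //.
  exact: measurable_cosfreq.
by move=> x _; exact: cos_max.
Qed.

Lemma quadE f g m : quad f g m = inner (fun x => f x * cos (freq m * x)) g.
Proof. by apply: eq_Rintegral => x _; rewrite mulrAC. Qed.

(** The product-to-sum formula on coefficients; with modes counted from 0, the
    wave numbers [k + 1] and [m + 1] combine to those of the modes [k + m + 1],
    [k - m - 1] and [m - k - 1]. *)
Definition coef_cos c m k : R := 2^-1 * (c (k + m.+1)%N +
  (if (m < k)%N then c (k - m.+1)%N else if (k < m)%N then - c (m - k.+1)%N else 0)).

Lemma inner_cos f m k : H f ->
  inner (fun x => f x * cos (freq m * x)) (ebasis k) =
  coef_cos (fun k => inner f (ebasis k)) m k.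
Proof.
move=> sf.
pose e' x := (if (m < k)%N then ebasis (k - m.+1)%N x
   else if (k < m)%N then - ebasis (m - k.+1)%N x else 0).
have se' : H e'.
  rewrite /e'; case: (m < k)%N; first exact: sqint_ebasis.
  case: (k < m)%N; last exact: sqint0.
  by apply: sqintN => //; exact: sqint_ebasis.
have E x : cos (freq m * x) * ebasis k x = 2^-1 * (ebasis (k + m.+1)%N x + e' x).
  have A : freq (k + m.+1)%N * x = freq k * x + freq m * x.
    by rewrite /freq -addSn natrD; ring.
  have B : e' x = Num.sqrt 2 * sin (freq k * x - freq m * x).
    rewrite /e' /ebasis; case: ifPn => [mk|].
      congr (_ * sin _); rewrite /freq -subSn// natrB; first by ring.
      by rewrite ltnS ltnW.
    rewrite -leqNgt => km; case: ifPn => [mk|].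
      rewrite -mulrN -sinN; congr (_ * sin _).
      rewrite /freq -subSn// natrB; first by ring.
      by rewrite ltnS ltnW.
    rewrite -leqNgt => mk; have -> : k = m by apply/eqP; rewrite eqn_leq km.
    by rewrite subrr sin0 mulr0.
  by rewrite B /ebasis A sinD sinB; field.
transitivity (inner (fun x => 2^-1 * (ebasis (k + m.+1)%N x + e' x)) f).
  by apply: eq_Rintegral => x _; rewrite -E; ring.
have se := sqint_ebasis R (k + m.+1).
rewrite innerZl//; last exact: sqintD.
rewrite innerDl// innerC /coef_cos; congr (_ * (_ + _)).
rewrite /e'; case: (m < k)%N; first by rewrite innerC.
case: (k < m)%N.
  rewrite innerC; transitivity (inner (fun x => -1 * ebasis (m - k.+1)%N x) f).
    by apply: eq_Rintegral => x _; rewrite mulN1r mulrC.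
  by rewrite innerZl ?mulN1r 1?innerC//; exact: sqint_ebasis.
rewrite -[RHS](Rintegral_mu01_cst 0); apply: eq_Rintegral => x _; exact: mul0r.
Qed.

Lemma quad_cvg f g m : H f -> H g ->
  (fun n => \sum_(k < n) coef_cos (fun k => inner f (ebasis k)) m k *
     inner g (ebasis k)) @ \oo --> quad f g m.
Proof.
move=> sf sg; rewrite quadE.
have := parseval (sqint_cos m sf) sg.
by under [X in X @ _ --> _ -> _]eq_fun do under eq_bigr do rewrite inner_cos//.
Qed.

Lemma coef_cos_split (a b : nat -> R) m n :
  \sum_(k < n) coef_cos b m k * a k =
  2^-1 * (\sum_(k < n) a k * b (k + m.+1)%N +
    \sum_(k < n | (m < k)%N) a k * b (k - m.+1)%N -
    \sum_(k < n | (k < m)%N) a k * b (m - k.+1)%N).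
Proof.
rewrite [X in _ + X - _]big_mkcond [X in _ - X]big_mkcond /=.
rewrite -sumrN -!big_split mulr_sumr /=; apply: eq_bigr => k _.
rewrite /coef_cos; have [mk|km|->] := ltngtP m k; ring.
Qed.

Lemma weighted_le_ge0 (w : nat -> R) M c : weighted_le w M c -> 0 <= M.
Proof. by move=> h; have := h 0%N; rewrite big_ord0. Qed.

Lemma conv_shift_le p q Z (a b : nat -> R) Ma Mb n N : (forall k, 0 < p k) ->
  (forall k, 0 < q k) -> convolution_weights p q Z ->
  weighted_le p Ma a -> weighted_le q Mb b ->
  \sum_(m < N) (\sum_(k < n) a k * b (k + m.+1)%N) ^+ 2 <= Z * Ma * Mb.
Proof.
move=> p0 q0 pqZ hA hB; apply: (@weighted_convolution_le R p q Z a b Ma Mb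
  (fun _ => xpredT) (fun k m => (k + m.+1)%N)) => //.
- by move=> k m m' _ _; lia.
- by move=> k k' m _ _; lia.
Qed.

Lemma conv_down_le p q Z (a b : nat -> R) Ma Mb n N : (forall k, 0 < p k) ->
  (forall k, 0 < q k) -> convolution_weights p q Z ->
  weighted_le p Ma a -> weighted_le q Mb b ->
  \sum_(m < N) (\sum_(k < n | (m < k)%N) a k * b (k - m.+1)%N) ^+ 2 <= Z * Ma * Mb.
Proof.
move=> p0 q0 pqZ hA hB; apply: (@weighted_convolution_le R p q Z a b Ma Mb
  (fun k m => (m < k)%N) (fun k m => (k - m.+1)%N)) => //.
- by move=> k m m' /= h1 h2; lia.
- by move=> k k' m /= h1 h2; lia.
Qed.

Lemma conv_le p q Z (a b : nat -> R) Ma Mb n N : (forall k, 0 < p k) ->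
  (forall k, 0 < q k) -> convolution_weights p q Z ->
  weighted_le p Ma a -> weighted_le q Mb b ->
  \sum_(m < N) (\sum_(k < n | (k < m)%N) a k * b (m - k.+1)%N) ^+ 2 <= Z * Ma * Mb.
Proof.
move=> p0 q0 pqZ hA hB; apply: (@weighted_convolution_le R p q Z a b Ma Mb
  (fun k m => (k < m)%N) (fun k m => (m - k.+1)%N)) => //.
- by move=> k m m' /= h1 h2; lia.
- by move=> k k' m /= h1 h2; lia.
Qed.

(** The product maps the weighted space twice into [L^2]: this is the Sobolev
    embedding of H^s into L^4, s > 1/4, seen on the cosine coefficients of the
    product. *)
Lemma quad_le f g Mf Mg N : H f -> H g ->
  weighted_le pw Mf (fun k => inner f (ebasis k)) ->
  weighted_le pw Mg (fun k => inner g (ebasis k)) ->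
  \sum_(m < N) quad f g m ^+ 2 <= 12 * Mf * Mg.
Proof.
move=> sf sg hf hg.
pose b k := inner f (ebasis k); pose a k := inner g (ebasis k).
have cv : (fun n => \sum_(m < N) (\sum_(k < n) coef_cos b m k * a k) ^+ 2) @ \oo
    --> \sum_(m < N) quad f g m ^+ 2.
  apply: (@cvg_sum_filter nat \oo _ N (fun m n => (\sum_(k < n) coef_cos b m k * a k) ^+ 2)
    (fun m => quad f g m ^+ 2)) => m.
  by under eq_fun do rewrite expr2; rewrite expr2; apply: cvgM; exact: quad_cvg.
apply: (cvgr_to_le cv); apply: nearW => n.
apply: (@le_trans _ _ (3 / 4 *
   (\sum_(m < N) (\sum_(k < n) a k * b (k + m.+1)%N) ^+ 2 +
    \sum_(m < N) (\sum_(k < n | (m < k)%N) a k * b (k - m.+1)%N) ^+ 2 +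
    \sum_(m < N) (\sum_(k < n | (k < m)%N) a k * b (m - k.+1)%N) ^+ 2))).
  rewrite -!big_split mulr_sumr /=; apply: ler_sum => m _.
  rewrite coef_cos_split; set x := \sum_(_ < _) _; set y := \sum_(_ < _ | _) _.
  set z := \sum_(_ < _ | _) _.
  have := sqr_ge0 (x - y); have := sqr_ge0 (x + z); have := sqr_ge0 (y + z).
  by rewrite !expr2; nra.
have pp := convolution_weights_sqr pw_gt0 sum_pw.
have := conv_shift_le n N pw_gt0 pw_gt0 pp hg hf.
have := conv_down_le n N pw_gt0 pw_gt0 pp hg hf.
have := conv_le n N pw_gt0 pw_gt0 pp hg hf.
have : 0 <= Mf * Mg by rewrite mulr_ge0// (weighted_le_ge0 hf, weighted_le_ge0 hg).
by rewrite /a /b; nra.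
Qed.

(** The derivative of a square: in the convolution sums the wave number of the
    output is at most the sum of those of the two inputs. *)
Lemma quad_grad_le f M N : H f ->
  weighted_le (fun k => k.+1%:R ^+ 2) M (fun k => inner f (ebasis k)) ->
  \sum_(m < N) (m.+1%:R * quad f f m) ^+ 2 <= 20 * M ^+ 2.
Proof.
move=> sf hf; pose p k : R := k.+1%:R ^+ 2; pose one (k : nat) : R := 1.
have p0 k : 0 < p k by rewrite exprn_gt0.
have one0 k : 0 < one k by exact: ltr01.
have pZ n : \sum_(k < n) (p k)^-1 <= 5.
  apply: le_trans (sum_pw n); apply: ler_sum => k _.
  rewrite lef_pV2 ?posrE ?exprn_gt0 ?pw_gt0// ler_pXn2r ?nnegrE ?(ltW (pw_gt0 k))//.
  exact: le_trans (pw_le_wt k) (wt_le_nat k).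
pose a k := inner f (ebasis k).
pose b k := `|a k|; pose b' k := k.+1%:R * `|a k|.
have hb : weighted_le p M b.
  by move=> n; under eq_bigr do rewrite /b real_normK ?num_real//; exact: hf.
have hb' : weighted_le one M b'.
  move=> n; under eq_bigr do rewrite /b' /one mul1r exprMn real_normK ?num_real//.
  exact: hf.
have b0 k : 0 <= b k by exact: normr_ge0.
have cv : (fun n => \sum_(m < N) (m.+1%:R * \sum_(k < n) coef_cos a m k * a k) ^+ 2)
    @ \oo --> \sum_(m < N) (m.+1%:R * quad f f m) ^+ 2.
  apply: (@cvg_sum_filter nat \oo _ N
    (fun m n => (m.+1%:R * \sum_(k < n) coef_cos a m k * a k) ^+ 2)
    (fun m => (m.+1%:R * quad f f m) ^+ 2)) => m.
  have h : (fun n => m.+1%:R * \sum_(k < n) coef_cos a m k * a k) @ \oo -->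
      m.+1%:R * quad f f m.
    by apply: cvgM; [exact: cvg_cst|exact: quad_cvg].
  by under eq_fun do rewrite expr2; rewrite expr2; apply: cvgM.
apply: (cvgr_to_le cv); apply: nearW => n.
apply: (@le_trans _ _ (
   \sum_(m < N) (\sum_(k < n) b k * b' (k + m.+1)%N) ^+ 2 +
   \sum_(m < N) (\sum_(k < n | (m < k)%N) b' k * b (k - m.+1)%N) ^+ 2 +
   \sum_(m < N) (\sum_(k < n | (k < m)%N) b' k * b (m - k.+1)%N) ^+ 2 +
   \sum_(m < N) (\sum_(k < n | (k < m)%N) b k * b' (m - k.+1)%N) ^+ 2)).
  rewrite -!big_split /=; apply: ler_sum => m _.
  rewrite coef_cos_split.
  set x := \sum_(_ < _) _; set y := \sum_(_ < _ | _) _; set z := \sum_(_ < _ | _) _.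
  set X := \sum_(_ < _) _; set Y := \sum_(_ < _ | _) _; set Z := \sum_(_ < _ | _) _.
  set W := \sum_(_ < _ | _) _.
  have m0 : (0 : R) <= m.+1%:R by [].
  have xX : m.+1%:R * `|x| <= X.
    apply: (le_trans (ler_wpM2l m0 (ler_norm_sum _ _ _))).
    rewrite mulr_sumr; apply: ler_sum => k _.
    rewrite normrM -/(b k) -/(b (k + m.+1)%N) mulrCA ler_wpM2l// ler_wpM2r//.
    by rewrite ler_nat; lia.
  have yY : m.+1%:R * `|y| <= Y.
    apply: (le_trans (ler_wpM2l m0 (ler_norm_sum _ _ _))).
    rewrite mulr_sumr; apply: ler_sum => k mk.
    rewrite normrM -/(b k) -/(b (k - m.+1)%N) mulrA ler_wpM2r// ler_wpM2r//.
    by rewrite ler_nat; lia.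
  have zZ : m.+1%:R * `|z| <= Z + W.
    apply: (le_trans (ler_wpM2l m0 (ler_norm_sum _ _ _))).
    rewrite mulr_sumr /Z /W -big_split /=; apply: ler_sum => k km.
    rewrite normrM -/(b k) -/(b (m - k.+1)%N) /b' -/(b k) -/(b (m - k.+1)%N).
    have -> : m.+1%:R = k.+1%:R + (m - k.+1).+1%:R :> R.
      by rewrite -natrD; congr (_%:R); lia.
    by rewrite mulrDl; lra.
  have : `|m.+1%:R * (2^-1 * (x + y - z))| <= 2^-1 * (X + Y + (Z + W)).
    rewrite mulrCA normrM ger0_norm; last by lra.
    rewrite ler_wpM2l//.
    rewrite normrM (ger0_norm m0).
    have : `|x + y - z| <= `|x| + `|y| + `|z|.
      by rewrite (le_trans (ler_normB _ _))// lerD2r ler_normD.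
    by move=> /(ler_wpM2l m0) h; apply: le_trans h _; rewrite !mulrDr; lra.
  rewrite ler_norml => /andP[h1 h2].
  have X0 : 0 <= X by apply: sumr_ge0 => k _; rewrite !mulr_ge0.
  have Y0 : 0 <= Y by apply: sumr_ge0 => k _; rewrite !mulr_ge0.
  have Z0 : 0 <= Z by apply: sumr_ge0 => k _; rewrite !mulr_ge0.
  have W0 : 0 <= W by apply: sumr_ge0 => k _; rewrite !mulr_ge0.
  apply: (@le_trans _ _ ((2^-1 * (X + Y + (Z + W))) ^+ 2)).
    by rewrite !expr2; move: h1 h2; set V := _ * (_ * _); set T := 2^-1 * _; nra.
  have := sqr_ge0 (X - Y); have := sqr_ge0 (X - Z); have := sqr_ge0 (X - W).
  have := sqr_ge0 (Y - Z); have := sqr_ge0 (Y - W); have := sqr_ge0 (Z - W).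
  by rewrite !expr2; nra.
have p1 := convolution_weights_l p0 pZ; have q1 := convolution_weights_r p0 pZ.
have := conv_shift_le n N p0 one0 p1 hb hb'.
have := conv_down_le n N one0 p0 q1 hb' hb.
have := conv_le n N one0 p0 q1 hb' hb.
have := conv_le n N p0 one0 p1 hb hb'.
by rewrite expr2; lra.
Qed.

End quadratic_term.

(** * The quadratic term of the equation *)

Section nonlinearity.
Context (R : realType).
Local Notation mu := (mu01 R).
Local Notation ebasis := (@ebasis R).
Local Notation freq := (@freq R).
Local Notation H := (sqint mu setT).
Implicit Types (f g h : R -> R) (c : nat -> R) (n k m N : nat) (M : R).

(** The coefficients of [1/2 D(f^2)], after the derivative has been moved to the
    test function. *)
Definition nl f m : R := - 2^-1 * inner (fun x => f x ^+ 2) (ebasis m)^`()%classic.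

Lemma is_derive_ebasis m (x : R) :
  is_derive x (1 : R) (ebasis m) (Num.sqrt 2 * (freq m * cos (freq m * x))).
Proof.
have := is_deriveZ (Num.sqrt 2) (is_derive_sinM (freq m) x).
by rewrite /GRing.scale /=.
Qed.

Lemma derive_ebasis m :
  (ebasis m)^`()%classic = fun x => Num.sqrt 2 * (freq m * cos (freq m * x)).
Proof.
apply/funext => x; rewrite derive1E.
exact: (@derive_val _ _ _ _ _ _ _ (is_derive_ebasis m x)).
Qed.

Lemma nlE f m : H f -> nl f m = - (Num.sqrt 2 / 2 * freq m) * quad f f m.
Proof.
move=> sf; rewrite /nl derive_ebasis /quad /inner.
have q := sqint_mul measurableT (sqint_cos m sf) sf.
transitivity (- 2^-1 * \int[mu]_x ((Num.sqrt 2 * freq m) *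
    ((f x * cos (freq m * x)) * f x))).
  by congr (_ * _); apply: eq_Rintegral => x _; ring.
rewrite RintegralZl// mulrA; congr (_ * _); first by field.
by apply: eq_Rintegral => x _; ring.
Qed.

Lemma quad_cs f g m : H f -> H g ->
  quad f g m ^+ 2 <= inner f f * inner g g.
Proof.
move=> sf sg; rewrite quadE.
apply: le_trans (inner_cauchy_schwarz (sqint_cos m sf) sg) _.
apply: ler_wpM2r; first exact: inner_ge0.
have sfc := sqint_cos m sf.
apply: le_Rintegral => //; [exact: sqint_mul|exact: sqint_mul|].
move=> x _; have : cos (freq m * x) ^+ 2 <= 1.
  by rewrite cos2sin2 gerBl sqr_ge0.
have := sqr_ge0 (f x); rewrite !expr2; nra.
Qed.

Lemma sqrt2_bounds : 0 <= (Num.sqrt 2 / 2 : R) <= 1.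
Proof.
have h : Num.sqrt 2 <= 2 :> R by rewrite -ler_sqr ?nnegrE ?sqrtr_ge0// sqr_sqrtr//; lra.
by have := sqrtr_ge0 (2 : R); lra.
Qed.

Lemma nl_sqr f m : H f -> nl f m ^+ 2 = 2^-1 * freq m ^+ 2 * quad f f m ^+ 2.
Proof.
move=> sf; rewrite nlE// mulNr sqrrN !exprMn sqr_sqrtr//.
by congr (_ * _); field.
Qed.

Lemma nl_bound f m : H f -> `|nl f m| <= freq m * inner f f.
Proof.
move=> sf; have f0 := inner_ge0 f; have q0 := freq_gt0 R m.
rewrite -ler_sqr ?nnegrE//; last exact: mulr_ge0 (ltW q0) f0.
rewrite real_normK ?num_real// nl_sqr// [leRHS](exprMn 2 (freq m)).
have := quad_cs m sf sf; rewrite -expr2; set q := quad _ _ _ ^+ 2 => hq.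
have q1 : 0 <= q by exact: sqr_ge0.
have P0 : 0 <= freq m ^+ 2 by exact: sqr_ge0.
apply: le_trans (ler_wpM2l P0 hq); rewrite -mulrA.
by have := mulr_ge0 P0 q1; set z := _ * q; lra.
Qed.

Lemma quad_sub f g m : H f -> H g ->
  quad f f m - quad g g m = quad (fun x => f x - g x) (fun x => f x + g x) m.
Proof.
move=> sf sg; rewrite /quad -RintegralB//.
- by apply: eq_Rintegral => x _; ring.
- have := sqint_mul measurableT (sqint_cos m sf) sf.
  by apply: intg_eq => // x _; ring.
- have := sqint_mul measurableT (sqint_cos m sg) sg.
  by apply: intg_eq => // x _; ring.
Qed.

Lemma nl_sub f g m : H f -> H g -> nl f m - nl g m =
  - (Num.sqrt 2 / 2 * freq m) * quad (fun x => f x - g x) (fun x => f x + g x) m.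
Proof. by move=> sf sg; rewrite !nlE// -mulrBr quad_sub. Qed.

Lemma is_derive_sine_sum c n (x : R) : is_derive x (1 : R) (sine_sum c n)
  (\sum_(k < n) c k * (Num.sqrt 2 * (freq k * cos (freq k * x)))).
Proof.
elim: n => [|n ih].
  rewrite big_ord0 (_ : sine_sum c 0 = cst 0); first exact: is_derive_cst.
  by apply/funext => y; rewrite /sine_sum big_ord0.
have -> : sine_sum c n.+1 = (sine_sum c n \+ c n \*: ebasis n).
  by apply/funext => y; rewrite /sine_sum big_ord_recr.
rewrite big_ord_recr /=.
exact: is_deriveD ih (is_deriveZ (c n) (is_derive_ebasis n x)).
Qed.

Lemma continuous_sine_sum c n : continuous (sine_sum c n).
Proof.
move=> x; apply: differentiable_continuous; apply/derivable1_diffP.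
exact: (@ex_derive _ _ _ _ _ _ _ (is_derive_sine_sum c n x)).
Qed.

Lemma sine_sum0 c n : sine_sum c n 0 = 0.
Proof. by rewrite /sine_sum big1// => k _; rewrite /Defs.ebasis mulr0 sin0 !mulr0. Qed.

Lemma sine_sum1 c n : sine_sum c n 1 = 0.
Proof.
by rewrite /sine_sum big1// => k _; rewrite /Defs.ebasis /Defs.freq mulr1 sin_natpi !mulr0.
Qed.

(** The convection term does no work: [f^2 f'] is the derivative of [f^3 / 3],
    and [f] vanishes at both ends. *)
Lemma nl_cancel c n : \sum_(m < n) c m * nl (sine_sum c n) m = 0.
Proof.
set f := sine_sum c n; have cf : continuous f by exact: continuous_sine_sum.
pose f' (x : R) := \sum_(k < n) c k * (Num.sqrt 2 * (freq k * cos (freq k * x))).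
have sf : H f by exact: sqint_sine_sum.
have df (x : R) : is_derive x (1 : R) f (f' x) by exact: is_derive_sine_sum.
have dfun (x : R) : is_derive x (1 : R) (fun y => f y ^+ 3) (3 * (f x ^+ 2 * f' x)).
  have := is_deriveX 3 (df x).
  by rewrite exprfctE /GRing.scale /= -mulrA.
have cf' : continuous f'.
  rewrite /f' => x; elim: (n) => [|i ih].
    by under eq_fun do rewrite big_ord0; exact: cvg_cst.
  under eq_fun do rewrite big_ord_recr; apply: cvgD; first exact: ih.
  apply: cvgM; first exact: cvg_cst.
  apply: cvgM; first exact: cvg_cst.
  apply: cvgM; first exact: cvg_cst.
  exact: continuous_cosM.
have c3 : continuous (fun x => 3 * (f x ^+ 2 * f' x)).
  move=> x; apply: cvgM; first exact: cvg_cst.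
  apply: cvgM; last exact: cf'.
  by under eq_fun do rewrite expr2; rewrite expr2; apply: cvgM; exact: cf.
have I3 := Rintegral_mu01_FTC dfun c3.
rewrite /= /f sine_sum1 sine_sum0 expr0n subr0 -/f in I3.
have bf x : `|f x| <= \sum_(k < n) `|c k| * 2.
  apply: le_trans (ler_norm_sum _ _ _) _; apply: ler_sum => k _.
  by rewrite normrM ler_wpM2l// ebasis_bounded.
have iterm m : intg mu setT
    (fun x => f x ^+ 2 * (Num.sqrt 2 * (freq m * cos (freq m * x)))).
  have := intgZ measurableT (Num.sqrt 2 * freq m) (sqint_mul measurableT (sqint_cos m sf) sf).
  by apply: intg_eq => // x _; ring.
transitivity (- 2^-1 * \int[mu]_x (f x ^+ 2 * f' x)).
  have -> : \int[mu]_x (f x ^+ 2 * f' x) = \int[mu]_x (\sum_(m < n)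
     c m * (f x ^+ 2 * (Num.sqrt 2 * (freq m * cos (freq m * x))))).
    by apply: eq_Rintegral => x _; rewrite /f' mulr_sumr; apply: eq_bigr => i _; ring.
  rewrite Rintegral_sum//; last by move=> m; exact: intgZ.
  rewrite mulr_sumr; apply: eq_bigr => m _; rewrite RintegralZl//; last exact: iterm.
  by rewrite /nl derive_ebasis /inner; ring.
have ff : intg mu setT (fun x => f x ^+ 2 * f' x).
  have : intg mu setT (fun x => \sum_(m < n)
     c m * (f x ^+ 2 * (Num.sqrt 2 * (freq m * cos (freq m * x))))).
    by apply: (@intg_sum _ _ _ mu setT measurableT) => m; exact: intgZ.
  by apply: intg_eq => // x _; rewrite /f' mulr_sumr; apply: eq_bigr => i _; ring.
have E3 : 3 * \int[mu]_x (f x ^+ 2 * f' x) = 0.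
  by rewrite -RintegralZl//; rewrite I3 expr0n.
have -> : \int[mu]_x (f x ^+ 2 * f' x) = 0 by lra.
by rewrite mulr0.
Qed.

(** Energy transfer through the first [n] modes: by cancellation only the
    difference between [f] and its truncation contributes. It is absorbed by a
    small part [d] of the dissipation, up to an error that vanishes as [n] grows,
    uniformly over bounded sets of weight [wt]. *)
Lemma flux_le f n M (d : R) : H f -> 0 < d ->
  weighted_le (wt R) M (fun k => inner f (ebasis k)) ->
  `|\sum_(m < n) inner f (ebasis m) * nl f m| <=
  d * \sum_(m < n) freq m ^+ 2 * inner f (ebasis m) ^+ 2 +
  12 * M ^+ 2 / d * decay R n.
Proof.
move=> sf d0 fM; pose c k := inner f (ebasis k).
have M0 := weighted_le_ge0 fM.
have sS := sqint_sine_sum c n.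
pose q m := quad (fun x => f x - sine_sum c n x) (fun x => f x + sine_sum c n x) m.
have qle : \sum_(m < n) q m ^+ 2 <= 12 * (decay R n * M) * (4 * M).
  apply: quad_le; [exact: sqintB|exact: sqintD| |].
  - move=> N; apply: le_trans (ler_wpM2l (decay_ge0 R n) (fM N)).
    rewrite mulr_sumr; apply: ler_sum => k _; rewrite innerBl//; last exact: sqint_ebasis.
    rewrite coef_sine_sum; case: ltnP => kn.
      rewrite subrr expr0n /= mulr0; apply: mulr_ge0; first exact: decay_ge0.
      by apply: mulr_ge0; [exact: ltW (wt_gt0 R k)|exact: sqr_ge0].
    rewrite subr0 [leRHS]mulrA; apply: ler_wpM2r; first exact: sqr_ge0.
    exact: pw_decay.
  - have four0 : 0 <= 4 :> R by [].
    move=> N; apply: le_trans (ler_wpM2l four0 (fM N)).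
    rewrite mulr_sumr; apply: ler_sum => k _; rewrite innerDl//; last exact: sqint_ebasis.
    rewrite coef_sine_sum; have := pw_le_wt R k; have := pw_gt0 R k.
    rewrite -/(c k); have := sqr_ge0 (c k); case: ltnP => kn.
      have -> : (c k + c k) ^+ 2 = 4 * c k ^+ 2 by ring.
      by nra.
    by rewrite addr0; nra.
have -> : \sum_(m < n) inner f (ebasis m) * nl f m =
    \sum_(m < n) c m * (- (Num.sqrt 2 / 2 * freq m) * q m).
  rewrite -[LHS]subr0 -[X in _ - X](nl_cancel c n) -sumrB; apply: eq_bigr => m _.
  by rewrite -mulrBr nl_sub.
apply: le_trans (ler_norm_sum _ _ _) _.
apply: (@le_trans _ _ (\sum_(m < n) (d * (freq m ^+ 2 * c m ^+ 2) + (4 * d)^-1 * q m ^+ 2))).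
  apply: ler_sum => m _.
  have /andP[s0 s1] := sqrt2_bounds.
  have -> : c m * (- (Num.sqrt 2 / 2 * freq m) * q m) =
     - (Num.sqrt 2 / 2 * ((freq m * c m) * q m)) by ring.
  rewrite normrN normrM (ger0_norm s0).
  apply: (@le_trans _ _ `|(freq m * c m) * q m|); first by rewrite ler_piMl.
  rewrite -exprMn; set x := freq m * c m; set y := q m.
  have h1 : 0 <= (2 * d * x - y) ^+ 2 / (4 * d).
    by rewrite divr_ge0 ?sqr_ge0// mulr_ge0// ltW.
  have h2 : 0 <= (2 * d * x + y) ^+ 2 / (4 * d).
    by rewrite divr_ge0 ?sqr_ge0// mulr_ge0// ltW.
  have e1 : (2 * d * x - y) ^+ 2 / (4 * d) = d * x ^+ 2 + (4 * d)^-1 * y ^+ 2 - x * y.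
    by field; rewrite gt_eqF.
  have e2 : (2 * d * x + y) ^+ 2 / (4 * d) = d * x ^+ 2 + (4 * d)^-1 * y ^+ 2 + x * y.
    by field; rewrite gt_eqF.
  by rewrite ler_norml; rewrite e1 in h1; rewrite e2 in h2; lra.
rewrite big_split /= -!mulr_sumr lerD2l.
have i0 : 0 <= (4 * d)^-1 by rewrite invr_ge0 mulr_ge0// ltW.
apply: le_trans (ler_wpM2l i0 qle) _.
by rewrite le_eqVlt; apply/orP; left; apply/eqP; field; rewrite gt_eqF.
Qed.

(** The difference of two squares factors, so the quadratic term is continuous
    for the norm of H, mode by mode. *)
Lemma nl_cvg (f_ : nat -> R -> R) f m : (forall n, H (f_ n)) -> H f ->
  (fun n => \int[mu]_x ((f_ n x - f x) ^+ 2)) @ \oo --> 0 ->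
  (fun n => nl (f_ n) m) @ \oo --> nl f m.
Proof.
move=> sfn sf cv; pose K := freq m ^+ 2.
pose d n := \int[mu]_x ((f_ n x - f x) ^+ 2).
have d0 n : 0 <= d n by apply: Rintegral_ge0 => x _; exact: sqr_ge0.
have f0 := inner_ge0 f.
have key n : (nl (f_ n) m - nl f m) ^+ 2 <= K * (d n * (2 * d n + 8 * inner f f)).
  have sd : H (fun x => f_ n x - f x) by exact: sqintB.
  have sp : H (fun x => f_ n x + f x) by exact: sqintD.
  rewrite nl_sub// mulNr sqrrN exprMn.
  have /andP[s0 s1] := sqrt2_bounds.
  have p2 : inner (fun x => f_ n x + f x) (fun x => f_ n x + f x) <=
      2 * d n + 8 * inner f f.
    have s2 : H (fun x => 2 * f x) by exact: sqintZ.
    have := sqint_add_le measurableT sd s2.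
    have -> : \int[mu]_x ((2 * f x) ^+ 2) = 4 * inner f f.
      rewrite inner_sqr -RintegralZl//; last exact: sf.2.
      by apply: eq_Rintegral => x _; ring.
    have -> : \int[mu]_x ((f_ n x - f x + 2 * f x) ^+ 2) =
       inner (fun x => f_ n x + f x) (fun x => f_ n x + f x).
      by apply: eq_Rintegral => x _; ring.
    by rewrite -/(d n); lra.
  apply: (@le_trans _ _ (K * quad (fun x => f_ n x - f x) (fun x => f_ n x + f x) m ^+ 2)).
    rewrite ler_wpM2r ?sqr_ge0// exprMn -[leRHS]mul1r ler_wpM2r ?sqr_ge0//.
    by rewrite expr2; nra.
  rewrite ler_wpM2l ?sqr_ge0//; apply: le_trans (quad_cs m sd sp) _.
  by rewrite inner_sqr -/(d n) ler_wpM2l.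
have cvR : (fun n => K * (d n * (2 * d n + 8 * inner f f))) @ \oo --> 0.
  rewrite -[0 in X in _ --> X](mulr0 K); apply: cvgM; first exact: cvg_cst.
  rewrite -[0 in X in _ --> X](mul0r (2 * 0 + 8 * inner f f)).
  apply: cvgM; first exact: cv.
  apply: cvgD; last exact: cvg_cst.
  by apply: cvgM; [exact: cvg_cst|exact: cv].
apply/cvgrPdist_le => e e0.
have e20 : 0 < e ^+ 2 by rewrite exprn_gt0.
have /cvgrPdist_le/(_ _ e20)[N _ HN] := cvR; exists N => // n /HN /= h.
rewrite distrC -ler_sqr ?nnegrE//; last exact: ltW.
rewrite real_normK ?num_real//; apply: le_trans (key n) _; apply: le_trans h.
by rewrite sub0r normrN ler_norm.
Qed.

Lemma measurable_nl d (T : measurableType d) (D : set T) (v : T -> R -> R) m :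
  measurable D -> (forall t, H (v t)) ->
  (forall k, measurable_fun D (fun t => inner (v t) (ebasis k))) ->
  measurable_fun D (fun t => nl (v t) m).
Proof.
move=> mD sv mv; under eq_fun do rewrite nlE//.
apply: measurable_funM => //.
apply: (@measurable_fun_cvg _ _ _ _ (fun n t => \sum_(k < n)
  coef_cos (fun k => inner (v t) (ebasis k)) m k * inner (v t) (ebasis k))).
  move=> n; apply: measurable_sum => k; apply: measurable_funM => //.
  apply: measurable_funM => //; apply: measurable_funD => //.
  case: (m < k)%N => //; case: (k < m)%N => //.
  exact: measurableT_comp.
by move=> t _; exact: quad_cvg.
Qed.

End nonlinearity.

(** * Trajectories and their energy *)

Section trajectories.
Context (R : realType).
Local Notation leb := (@lebesgue_measure R).
Local Notation mu := (mu01 R).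
Local Notation ebasis := (@ebasis R).
Local Notation freq := (@freq R).
Local Notation wt := (wt R).
Local Notation H := (sqint mu setT).
Implicit Types (c : nat -> R) (u : R -> nat -> R) (F : nat -> R -> R)
  (n k m N : nat) (M E T t alpha : R).

Definition lam k : R := freq k ^+ 2.

Lemma freq_ge k : k.+1%:R <= freq k.
Proof. by rewrite /Defs.freq ler_peMr// (le_trans _ (pi_ge2 R))//; lra. Qed.

Lemma lam_ge k : k.+1%:R ^+ 2 <= lam k.
Proof. by rewrite /lam ler_pXn2r ?nnegrE// ?(ltW (freq_gt0 R k))// freq_ge. Qed.

Lemma lam_ge1 k : 1 <= lam k.
Proof. by apply: le_trans (lam_ge k); rewrite exprn_ege1// natS_ge1. Qed.

Lemma lam_gt0 k : 0 < lam k. Proof. exact: lt_le_trans ltr01 (lam_ge1 k). Qed.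

Lemma mitv (i : interval R) : measurable ([set` i] : set (measurableTypeR R)).
Proof. exact: measurable_itv. Qed.

(** The symbol of [A^(alpha/2)]. *)
Definition apow alpha k : R := lam k `^ (alpha / 2).

Lemma apow_sqr alpha k : apow alpha k ^+ 2 = lam k `^ alpha.
Proof.
by rewrite /apow -powR_mulrn ?powR_ge0// -powRrM; congr (_ `^ _); field.
Qed.

Lemma apow_sqr_le alpha k : alpha < 2^-1 -> apow alpha k ^+ 2 <= lam k.
Proof.
move=> a1; rewrite apow_sqr -[leRHS]powRr1 ?(ltW (lam_gt0 k))//.
by rewrite ler_powR ?lam_ge1//; lra.
Qed.

Lemma wt_apow alpha k : alpha < 2^-1 -> wt k * apow alpha k ^+ 2 <= lam k.
Proof.
move=> a1; have l0 := lam_gt0 k.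
have h : wt k <= lam k `^ 2^-1.
  apply: le_trans (wt_le_nat R k) _; apply: le_trans (freq_ge k) _.
  by rewrite /lam powR12_sqrt ?sqr_ge0// sqrtr_sqr ler_norm.
apply: le_trans (ler_wpM2r (sqr_ge0 _) h) _.
rewrite apow_sqr -powRD; last by apply/implyP => _; rewrite gt_eqF.
by rewrite -[leRHS]powRr1 ?(ltW l0)// ler_powR ?lam_ge1//; lra.
Qed.

Lemma weighted_le_sum c M : weighted_le wt M c ->
  forall n, \sum_(k < n) c k ^+ 2 <= M.
Proof.
move=> cM n; apply: le_trans (cM n); apply: ler_sum => k _.
by rewrite ler_peMl ?sqr_ge0// wt_ge1.
Qed.

Lemma sum_le_sqr c M k : (forall n, \sum_(j < n) c j ^+ 2 <= M) -> c k ^+ 2 <= M.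
Proof.
move=> cM; apply: le_trans (cM k.+1); rewrite big_ord_recr /= lerDr.
by apply: sumr_ge0 => j _; exact: sqr_ge0.
Qed.

Lemma inner_of_coef c M k : (forall n, \sum_(k < n) c k ^+ 2 <= M) ->
  inner (of_coef c) (ebasis k) = c k.
Proof. by move=> cM; rewrite -/(coef (of_coef c) k) (of_coefK cM). Qed.

Lemma inner_of_coef_le c M : (forall n, \sum_(k < n) c k ^+ 2 <= M) ->
  inner (of_coef c) (of_coef c) <= M.
Proof.
move=> cM; apply: inner_le_of_coef; first exact: sqint_L2.
move=> n; under eq_bigr do rewrite (inner_of_coef _ cM); exact: cM.
Qed.

Definition convect c k : R := nl (of_coef c) k.

Lemma convect_bound c M k : (forall n, \sum_(k < n) c k ^+ 2 <= M) ->
  `|convect c k| <= freq k * M.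
Proof.
move=> cM; apply: le_trans (nl_bound k (sqint_L2 _)) _.
by rewrite ler_wpM2l ?(ltW (freq_gt0 R k))//; exact: inner_of_coef_le.
Qed.

Lemma convect_sqr_sum c M N : weighted_le wt M c ->
  \sum_(k < N) convect c k ^+ 2 / lam k <= 6 * M ^+ 2.
Proof.
move=> cM; have cM' := weighted_le_sum cM.
have pM : weighted_le (pw R) M (fun k => inner (of_coef c) (ebasis k)).
  move=> n; apply: le_trans (cM n); apply: ler_sum => k _.
  by rewrite (inner_of_coef _ cM') ler_wpM2r ?sqr_ge0// pw_le_wt.
have := quad_le N (sqint_L2 (of_coef c)) (sqint_L2 (of_coef c)) pM pM.
have -> : \sum_(k < N) convect c k ^+ 2 / lam k =
   2^-1 * \sum_(k < N) quad (of_coef c) (of_coef c) k ^+ 2.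
  rewrite mulr_sumr; apply: eq_bigr => k _; rewrite /convect nl_sqr; last exact: sqint_L2.
  by have := lam_gt0 k; rewrite /lam => l0; field; rewrite gt_eqF ?freq_gt0.
by rewrite expr2; lra.
Qed.

(** Paths from 0 with forcing [F] of squared norm at most [E], that is of action
    at most [E / 2], the equation being written mode by mode in integrated form.
    The bound of weight [wt] takes the place of boundedness in H: it follows from
    it by the smoothing of the heat semigroup, it passes to limits, and it makes
    the energy estimate rigorous. *)
Definition trajectory alpha T E u F : Prop :=
  [/\ exists M, forall t, t \in `[0, T] -> weighted_le wt M (u t),
      forall k, measurable_fun `[0, T] (u^~ k),
      forall k, sqint leb `[0, T] (F k),
      forall n, \sum_(k < n) \int[leb]_(s in `[0, T]) (F k s ^+ 2) <= E &
      forall t, t \in `[0, T] -> forall k, u t k = \int[leb]_(s in `[0, t])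
        ((convect (u s) k + apow alpha k * F k s) - lam k * u s k)].

Lemma measurable_convect T M u k :
  (forall t, t \in `[0, T] -> forall n, \sum_(k < n) u t k ^+ 2 <= M) ->
  (forall k, measurable_fun `[0, T] (u^~ k)) ->
  measurable_fun `[0, T] (fun s => convect (u s) k).
Proof.
move=> uM mu_; apply: measurable_nl => //.
  by move=> t; exact: sqint_L2.
move=> j; apply: eq_measurable_fun (mu_ j) => t /set_mem tT.
by rewrite (inner_of_coef _ (uM t tT)).
Qed.

Lemma sqint_itv_bounded T (f : R -> R) (B : R) : measurable_fun `[0, T] f ->
  (forall t, t \in `[0, T] -> `|f t| <= B) -> sqint leb `[0, T] f.
Proof.
move=> mf fB; have s1 : sqint leb `[0, T] (fun=> 1).
  by apply: sqint_continuous; apply: continuous_subspaceT => x; exact: cst_continuous.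
have [] := @sqint_bounded _ _ _ leb `[0, T]%classic (measurable_itv _) _ _ _ s1 mf fB.
by move=> m1 i1; split => //; apply: intg_eq i1 => // s _; rewrite mul1r.
Qed.

Section one_trajectory.
Variables (alpha T E : R) (u : R -> nat -> R) (F : nat -> R -> R).
Hypotheses (alpha0 : 0 <= alpha) (alpha1 : alpha < 2^-1) (T0 : 0 <= T).
Hypothesis traj : trajectory alpha T E u F.

Let g k s := convect (u s) k + apow alpha k * F k s.

Lemma traj_bounded : exists2 M, 0 <= M &
  forall t, t \in `[0, T] -> weighted_le wt M (u t).
Proof.
case: traj => -[M uM] _ _ _ _; exists M => //.
by apply: (weighted_le_ge0 (uM 0 _)); rewrite in_itv /= lexx.
Qed.

Lemma traj_convect_sqint k : sqint leb `[0, T] (fun s => convect (u s) k).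
Proof.
have [M M0 uM] := traj_bounded; case: traj => _ mu_ _ _ _.
apply: (@sqint_itv_bounded _ _ (freq k * M)).
  exact: (@measurable_convect T M u k (fun t tT => weighted_le_sum (uM t tT)) mu_).
by move=> t tT; apply: convect_bound; exact: weighted_le_sum (uM t tT).
Qed.

Lemma traj_forcing_sqint k : sqint leb `[0, T] (fun s => apow alpha k * F k s).
Proof. by case: traj => _ _ sF _ _; apply: sqintZ. Qed.

Lemma traj_g_sqint k : sqint leb `[0, T] (g k).
Proof. by apply: sqintD => //; [exact: traj_convect_sqint|exact: traj_forcing_sqint]. Qed.

Lemma traj_intg k : intg leb `[0, T] (u^~ k).
Proof.
have [M M0 uM] := traj_bounded; case: traj => _ mu_ _ _ _.
apply: sqint_intg_itv; apply: (@sqint_itv_bounded _ _ (1 + M)) => // t tT.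
have := sum_le_sqr k (weighted_le_sum (uM t tT)).
rewrite ler_norml expr2 => h; apply/andP; split; nra.
Qed.

Lemma traj_continuous k : {within `[0, T], continuous (u^~ k)}.
Proof.
have hi : intg leb `[0, T] (fun s => g k s - lam k * u s k).
  apply: intgB => //; first by apply: sqint_intg_itv; exact: traj_g_sqint.
  by apply: intgZ => //; exact: traj_intg.
have := primitive_continuous T0 hi; apply: subspace_eq_continuous => t tT.
rewrite /from_subspace /=; case: traj => _ _ _ _ -> //.
by move: tT; rewrite inE.
Qed.

Lemma traj_eq k t : t \in `[0, T] ->
  u t k = \int[leb]_(s in `[0, t]) (g k s - lam k * u s k).
Proof. by case: traj => _ _ _ _ h tT; exact: h. Qed.

Lemma traj_sqint k : sqint leb `[0, T] (u^~ k).
Proof. apply: sqint_continuous; exact: traj_continuous. Qed.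

Let TT : T \in `[0, T]. Proof. by rewrite in_itv /= T0 lexx. Qed.

(** The dissipation is finite. The bound is crude since it uses the maximal
    regularity of each mode with the quadratic term as a forcing; its only role
    is to make the limit in the number of modes legitimate in the energy
    estimate. *)
Lemma traj_rough_bound : exists2 A, 0 <= A & forall n,
  \sum_(k < n) lam k * \int[leb]_(s in `[0, T]) (u s k ^+ 2) <= A.
Proof.
have [M M0 uM] := traj_bounded; case: (traj) => _ _ sF FE _.
have E0 : 0 <= E by have := FE 0%N; rewrite big_ord0.
exists (12 * M ^+ 2 * T + 2 * E).
  by rewrite addr_ge0// !mulr_ge0// sqr_ge0.
move=> n; apply: (@le_trans _ _ (\sum_(k < n)
   (2 * \int[leb]_(s in `[0, T]) (convect (u s) k ^+ 2 / lam k) +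
    2 * \int[leb]_(s in `[0, T]) (F k s ^+ 2)))).
  apply: ler_sum => k _; have l0 := lam_gt0 k.
  have := ode_maximal_regularity T0 l0 (traj_g_sqint k) (@traj_continuous k) (@traj_eq k).
  have := sqint_add_le (@mitv `[0, T]) (traj_convect_sqint k) (traj_forcing_sqint k).
  have -> : \int[leb]_(s in `[0, T]) ((apow alpha k * F k s) ^+ 2) =
      apow alpha k ^+ 2 * \int[leb]_(s in `[0, T]) (F k s ^+ 2).
    rewrite -RintegralZl//; last exact: (sF k).2.
    by apply: eq_Rintegral => s _; rewrite exprMn.
  rewrite RintegralZr//; last exact: (traj_convect_sqint k).2.
  have a1 := apow_sqr_le k alpha1.
  have F0 : 0 <= \int[leb]_(s in `[0, T]) (F k s ^+ 2).
    by apply: Rintegral_ge0 => s _; exact: sqr_ge0.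
  have u0 : 0 <= u T k ^+ 2 by exact: sqr_ge0.
  have aF := ler_wpM2r F0 a1.
  have aux (X B IF a G U : R) : 0 <= U -> U + lam k ^+ 2 * X <= G ->
      G <= 2 * B + 2 * (a * IF) -> a * IF <= lam k * IF ->
      lam k * X <= 2 * (B / lam k) + 2 * IF.
    move=> U0 h1 h2 h3; rewrite -(ler_pM2l l0).
    have -> : lam k * (2 * (B / lam k) + 2 * IF) = 2 * B + 2 * (lam k * IF).
      by field; rewrite gt_eqF.
    by rewrite expr2 in h1; lra.
  move=> h1 h2; apply: aux h2 h1 aF; exact: mulr_ge0 (ltW l0) u0.
rewrite big_split /= -!mulr_sumr; apply: lerD; last first.
  by apply: ler_wpM2l => //; exact: FE.
have ic k : intg leb `[0, T] (fun s => convect (u s) k ^+ 2 / lam k).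
  have := intgZ (@mitv `[0, T]) (lam k)^-1 (traj_convect_sqint k).2.
  by apply: intg_eq => // s _; rewrite mulrC.
rewrite -Rintegral_sum//.
have : \int[leb]_(s in `[0, T]) \sum_(k < n) convect (u s) k ^+ 2 / lam k <=
   \int[leb]_(s in `[0, T]) (6 * M ^+ 2).
  apply: le_Rintegral => //.
  - by apply: intg_sum.
  - apply: intg_continuous; apply: continuous_subspaceT => x; exact: cst_continuous.
  - by move=> s sT; apply: convect_sqr_sum; exact: uM.
rewrite Rintegral_cst//= lebesgue_measure_itv /= lte_fin.
case: ltgtP T0 => // [t0 _|<- _].
  by rewrite -EFinB subr0 /=; lra.
by rewrite /= !mulr0; lra.
Qed.

(** The forcing does at most the work [|F|^2 + |A^(1/2) u|^2], as
    [alpha < 1/2], and half of the dissipation compensates the last term. The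
    quadratic term does work on the first [m] modes only through [flux_le]: its
    small multiple of the dissipation is controlled by [traj_rough_bound], and
    its error tends to 0 with [m]. *)
Lemma traj_energy_end n : \sum_(k < n) u T k ^+ 2 +
  \sum_(k < n) lam k * \int[leb]_(s in `[0, T]) (u s k ^+ 2) <= E.
Proof.
have [M M0 uM] := traj_bounded; case: (traj) => _ _ sF FE _.
have [A A0 hA] := traj_rough_bound.
pose X k := \int[leb]_(s in `[0, T]) (u s k ^+ 2).
have X0 k : 0 <= X k by apply: Rintegral_ge0 => s _; exact: sqr_ge0.
pose S n := \sum_(k < n) (u T k ^+ 2 + lam k * X k).
suff SE : S n <= E by move: SE; rewrite /S big_split.
have Smono m : S n <= S (n + m)%N.
  rewrite /S big_split_ord /= lerDl; apply: sumr_ge0 => k _.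
  by rewrite addr_ge0 ?sqr_ge0// mulr_ge0// ltW// lam_gt0.
have cu k : sqint leb `[0, T] (u^~ k) by exact: traj_sqint.
have icu k : intg leb `[0, T] (fun s => u s k * convect (u s) k).
  by apply: sqint_mul => //; exact: traj_convect_sqint.
have mode k : u T k ^+ 2 + lam k * X k <=
    2 * \int[leb]_(s in `[0, T]) (u s k * convect (u s) k) +
    \int[leb]_(s in `[0, T]) (F k s ^+ 2).
  have l0 := lam_gt0 k.
  have := ode_energy T0 (sqint_intg_itv (traj_g_sqint k)) (@traj_continuous k) (@traj_eq k).
  have : \int[leb]_(s in `[0, T]) (2 * (g k s * u s k)) <=
     \int[leb]_(s in `[0, T]) (2 * (u s k * convect (u s) k) +
       (F k s ^+ 2 + lam k * u s k ^+ 2)).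
    apply: le_Rintegral => //.
    - by apply: intgZ => //; apply: sqint_mul => //; exact: traj_g_sqint.
    - apply: intgD => //; first exact: intgZ.
      apply: intgD => //; first exact: (sF k).2.
      by apply: intgZ => //; exact: (cu k).2.
    - move=> s _; rewrite /g.
      have := sqr_ge0 (F k s - apow alpha k * u s k).
      have := ler_wpM2r (sqr_ge0 (u s k)) (apow_sqr_le k alpha1).
      by rewrite !expr2; nra.
  rewrite RintegralZl//; last by apply: sqint_mul => //; exact: traj_g_sqint.
  rewrite RintegralD//; first last.
  - apply: intgD => //; first exact: (sF k).2.
    by apply: intgZ => //; exact: (cu k).2.
  - exact: intgZ.
  have -> : \int[leb]_(s in `[0, T]) (2 * (u s k * convect (u s) k)) =
      2 * \int[leb]_(s in `[0, T]) (u s k * convect (u s) k).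
    by rewrite RintegralZl//; exact: icu.
  have -> : \int[leb]_(s in `[0, T]) (F k s ^+ 2 + lam k * u s k ^+ 2) =
      \int[leb]_(s in `[0, T]) (F k s ^+ 2) + lam k * X k.
    rewrite RintegralD//.
    + by rewrite RintegralZl//; exact: (cu k).2.
    + exact: (sF k).2.
    + by apply: intgZ => //; exact: (cu k).2.
  rewrite -/(X k).
  by move=> h1 h2; lra.
(* [flux_le] with parameter [d]; the first error term is small with [d] by the
   rough bound, the second one tends to 0 as [m] grows, for each [d] *)
have step (d : R) m : 0 < d ->
    S m <= 2 * d * A + 24 * M ^+ 2 * T / d * decay R m + E.
  move=> d0; apply: (@le_trans _ _ (\sum_(k < m)
     (2 * \int[leb]_(s in `[0, T]) (u s k * convect (u s) k) +
      \int[leb]_(s in `[0, T]) (F k s ^+ 2)))).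
    by apply: ler_sum => k _; exact: mode.
  rewrite big_split /=; apply: lerD; last exact: FE.
  rewrite -mulr_sumr -Rintegral_sum//.
  have cst_int (B : R) : intg leb `[0, T] (fun=> B).
    by apply: intg_continuous; apply: continuous_subspaceT => x; exact: cst_continuous.
  have iX : intg leb `[0, T] (fun s => \sum_(k < m) lam k * u s k ^+ 2).
    by apply: intg_sum => // k; apply: intgZ => //; exact: (cu k).2.
  have : \int[leb]_(s in `[0, T]) \sum_(k < m) u s k * convect (u s) k <=
      \int[leb]_(s in `[0, T]) (d * (\sum_(k < m) lam k * u s k ^+ 2) +
         12 * M ^+ 2 / d * decay R m).
    apply: le_Rintegral => //.
    - exact: intg_sum.
    - by apply: intgD => //; exact: intgZ.
    - move=> s sT; have uE k := inner_of_coef k (weighted_le_sum (uM s sT)).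
      have := @flux_le R (of_coef (u s)) m M d (sqint_L2 _) d0.
      have -> : (fun k => inner (of_coef (u s)) (ebasis k)) = u s.
        by apply/funext => k; exact: uE.
      move=> /(_ (uM s sT)); under eq_bigr do rewrite uE.
      under [X in _ <= _ * X + _ -> _]eq_bigr do rewrite uE.
      by apply: le_trans; exact: ler_norm.
  rewrite RintegralD//; [|exact: intgZ|exact: cst_int].
  have -> : \int[leb]_(s in `[0, T]) (d * \sum_(k < m) lam k * u s k ^+ 2) =
      d * \sum_(k < m) lam k * X k.
    rewrite RintegralZl//; congr (d * _); rewrite Rintegral_sum//.
      by apply: eq_bigr => k _; rewrite RintegralZl//; exact: (cu k).2.
    by move=> k; apply: intgZ => //; exact: (cu k).2.
  have -> : \int[leb]_(s in `[0, T]) (12 * M ^+ 2 / d * decay R m) =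
      12 * M ^+ 2 / d * decay R m * T.
    rewrite Rintegral_cst//= lebesgue_measure_itv /= lte_fin.
    case: ltgtP T0 => // [t0 _|<- _]; last by rewrite /= !mulr0.
    by rewrite -EFinB subr0.
  have dA := ler_wpM2l (ltW d0) (hA m).
  have -> : 24 * M ^+ 2 * T / d * decay R m = 2 * (12 * M ^+ 2 / d * decay R m * T) by ring.
  by move=> h; move: dA; rewrite -/(X _); lra.
have lim1 (d : R) : 0 < d -> S n <= 2 * d * A + E.
  move=> d0.
  have cv : (fun m => 2 * d * A + 24 * M ^+ 2 * T / d * decay R (n + m)%N + E) @ \oo
      --> 2 * d * A + 24 * M ^+ 2 * T / d * 0 + E.
    apply: cvgD; last exact: cvg_cst.
    apply: cvgD; first exact: cvg_cst.
    apply: cvgM; first exact: cvg_cst.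
    have := @decay_cvg R; rewrite -(cvg_shiftn n) => h.
    by under eq_fun do rewrite addnC; exact: h.
  rewrite mulr0 addr0 in cv; apply: (cvgr_to_ge cv); apply: nearW => m.
  exact: le_trans (Smono m) (step d _ d0).
apply/ler_addgt0Pr => e e0.
have d0 : 0 < e / (2 * (A + 1)) by rewrite divr_gt0// mulr_gt0// ltr_wpDl.
apply: le_trans (lim1 _ d0) _; rewrite addrC lerD2l.
have -> : 2 * (e / (2 * (A + 1))) * A = e * (A / (A + 1)).
  by field; rewrite gt_eqF// ltr_wpDl.
by rewrite ler_piMr ?(ltW e0)// ler_pdivrMr ?ltr_wpDl// mul1r lerDl.
Qed.

End one_trajectory.

Lemma trajectory_restrict alpha T t E u F : t \in `[0, T] ->
  trajectory alpha T E u F -> trajectory alpha t E u F.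
Proof.
rewrite in_itv /= => /andP[t0 tT] [[M uM] mu_ sF FE ueq].
have sub s : s \in `[0, t] -> s \in `[0, T].
  by rewrite !in_itv /= => /andP[-> /le_trans]; exact.
have sub' : `[0, t]%classic `<=` (`[0, T]%classic : set R) by move=> s /=; exact: sub.
split.
- by exists M => s /sub; exact: uM.
- by move=> k; apply: measurable_funS (mu_ k).
- move=> k; split; first by apply: measurable_funS (sF k).1.
  exact: intg_subitv (sF k).2.
- move=> n; apply: le_trans (FE n); apply: ler_sum => k _.
  rewrite -lee_fin !EFin_Rintegral//; [|exact: (sF k).2|exact: intg_subitv (sF k).2].
  apply: ge0_subset_integral => //.
  + by case/integrableP : (sF k).2.
  + by move=> s _; rewrite lee_fin sqr_ge0.
- by move=> s /sub; exact: ueq.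
Qed.

Lemma trajectory_energy alpha T E u F n t : alpha < 2^-1 ->
  trajectory alpha T E u F -> t \in `[0, T] -> \sum_(k < n) u t k ^+ 2 <= E.
Proof.
move=> a1 tr tT; have t0 : 0 <= t by move: tT; rewrite in_itv /= => /andP[].
have := traj_energy_end a1 t0 (trajectory_restrict tT tr) n.
apply: le_trans; rewrite lerDl; apply: sumr_ge0 => k _.
rewrite mulr_ge0 ?(ltW (lam_gt0 k))//.
by apply: Rintegral_ge0 => s _; exact: sqr_ge0.
Qed.

Lemma trajectory_dissipation alpha T E u F n : alpha < 2^-1 -> 0 <= T ->
  trajectory alpha T E u F ->
  \sum_(k < n) lam k * \int[leb]_(s in `[0, T]) (u s k ^+ 2) <= E.
Proof.
move=> a1 T0 tr; have := traj_energy_end a1 T0 tr n.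
by apply: le_trans; rewrite lerDr; apply: sumr_ge0 => k _; exact: sqr_ge0.
Qed.

End trajectories.

(** * A priori bound in a compactly embedded space *)

Section mild_bounds.
Context (R : realType).
Local Notation leb := (@lebesgue_measure R).
Local Notation mu := (mu01 R).
Local Notation ebasis := (@ebasis R).
Local Notation freq := (@freq R).
Local Notation wt := (wt R).
Local Notation lam := (lam R).
Local Notation H := (sqint mu setT).
Implicit Types (c : nat -> R) (u : R -> nat -> R) (F : nat -> R -> R)
  (f g : R -> R) (n k m N : nat) (M E T t alpha : R).

Lemma freq_lam k : freq k / lam k = (freq k)^-1.
Proof. by rewrite /lam expr2 invfM mulrA divff ?mul1r// gt_eqF// freq_gt0. Qed.

Lemma mild_forced (a l : R) t f : 0 <= t -> 0 < l -> sqint leb `[0, t] f ->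
  l * (\int[leb]_(s in `[0, t]) (expR (- (l * (t - s))) * (a * f s))) ^+ 2 <=
  a ^+ 2 * \int[leb]_(s in `[0, t]) (f s ^+ 2).
Proof.
move=> t0 l0 sf; have sg : sqint leb `[0, t] (fun s => a * f s) by exact: sqintZ.
pose y r := \int[leb]_(s in `[0, r]) (expR (- (l * (r - s))) * (a * f s)).
have [cy hy] := @ode_of_mild R t l y (fun s => a * f s) t0 (sqint_intg_itv sg)
  (fun _ _ => erefl).
have := ode_maximal_regularity t0 l0 sg cy hy.
have -> : \int[leb]_(s in `[0, t]) ((a * f s) ^+ 2) =
    a ^+ 2 * \int[leb]_(s in `[0, t]) (f s ^+ 2).
  rewrite -RintegralZl//; last exact: sf.2.
  by apply: eq_Rintegral => s _; rewrite exprMn.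
apply: le_trans; rewrite lerDl mulr_ge0 ?sqr_ge0//.
by apply: Rintegral_ge0 => s _; exact: sqr_ge0.
Qed.

Lemma mild_bound_ae t (l : R) g (G : R) : 0 <= t -> 0 < l -> 0 <= G ->
  intg leb `[0, t] g -> {ae leb, forall s, s \in `[0, t] -> `|g s| <= G} ->
  `|\int[leb]_(s in `[0, t]) (expR (- (l * (t - s))) * g s)| <= G / l.
Proof.
move=> t0 l0 G0 gi gG.
pose I : set (measurableTypeR R) := `[0, t]%classic.
have mI : measurable I by exact: mitv.
have mg : measurable_fun I g by exact: intg_measurable gi.
pose g' s := Num.max (- G) (Num.min G (g s)).
have gg' : ae_eq leb I g g'.
  apply: ae_imply gG => s h sI; rewrite /g'.
  have := h sI; rewrite ler_norml => /andP[h1 h2].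
  by rewrite (min_idPr h2) (max_idPr h1).
have mg' : measurable_fun I g'.
  by apply: measurable_maxr => //; apply: measurable_minr.
have gi' : intg leb `[0, t] g' by exact: (intg_ae mI mg' gg' gi).
have me : measurable_fun I (fun s => expR (- (l * (t - s)))).
  apply: measurableT_comp => //; apply: measurableT_comp => //.
  by apply: measurable_funM => //; apply: measurable_funB.
have -> : \int[leb]_(s in `[0, t]) (expR (- (l * (t - s))) * g s) =
    \int[leb]_(s in `[0, t]) (expR (- (l * (t - s))) * g' s).
  apply: (@Rintegral_ae _ _ _ leb I mI).
  - exact: (measurable_funM me mg).
  - exact: (measurable_funM me mg').
  - by apply: ae_imply gg' => s h /h ->.
apply: mild_bound => // s _; rewrite /g' ler_norml.
rewrite le_max lexx /= ge_max ge_min lexx andbT; lra.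
Qed.

(** The smoothing of the heat semigroup in the weight [wt], separately on the
    two terms of the mild formula: [A] is the contribution of the quadratic term,
    bounded in H^(-1) pointwise in each mode, and [Z] that of the forcing, with
    maximal regularity. *)
Lemma weighted_of_split c (A Z I : nat -> R) (G E alpha : R) :
  alpha < 2^-1 -> 0 <= G -> (forall k, c k = A k + Z k) ->
  (forall k, `|A k| <= G / freq k) ->
  (forall k, lam k * Z k ^+ 2 <= apow alpha k ^+ 2 * I k) ->
  (forall k, 0 <= I k) ->
  (forall n, \sum_(k < n) I k <= E) -> weighted_le wt (10 * G ^+ 2 + 2 * E) c.
Proof.
move=> a1 G0 cE AG ZI I0 IE n.
apply: (@le_trans _ _ (\sum_(k < n) (2 * G ^+ 2 * (wt k / k.+1%:R ^+ 2) + 2 * I k))).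
  apply: ler_sum => k _; rewrite cE; have w0 := wt_gt0 R k; have l0 := lam_gt0 R k.
  have hA : wt k * A k ^+ 2 <= G ^+ 2 * (wt k / k.+1%:R ^+ 2).
    rewrite [leRHS]mulrCA; apply: ler_wpM2l; first exact: ltW.
    have : `|A k| <= G / k.+1%:R.
      apply: le_trans (AG k) _; rewrite ler_wpM2l// lef_pV2 ?posrE ?freq_gt0//.
      exact: freq_ge.
    move=> h; rewrite -expr_div_n -(real_normK (num_real (A k))).
    by apply: lerXn2r => //; rewrite nnegrE// divr_ge0.
  have hZ : wt k * Z k ^+ 2 <= I k.
    rewrite -(ler_pM2l l0) mulrCA; apply: le_trans (ler_wpM2l (ltW w0) (ZI k)) _.
    by rewrite mulrA ler_wpM2r//; exact: wt_apow.
  have : wt k * (A k + Z k) ^+ 2 <= 2 * (wt k * A k ^+ 2) + 2 * (wt k * Z k ^+ 2).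
    have := mulr_ge0 (ltW w0) (sqr_ge0 (A k - Z k)); rewrite !expr2; nra.
  by move: hA hZ; set p := _ * (_ / _); set q := wt k * A k ^+ 2;
     rewrite -mulrA -/p; lra.
rewrite big_split /= -!mulr_sumr; apply: lerD.
  have := ler_wpM2l (mulr_ge0 (ler0n R 2) (sqr_ge0 G)) (sum_wt R n); lra.
by apply: ler_wpM2l => //; exact: IE.
Qed.

Lemma Rintegral_subitv T t f : t \in `[0, T] -> sqint leb `[0, T] f ->
  \int[leb]_(s in `[0, t]) (f s ^+ 2) <= \int[leb]_(s in `[0, T]) (f s ^+ 2).
Proof.
rewrite in_itv /= => /andP[t0 tT] sf.
have st : intg leb `[0, t] (fun s => f s ^+ 2) by exact: intg_subitv sf.2.
rewrite -lee_fin !EFin_Rintegral//; last exact: sf.2.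
apply: ge0_subset_integral => //.
- by case/integrableP : sf.2.
- by move=> s _; rewrite lee_fin sqr_ge0.
- by move=> s /=; rewrite !in_itv /= => /andP[-> h]; exact: le_trans h tT.
Qed.

Lemma sqint_subitv T t f : t \in `[0, T] -> sqint leb `[0, T] f ->
  sqint leb `[0, t] f.
Proof.
rewrite in_itv /= => /andP[t0 tT] [mf fi]; split.
  apply: (measurable_funS _ _ mf) => //.
  by move=> s /=; rewrite !in_itv /= => /andP[-> h]; exact: le_trans h tT.
exact: intg_subitv fi.
Qed.

(** The energy estimate bounds the quadratic term in the mild formula, and the
    heat semigroup does the rest. The bound depends only on the action, in
    particular not on [T]. *)
Lemma trajectory_weighted alpha T E u F t : alpha < 2^-1 ->
  trajectory alpha T E u F -> t \in `[0, T] ->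
  weighted_le wt (10 * E ^+ 2 + 2 * E) (u t).
Proof.
move=> a1 tr tT; have en := fun n => trajectory_energy n a1 tr.
have E0 : 0 <= E.
  by case: (tr) => _ _ _ /(_ 0%N) + _; rewrite big_ord0.
have /andP[t0 tT'] : 0 <= t <= T by move: tT; rewrite in_itv.
have T0 : 0 <= T by exact: le_trans tT'.
have [_ _ sF FE _] := tr.
have ci k : intg leb `[0, T] (fun s => convect (u s) k).
  by apply: sqint_intg_itv; exact: traj_convect_sqint T0 tr k.
have fi k := traj_forcing_sqint tr k.
have gi k : intg leb `[0, T] (fun s => convect (u s) k + apow alpha k * F k s).
  by apply: sqint_intg_itv; exact: traj_g_sqint T0 tr k.
pose A k := \int[leb]_(s in `[0, t]) (expR (- (lam k * (t - s))) * convect (u s) k).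
pose Z k := \int[leb]_(s in `[0, t])
  (expR (- (lam k * (t - s))) * (apow alpha k * F k s)).
apply: (@weighted_of_split _ A Z
  (fun k => \int[leb]_(s in `[0, T]) (F k s ^+ 2)) E E alpha) => //.
- move=> k.
  have sub : intg leb `[0, t] (fun s => convect (u s) k) by exact: intg_subitv (ci k).
  have sub' : intg leb `[0, t] (fun s => apow alpha k * F k s).
    by apply: intg_subitv (sqint_intg_itv (fi k)).
  rewrite (mild_of_ode (gi k) (traj_intg T0 tr k) (@traj_eq _ _ _ _ _ _ tr k) tT).
  have It := @mitv R `[0, t].
  rewrite /A /Z (Rintegral_mild _ sub) (Rintegral_mild _ sub').
  rewrite (Rintegral_mild _ (intgD It sub sub')) -mulrDr.
  rewrite -(RintegralD It (intg_expM_mul (lam k) sub) (intg_expM_mul (lam k) sub')).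
  by congr (_ * _); apply: eq_Rintegral => s _; rewrite mulrDr.
- move=> k; rewrite -freq_lam mulrA [E * _]mulrC; apply: mild_bound => //.
  + exact: lam_gt0.
  + by rewrite mulr_ge0// ltW// freq_gt0.
  + exact: intg_subitv (ci k).
  + move=> s; rewrite in_itv /= => /andP[s0 st]; apply: convect_bound => n.
    by apply: en; rewrite in_itv /= s0 (le_trans st).
- move=> k; apply: le_trans (mild_forced _ t0 (lam_gt0 R k) (sqint_subitv tT (sF k))) _.
  by rewrite ler_wpM2l ?sqr_ge0//; exact: Rintegral_subitv.
- by move=> k; apply: Rintegral_ge0 => s _; exact: sqr_ge0.
Qed.

Lemma heatDE t (v : L2 R) k :
  2^-1 * heatD t (fun x => (v : R -> R) x ^+ 2) k =
  expR (- (lam k * t)) * nl v k.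
Proof. by rewrite /heatD /nl; ring. Qed.

Lemma measurable_coef T (f : R -> L2 R) k : measurable_L2 T f ->
  measurable_fun (`[0, T]%classic : set (measurableTypeR R)) (fun s => coef (f s) k).
Proof.
move=> mf; have [phi hphi] := exists_L2 (sqint_ebasis R k).
apply: eq_measurable_fun (mf phi) => s _; rewrite /coef innerC.
rewrite [LHS]innerC; apply/esym; rewrite innerC [RHS]innerC.
by apply: inner_ae => //; [exact: sqint_ebasis|exact: sqint_L2|exact: sqint_L2].
Qed.

Lemma measurable_inner T (f : R -> L2 R) (h : R -> R) : sqint mu setT h ->
  (forall k, measurable_fun (`[0, T]%classic : set (measurableTypeR R))
     (fun s => coef (f s) k)) ->
  measurable_fun (`[0, T]%classic : set (measurableTypeR R)) (fun s => inner (f s) h).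
Proof.
move=> sh mf; apply: (@measurable_fun_cvg _ _ _ _ (fun n s =>
    \sum_(k < n) coef (f s) k * inner h (ebasis k))).
  move=> n; apply: measurable_sum => k.
  by apply: measurable_funM; [exact: mf|exact: measurable_cst].
by move=> s _; apply: parseval => //; exact: sqint_L2.
Qed.

Lemma measurable_L2norm_sqr T (f : R -> L2 R) : (forall k,
     measurable_fun (`[0, T]%classic : set (measurableTypeR R)) (fun s => coef (f s) k)) ->
  measurable_fun (`[0, T]%classic : set (measurableTypeR R)) (fun s => L2norm (f s) ^+ 2).
Proof.
move=> mf; apply: (@measurable_fun_cvg _ _ _ _ (fun n s =>
    \sum_(k < n) coef (f s) k * coef (f s) k)).
  by move=> n; apply: measurable_sum => k; apply: measurable_funM; exact: mf.
move=> s _; rewrite L2norm_sqr; last exact: sqint_L2.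
by apply: parseval; exact: sqint_L2.
Qed.

End mild_bounds.

(** * Trajectories and the quasi-potential *)

Section trajectories_and_forcings.
Context (R : realType).
Local Notation leb := (@lebesgue_measure R).
Local Notation mu := (mu01 R).
Local Notation ebasis := (@ebasis R).
Local Notation freq := (@freq R).
Local Notation wt := (wt R).
Local Notation lam := (lam R).
Local Notation H := (sqint mu setT).
Implicit Types (c : nat -> R) (u : R -> nat -> R) (F : nat -> R -> R)
  (n k m N : nat) (M E T t alpha : R).

Lemma ae_bounded_sqint T (g : R -> R) (G : R) : 0 <= G ->
  measurable_fun (`[0, T]%classic : set (measurableTypeR R)) g ->
  {ae leb, forall s, s \in `[0, T] -> `|g s| <= G} -> sqint leb `[0, T] g.
Proof.
move=> G0 mg gG.
pose I : set (measurableTypeR R) := `[0, T]%classic.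
have mI : measurable I by exact: mitv.
pose g' s := Num.max (- G) (Num.min G (g s)).
have gg' : ae_eq leb I g g'.
  apply: ae_imply gG => s h sI; rewrite /g'.
  have := h sI; rewrite ler_norml => /andP[h1 h2].
  by rewrite (min_idPr h2) (max_idPr h1).
have mg' : measurable_fun I g' by apply: measurable_maxr => //; apply: measurable_minr.
have s' : sqint leb `[0, T] g'.
  apply: (@sqint_itv_bounded _ _ _ G) => // s _; rewrite /g' ler_norml.
  rewrite le_max lexx /= ge_max ge_min lexx andbT; lra.
split => //; apply: (@intg_ae _ _ _ leb I mI _ _ _ _ s'.2).
  exact: measurable_funX.
by apply: ae_imply gg' => s h /h ->.
Qed.

(** The only gap between the two formulations is the bound of weight [wt]: it
    comes from the bound in H by the smoothing of the heat semigroup. *)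
Lemma forcing_trajectory alpha T u f : alpha < 2^-1 -> 0 < T ->
  u 0 = (fun=> 0) -> is_forcing alpha T u f ->
  trajectory alpha T (fine (sqr_int_L2 T f)) u (fun k s => coef (f s) k).
Proof.
move=> a1 T0 u0 [[mf finf] [v [[mv [M0 vM]] uv mild]]].
pose I : set (measurableTypeR R) := `[0, T]%classic.
have mI : measurable I by exact: mitv.
pose F k s := coef (f s) k.
have mF k : measurable_fun I (F k) by exact: measurable_coef.
have mN : measurable_fun I (fun s => L2norm (f s) ^+ 2) by exact: measurable_L2norm_sqr.
have iN : intg leb `[0, T] (fun s => L2norm (f s) ^+ 2).
  apply/integrableP; split; first exact/measurable_EFinP.
  apply: le_lt_trans finf; rewrite le_eqVlt; apply/orP; left; apply/eqP.
  by apply: eq_integral => s _; rewrite /= ger0_norm// sqr_ge0.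
have FN n s : \sum_(k < n) F k s ^+ 2 <= L2norm (f s) ^+ 2.
  by rewrite L2norm_sqr; [apply: bessel|]; exact: sqint_L2.
have sF k : sqint leb `[0, T] (F k).
  split; first exact: mF.
  apply: (intg_le mI _ iN); first exact: measurable_funX.
  move=> s _; rewrite ger0_norm ?sqr_ge0//; apply: le_trans (FN k.+1 s).
  by rewrite big_ord_recr /= lerDr; apply: sumr_ge0 => j _; exact: sqr_ge0.
have FE n : \sum_(k < n) \int[leb]_(s in `[0, T]) (F k s ^+ 2) <=
    fine (sqr_int_L2 T f).
  rewrite -Rintegral_sum//; last by move=> k; exact: (sF k).2.
  apply: le_Rintegral => //; first by apply: intg_sum => // k; exact: (sF k).2.
have E0 : 0 <= fine (sqr_int_L2 T f) by have := FE 0%N; rewrite big_ord0.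
pose G := M0 ^+ 2; have G0 : 0 <= G by exact: sqr_ge0.
have bG k : {ae leb, forall s, s \in `[0, T] -> `|nl (v s) k| <= freq k * G}.
  apply: ae_imply vM => s h sT; apply: le_trans (nl_bound k (sqint_L2 _)) _.
  rewrite ler_wpM2l ?(ltW (freq_gt0 R k))// inner_sqr -L2norm_sqr; last exact: sqint_L2.
  have := h sT; have := L2norm_ge0 (v s); rewrite /G !expr2; nra.
have mb k : measurable_fun I (fun s => nl (v s) k).
  apply: measurable_nl => //; first by move=> t; exact: sqint_L2.
  by move=> j; exact: measurable_coef.
have freqG k : 0 <= freq k * G by rewrite mulr_ge0// ltW// freq_gt0.
have sb k : sqint leb `[0, T] (fun s => nl (v s) k) by exact: ae_bounded_sqint (bG k).
have sa k : sqint leb `[0, T] (fun s => apow alpha k * F k s) by exact: sqintZ.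
have sg k : sqint leb `[0, T] (fun s => nl (v s) k + apow alpha k * F k s).
  exact: sqintD.
have split_t t k : t \in `[0, T] -> u t k =
    \int[leb]_(s in `[0, t]) (expR (- (lam k * (t - s))) * nl (v s) k) +
    \int[leb]_(s in `[0, t]) (expR (- (lam k * (t - s))) * (apow alpha k * F k s)).
  move=> tT; rewrite (mild t tT k) u0 /heat mulr0 add0r; congr (_ + _).
  have sbt := sqint_intg_itv (sqint_subitv tT (sb k)).
  have ie : intg leb `[0, t] (fun s => expR (- (lam k * (t - s))) * nl (v s) k).
    have := intgZ (@mitv R `[0, t]) (expR (- lam k * t)) (intg_expM_mul (lam k) sbt).
    apply: intg_eq => // s _; rewrite mulrA -expRD; congr (expR _ * _); ring.
  rewrite -[LHS]RintegralZl//; first by apply: eq_Rintegral => s _; rewrite heatDE.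
  have := intgZ (@mitv R `[0, t]) 2 ie; apply: intg_eq => // s _.
  by rewrite -heatDE; field.
have mildg t k : t \in `[0, T] -> u t k = \int[leb]_(s in `[0, t])
    (expR (- (lam k * (t - s))) * (nl (v s) k + apow alpha k * F k s)).
  move=> tT; rewrite split_t//.
  have ib := sqint_intg_itv (sqint_subitv tT (sb k)).
  have ia := sqint_intg_itv (sqint_subitv tT (sa k)).
  have ig := sqint_intg_itv (sqint_subitv tT (sg k)).
  rewrite (Rintegral_mild _ ib) (Rintegral_mild _ ia) (Rintegral_mild _ ig).
  rewrite -mulrDr; congr (_ * _).
  rewrite -(RintegralD (@mitv R `[0, t]) (intg_expM_mul (lam k) ib) (intg_expM_mul (lam k) ia)).
  by apply: eq_Rintegral => s _; rewrite mulrDr.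
have ode k := ode_of_mild (ltW T0) (sqint_intg_itv (sg k)) (fun t => @mildg t k).
have uM t : t \in `[0, T] ->
    weighted_le wt (10 * G ^+ 2 + 2 * fine (sqr_int_L2 T f)) (u t).
  move=> tT; have t0 : 0 <= t by move: tT; rewrite in_itv /= => /andP[].
  apply: (weighted_of_split (I := fun k => \int[leb]_(s in `[0, T]) (F k s ^+ 2))
    a1 G0 (fun k => split_t t k tT)) => //.
  - move=> k; rewrite -freq_lam mulrA [G * _]mulrC; apply: mild_bound_ae => //.
    + exact: lam_gt0.
    + exact: sqint_intg_itv (sqint_subitv tT (sb k)).
    + apply: ae_imply (bG k) => s h st; apply: h.
      move: st tT; rewrite !in_itv /= => /andP[-> st] /andP[_ tT].
      exact: le_trans tT.
  - move=> k.
    apply: le_trans (mild_forced _ t0 (lam_gt0 R k) (sqint_subitv tT (sF k))) _.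
    by rewrite ler_wpM2l ?sqr_ge0//; exact: Rintegral_subitv.
  - by move=> k; apply: Rintegral_ge0 => s _; exact: sqr_ge0.
have mu_ k : measurable_fun `[0, T] (u^~ k).
  by apply: within_continuous_measurable; exact: (ode k).1.
split => //; first by exists (10 * G ^+ 2 + 2 * fine (sqr_int_L2 T f)).
move=> t tT k; rewrite ((ode k).2 t tT).
have tT' : `[0, t] `<=` `[0, T].
  move=> s /=; move: tT; rewrite !in_itv /= => /andP[_ tT] /andP[-> st].
  exact: le_trans tT.
pose J : set (measurableTypeR R) := `[0, t]%classic.
have mJ : measurable J by exact: mitv.
have cv : measurable_fun `[0, T] (fun s => convect (u s) k).
  apply: measurable_convect mu_ => s sT; exact: weighted_le_sum (uM s sT).
have ms g : measurable_fun I g -> measurable_fun J g by exact: measurable_funS.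
apply: (@Rintegral_ae _ _ _ leb J mJ).
- apply: measurable_funB; last by apply: measurable_funM => //; exact: ms (mu_ k).
  exact: ms (sg k).1.
- apply: measurable_funB; last by apply: measurable_funM => //; exact: ms (mu_ k).
  by apply: measurable_funD; [exact: ms cv|exact: ms (sa k).1].
- apply: ae_imply uv => s h /tT' sT.
  by rewrite /convect (h sT) of_coef_coef.
Qed.

Lemma Hnorm_neg_le alpha c (B : R) : 0 <= alpha ->
  (forall n, \sum_(k < n) c k ^+ 2 <= B) ->
  (Hnorm (- alpha) c <= (Num.sqrt B)%:E)%E.
Proof.
move=> a0 cB; rewrite /Hnorm.
have term0 k : (0 <= (freq k `^ (2 * - alpha) * c k ^+ 2)%:E)%E.
  by rewrite lee_fin mulr_ge0 ?powR_ge0 ?sqr_ge0.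
have : (\sum_(0 <= k <oo) (freq k `^ (2 * - alpha) * c k ^+ 2)%:E <= B%:E)%E.
  apply: lime_le; first by apply: is_cvg_nneseries => k _ _; exact: term0.
  apply: nearW => n; rewrite big_mkord sumEFin lee_fin.
  apply: le_trans (cB n); apply: ler_sum => k _.
  rewrite ler_piMl ?sqr_ge0// -[leRHS](powRr0 (freq k)) ler_powR//; last by lra.
  by apply: le_trans (freq_ge R k); rewrite natS_ge1.
have : (0 <= \sum_(0 <= k <oo) (freq k `^ (2 * - alpha) * c k ^+ 2)%:E)%E.
  by apply: nneseries_ge0 => k _ _; exact: term0.
case: (\sum_(0 <= k <oo) _)%E => [r| |]//= r0 rB.
by rewrite lee_fin ler_wsqrtr.
Qed.

Lemma Hnorm_ge0 (r : R) c : (0 <= Hnorm r c)%E.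
Proof. exact: sqrte_ge0. Qed.

(** Bounded sets of weight [wt] are tight: the modes beyond [n] contribute
    uniformly little to the norm of H. *)
Lemma weighted_tail c M n N : weighted_le wt M c ->
  \sum_(k < N) c k ^+ 2 <= \sum_(k < n) c k ^+ 2 + decay R n * M.
Proof.
move=> cM; have M0 := weighted_le_ge0 cM.
have d0 : 0 <= decay R n * M by rewrite mulr_ge0// decay_ge0.
have [Nn|nN] := leqP N n.
  apply: le_trans (sums_nondecreasing c Nn) _; lra.
rewrite -(big_mkord xpredT (fun k => c k ^+ 2)) (@big_cat_nat _ _ _ n)//=; last exact: ltnW.
rewrite big_mkord lerD2l; apply: le_trans (ler_wpM2l (decay_ge0 R n) (cM N)).
rewrite -(big_mkord xpredT (fun k => wt k * c k ^+ 2)) [in leRHS](@big_cat_nat _ _ _ n)//=; last exact: ltnW.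
rewrite mulrDr; apply: (@le_trans _ _ (decay R n *
    \sum_(n <= k < N) wt k * c k ^+ 2)); last first.
  rewrite lerDr mulr_ge0 ?decay_ge0//; apply: sumr_ge0 => k _.
  by rewrite mulr_ge0 ?sqr_ge0// ltW// wt_gt0.
rewrite mulr_sumr !big_nat; apply: ler_sum => k /andP[nk _].
rewrite mulrA -[leLHS]mul1r ler_wpM2r ?sqr_ge0//.
exact: le_trans (pw_ge1 R k) (pw_decay R nk).
Qed.

Lemma weighted_le_sub c c' M : weighted_le wt M c -> weighted_le wt M c' ->
  weighted_le wt (4 * M) (fun k => c k - c' k).
Proof.
move=> cM cM' n.
apply: (@le_trans _ _ (\sum_(k < n) (2 * (wt k * c k ^+ 2) + 2 * (wt k * c' k ^+ 2)))).
  apply: ler_sum => k _; have := mulr_ge0 (ltW (wt_gt0 R k)) (sqr_ge0 (c k + c' k)).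
  by rewrite !expr2; lra.
rewrite big_split /= -!mulr_sumr.
by have := cM n; have := cM' n; lra.
Qed.

(** The squared distance in H of the elements with given coefficients. *)
Definition coef_dist c c' : R :=
  \int[mu]_x (((of_coef c : R -> R) x - (of_coef c' : R -> R) x) ^+ 2).

Lemma coef_dist_ge0 c c' : 0 <= coef_dist c c'.
Proof. by apply: Rintegral_ge0 => x _; exact: sqr_ge0. Qed.

Lemma coef_of_sub c c' M k : weighted_le wt M c -> weighted_le wt M c' ->
  inner (fun x => (of_coef c : R -> R) x - (of_coef c' : R -> R) x) (ebasis k) =
  c k - c' k.
Proof.
move=> cM cM'; rewrite innerBl; [|exact: sqint_L2|exact: sqint_L2|exact: sqint_ebasis].
by rewrite (inner_of_coef _ (weighted_le_sum cM)) (inner_of_coef _ (weighted_le_sum cM')).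
Qed.

(** By tightness, convergence of each coefficient implies convergence in H on
    bounded sets of weight [wt]: these sets are compact in H. *)
Lemma coef_dist_cvg (S : Type) (X : set_system S) {FX : ProperFilter X}
    (c_ : S -> nat -> R) c M :
  (\forall s \near X, weighted_le wt M (c_ s)) -> weighted_le wt M c ->
  (forall k, (fun s => c_ s k) @ X --> c k) ->
  (fun s => coef_dist (c_ s) c) @ X --> 0.
Proof.
move=> cM cM' cv; apply/cvgrPdist_le => e e0.
have cd : (fun n => decay R n * (4 * M)) @ \oo --> 0.
  rewrite -[0 in Y in _ --> Y](mul0r (4 * M)); apply: cvgM; last exact: cvg_cst.
  exact: decay_cvg.
have e20 : 0 < e / 2 by rewrite divr_gt0.
have /cvgrPdist_le/(_ _ e20)[n _ /(_ n (leqnn n)) /=] := cd.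
rewrite sub0r normrN => hn; have {}hn := le_trans (ler_norm _) hn.
have cs : (fun s => \sum_(k < n) (c_ s k - c k) ^+ 2) @ X --> 0.
  have z0 : \sum_(k < n) (c k - c k) ^+ 2 = 0.
    by rewrite big1// => k _; rewrite subrr expr0n.
  rewrite -[X in _ --> X]z0.
  apply: (@cvg_sum_filter R S X _ n (fun k s => (c_ s k - c k) ^+ 2)
    (fun k => (c k - c k) ^+ 2)) => k.
  have h : (fun s => c_ s k - c k) @ X --> c k - c k.
    by apply: cvgB; [exact: cv|exact: cvg_cst].
  by under eq_fun do rewrite expr2; rewrite expr2; apply: cvgM.
have /cvgrPdist_le/(_ _ e20) := cs; apply: filterS2 cM => s sM.
rewrite sub0r normrN => hs; rewrite sub0r normrN ger0_norm ?coef_dist_ge0//.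
have : coef_dist (c_ s) c <=
    \sum_(k < n) (c_ s k - c k) ^+ 2 + decay R n * (4 * M).
  apply: inner_le_of_coef; first by apply: sqintB => //; exact: sqint_L2.
  move=> N; under eq_bigr do rewrite (coef_of_sub _ sM cM').
  exact: (weighted_tail n N (weighted_le_sub sM cM')).
by have := le_trans (ler_norm _) hs; lra.
Qed.

Lemma trajectory_continuous_Hspace alpha T M u : 0 <= alpha ->
  (forall t, t \in `[0, T] -> weighted_le wt M (u t)) ->
  (forall k, {within `[0, T], continuous (u^~ k)}) ->
  continuous_Hspace (- alpha) T u.
Proof.
move=> a0 uM cu t tT; split.
  apply: le_lt_trans (Hnorm_neg_le a0 (weighted_le_sum (uM t tT))) _.
  exact: ltry.
pose X := within `[0, T] (nbhs t).
have FX : ProperFilter X by apply: within_nbhs_proper; exact: subset_closure.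
have inX : \forall s \near X, s \in `[0, T].
  by rewrite /X near_withinE; exact: nearW.
have Bcv : (fun s => coef_dist (u s) (u t)) @ X --> 0.
  apply: (coef_dist_cvg (M := M)) (uM t tT) _.
    by apply: filterS inX => s sT; exact: uM.
  by move=> k; have /subspace_continuousP := @cu k; apply.
apply: (@squeeze_cvge _ _ _ _ (cst 0%E) _ (fun s => (Num.sqrt (coef_dist (u s) (u t)))%:E)).
- apply: filterS inX => s sT; rewrite Hnorm_ge0 /=.
  apply: Hnorm_neg_le => // n.
  under eq_bigr do rewrite /= -(coef_of_sub _ (uM s sT) (uM t tT)).
  by apply: bessel; apply: sqintB => //; exact: sqint_L2.
- exact: cvg_cst.
- apply: cvg_EFin; first exact: nearW.
  have c0 : Num.sqrt x @[x --> (0 : R)] --> Num.sqrt (0 : R) by exact: sqrt_continuous.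
  by have := cvg_comp _ _ Bcv c0; rewrite sqrtr0.
Qed.

Lemma ae_summable T E F : (forall k, sqint leb `[0, T] (F k)) ->
  (forall n, \sum_(k < n) \int[leb]_(s in `[0, T]) (F k s ^+ 2) <= E) ->
  {ae leb, forall s, s \in `[0, T] ->
    exists M, forall n, \sum_(k < n) F k s ^+ 2 <= M}.
Proof.
move=> sF FE.
pose I : set (measurableTypeR R) := `[0, T]%classic.
have mI : measurable I by exact: mitv.
pose h s := (\sum_(0 <= k <oo) (F k s ^+ 2)%:E)%E.
have mterm k : measurable_fun I (fun s => (F k s ^+ 2)%:E).
  by apply/measurable_EFinP; exact: intg_measurable (sF k).2.
have term0 k s : (0 <= (F k s ^+ 2)%:E)%E by rewrite lee_fin sqr_ge0.
have hint : leb.-integrable I h.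
  apply/integrableP; split.
    apply: (@ge0_emeasurable_sum _ _ _ I _ predT) => // k x Dx _; exact: term0.
  under eq_integral => x xD.
    rewrite gee0_abs; last by apply: nneseries_ge0 => k _ _; exact: term0.
    over.
  rewrite (integral_nneseries leb mI mterm (fun k s _ => term0 k s)).
  apply: (@le_lt_trans _ _ E%:E); last exact: ltry.
  apply: lime_le.
    by apply: is_cvg_nneseries => k _ _; apply: integral_ge0 => s _; exact: term0.
  apply: nearW => n; rewrite big_mkord.
  have -> : (\sum_(k < n) \int[leb]_(s in I) (F k s ^+ 2)%:E =
     (\sum_(k < n) \int[leb]_(s in `[0%R, T]) (F k s ^+ 2))%:E)%E.
    by rewrite -sumEFin; apply: eq_bigr => k _; rewrite EFin_Rintegral//; exact: (sF k).2.
  by rewrite lee_fin.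
apply: ae_imply (integrable_ae mI hint) => s hs sT.
exists (fine (h s)) => n; rewrite -lee_fin fineK; last exact: hs.
rewrite -sumEFin -(big_mkord xpredT (fun k => (F k s ^+ 2)%:E)).
by apply: nneseries_lim_ge => k _ _; exact: term0.
Qed.

(** The coefficients [F] of the forcing are square-summable only for almost every
    time; they are assembled into elements of H after having been set to 0 on the
    exceptional set. *)
Lemma trajectory_quasi_potential alpha T E u F : 0 <= alpha -> alpha < 2^-1 ->
  0 < T -> trajectory alpha T E u F ->
  (quasi_potential alpha (u T) <= (2^-1 * E)%:E)%E.
Proof.
move=> a0 a1 T0 tr; have T0' := ltW T0.
have [[M uM] mu_ sF FE ueq] := tr.
have uM' t tT := weighted_le_sum (uM t tT).
pose I : set (measurableTypeR R) := `[0, T]%classic.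
have mI : measurable I by exact: mitv.
have [Nn [mN N0 subN]] := ae_summable sF FE.
pose F' k s := F k s * \1_(~` Nn) s.
have F'E k s : ~ Nn s -> F' k s = F k s.
  by move=> ns; rewrite /F' indicE mem_set ?mulr1.
have F'0 k s : Nn s -> F' k s = 0.
  by move=> ns; rewrite /F' indicE memNset ?mulr0//; apply.
pose f s : L2 R := of_coef (F'^~ s).
have fE s k : s \in `[0, T] -> coef (f s) k = F' k s.
  move=> sT; have [ns|ns] := pselect (Nn s).
    rewrite /f (_ : F'^~ s = fun=> 0); last by apply/funext => j; exact: F'0.
    have c0 n : \sum_(j < n) ((fun=> 0) j : R) ^+ 2 <= 0.
      by rewrite big1// => j _; exact: expr0n.
    by rewrite (of_coefK c0) F'0.
  have [K hK] : exists K, forall n, \sum_(j < n) F j s ^+ 2 <= K.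
    by apply: contrapT => h; apply: ns; apply: subN => /= /(_ sT).
  rewrite /f (@of_coefK _ _ K)// => n.
  by under eq_bigr do rewrite F'E//; exact: hK.
have mF' k : measurable_fun I (F' k).
  apply: measurable_funM; first exact: (sF k).1.
  by apply: measurable_indic; exact: measurableC.
have mfc k : measurable_fun I (fun s => coef (f s) k).
  by apply: eq_measurable_fun (mF' k) => s /set_mem sT; rewrite fE.
have aeF k : ae_eq leb I (F k) (fun s => coef (f s) k).
  exists Nn; split => // s /= /not_implyP[sT]; apply: contra_notP => ns.
  by rewrite fE// F'E.
have sfc k : sqint leb `[0, T] (fun s => coef (f s) k).
  split; first exact: mfc.
  apply: (@intg_ae _ _ _ leb I mI _ _ _ _ (sF k).2).
    exact: measurable_funX (mfc k).
  by apply: ae_imply (aeF k) => s h /h ->.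
have [iN leN] : intg leb `[0, T] (fun s => L2norm (f s) ^+ 2) /\
    \int[leb]_(s in `[0, T]) (L2norm (f s) ^+ 2) <= E.
  apply: (@Rintegral_fatou _ _ _ leb I mI (fun n s => \sum_(k < n) coef (f s) k ^+ 2)).
  - by move=> n; apply: intg_sum => // k; exact: (sfc k).2.
  - by move=> n s _; apply: sumr_ge0 => k _; exact: sqr_ge0.
  - move=> s _; rewrite L2norm_sqr; last exact: sqint_L2.
    by apply: parseval; exact: sqint_L2.
  - move=> n; rewrite Rintegral_sum//; last by move=> k; exact: (sfc k).2.
    apply: le_trans (FE n); rewrite le_eqVlt; apply/orP; left; apply/eqP.
    apply: eq_bigr => k _; apply/esym; apply: (@Rintegral_ae _ _ _ leb I mI).
    + exact: intg_measurable (sF k).2.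
    + exact: intg_measurable (sfc k).2.
    + by apply: ae_imply (aeF k) => s h /h ->.
have sqrE : (sqr_int_L2 T f <= E%:E)%E.
  by rewrite /sqr_int_L2 -EFin_Rintegral// lee_fin.
have forcing : is_forcing alpha T u f.
  split.
    split; last by apply: le_lt_trans sqrE _; exact: ltry.
    by move=> h; apply: measurable_inner => //; exact: sqint_L2.
  exists (fun t => of_coef (u t)); split.
  - split.
      move=> h; apply: measurable_inner => //; first exact: sqint_L2.
      move=> k; apply: eq_measurable_fun (mu_ k) => s /set_mem sT.
      by rewrite (of_coefK (uM' s sT)).
    exists (1 + M); apply: aeW => t tT.
    have := inner_of_coef_le (uM' t tT); rewrite inner_sqr -L2norm_sqr; last exact: sqint_L2.
    have := L2norm_ge0 (of_coef (u t)); have := weighted_le_ge0 (uM t tT).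
    by rewrite expr2; nra.
  - by apply: aeW => t tT; rewrite (of_coefK (uM' t tT)).
  move=> t tT k; have t0 : 0 <= t by move: tT; rewrite in_itv /= => /andP[].
  have u00 : u 0 k = 0.
    by rewrite ueq ?set_itv1 ?Rintegral_set1// in_itv /= lexx.
  rewrite /heat u00 mulr0 add0r.
  have gi := sqint_intg_itv (traj_g_sqint T0' tr k).
  rewrite (mild_of_ode gi (traj_intg T0' tr k) (@traj_eq _ _ _ _ _ _ tr k) tT).
  have sb := sqint_subitv tT (traj_convect_sqint T0' tr k).
  have sf := sqint_subitv tT (traj_forcing_sqint tr k).
  have ie : intg leb `[0, t] (fun s => expR (- (lam k * (t - s))) * convect (u s) k).
    have := intgZ (@mitv R `[0, t]) (expR (- lam k * t))
      (intg_expM_mul (lam k) (sqint_intg_itv sb)).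
    apply: intg_eq => // s _; rewrite mulrA -expRD; congr (expR _ * _); ring.
  have ie' : intg leb `[0, t] (fun s => expR (- (lam k * (t - s))) * (apow alpha k * F k s)).
    have := intgZ (@mitv R `[0, t]) (expR (- lam k * t))
      (intg_expM_mul (lam k) (sqint_intg_itv sf)).
    apply: intg_eq => // s _; rewrite mulrA -expRD; congr (expR _ * _); ring.
  under eq_Rintegral do rewrite mulrDr.
  rewrite RintegralD//; congr (_ + _).
    rewrite -RintegralZl//; first by apply: eq_Rintegral => s _; rewrite heatDE.
    have := intgZ (@mitv R `[0, t]) 2 ie; apply: intg_eq => // s _.
    by rewrite /convect -heatDE; field.
  pose J : set (measurableTypeR R) := `[0, t]%classic.
  have mJ : measurable J by exact: mitv.
  have JI : J `<=` I.
    move=> s; rewrite /J /I /=; move: tT; rewrite !in_itv /= => /andP[_ tT] /andP[-> st].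
    exact: le_trans tT.
  have me : measurable_fun J (fun s => expR (- (lam k * (t - s)))).
    apply: measurableT_comp => //; apply: measurableT_comp => //.
    by apply: measurable_funM => //; apply: measurable_funB.
  apply: (@Rintegral_ae _ _ _ leb J mJ).
  - exact: intg_measurable ie'.
  - apply: (measurable_funM me); apply: measurable_funM => //.
    by apply: measurable_funS (mfc k).
  - by apply: ae_imply (aeF k) => s h /JI /h ->.
apply: (@le_trans _ _ (action alpha T u)).
  apply: ereal_inf_lbound; exists T, u; split => //.
    apply: (trajectory_continuous_Hspace a0 uM) => k.
    exact: (@traj_continuous _ _ _ _ _ _ T0' tr k).
  apply/funext => k; rewrite ueq ?set_itv1 ?Rintegral_set1//.
  by rewrite in_itv /= lexx.
apply: (@le_trans _ _ ((2^-1)%:E * sqr_int_L2 T f)%E).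
  by apply: ereal_inf_lbound; exists f.
by rewrite EFinM lee_pmul2l// lte_fin.
Qed.

End trajectories_and_forcings.

(** * Minimal norm in decreasing convex sets *)

Section near_minimizers.
Context d (T : measurableType d) (R : realType).
Variables (mu : {measure set T -> \bar R}) (D : set T).
Hypothesis mD : measurable D.
Implicit Types f g h : T -> R.
Local Notation sq f := (\int[mu]_(x in D) (f x ^+ 2)).

Lemma sqint_sq_ge0 f : 0 <= sq f.
Proof. by apply: Rintegral_ge0 => x _; exact: sqr_ge0. Qed.

Lemma sqint_young (e : R) f g : 0 < e -> sqint mu D f -> sqint mu D g ->
  sq f <= (1 + e) * sq g + (1 + e^-1) * \int[mu]_(x in D) ((g x - f x) ^+ 2).
Proof.
move=> e0 sf sg; have sgf := sqintB mD sg sf.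
rewrite -(RintegralZl _ mD sg.2) -(RintegralZl _ mD sgf.2).
rewrite -(RintegralD mD (intgZ mD _ sg.2) (intgZ mD _ sgf.2)).
apply: (le_Rintegral mD sf.2).
  exact: intgD mD _ _ (intgZ mD _ sg.2) (intgZ mD _ sgf.2).
move=> x _; have := sqr_ge0 (e * g x + (g x - f x)); rewrite -subr_ge0 => h.
rewrite -subr_ge0 (_ : _ - _ = e^-1 * ((e * g x + (g x - f x)) ^+ 2 - 0)); last first.
  by field; rewrite gt_eqF.
by apply: mulr_ge0 => //; rewrite invr_ge0 ltW.
Qed.

Lemma sqint_parallelogram f g : sqint mu D f -> sqint mu D g ->
  \int[mu]_(x in D) ((f x - g x) ^+ 2) =
  2 * sq f + 2 * sq g - 4 * \int[mu]_(x in D) ((2^-1 * (f x + g x)) ^+ 2).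
Proof.
move=> sf sg; have sm := sqintZ mD 2^-1 (sqintD mD sf sg).
rewrite -(RintegralZl _ mD sf.2) -(RintegralZl _ mD sg.2) -(RintegralZl _ mD sm.2).
have i1 := intgD mD (intgZ mD 2 sf.2) (intgZ mD 2 sg.2).
rewrite -(RintegralD mD (intgZ mD 2 sf.2) (intgZ mD 2 sg.2)).
rewrite -(RintegralB mD i1 (intgZ mD 4 sm.2)).
by apply: eq_Rintegral => x _; field.
Qed.

(** The argument of the projection theorem: by the parallelogram identity,
    elements of [C n] whose norms approach the infimum over [C n] form a Cauchy
    sequence as [n] grows. This replaces weak compactness. *)
Lemma convex_near_minimizers (C : nat -> (T -> R) -> Prop) (K : R) :
  (forall n f, C n f -> sqint mu D f) ->
  (forall m n f, (n <= m)%N -> C m f -> C n f) ->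
  (forall n f g, C n f -> C n g -> C n (fun x => 2^-1 * (f x + g x))) ->
  (forall n (e : R), 0 < e -> exists2 f, C n f & sq f <= K + e) ->
  exists (h : nat -> T -> R) f, [/\ forall n, C n (h n), sqint mu D f,
    sq f <= K & forall e : R, 0 < e -> exists N, forall n, (N <= n)%N ->
      \int[mu]_(x in D) ((h n x - f x) ^+ 2) <= e].
Proof.
move=> sC decC midC exC.
pose V n := [set z | exists2 f, C n f & z = sq f].
have lbV n : lbound (V n) 0 by move=> _ [f _ ->]; exact: sqint_sq_ge0.
have infV n : has_inf (V n).
  split; last by exists 0.
  by have [f Cf _] := exC n 1 ltr01; exists (sq f); exists f.
pose dd n := inf (V n).
have dle n f : C n f -> dd n <= sq f.
  by move=> Cf; apply: ge_inf; [exists 0|exists f].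
have dK n : dd n <= K.
  apply/ler_addgt0Pr => e e0; have [f Cf fK] := exC n e e0.
  exact: le_trans (dle n f Cf) fK.
have dmono : nondecreasing_seq dd.
  move=> n m nm; apply: lb_le_inf; first exact: (infV m).1.
  by move=> _ [f Cf ->]; apply: dle; exact: decC Cf.
have dcv : cvgn dd.
  by apply: nondecreasing_is_cvgn => //; exists K => _ [n _ <-].
pose l : R := limn dd.
have dl : dd @ \oo --> l by exact: dcv.
have lK n : dd n <= l by exact: nondecreasing_cvgn_le.
have eps0 n : 0 < n.+1%:R^-1 :> R by rewrite invr_gt0.
have /choice[h hP] n : exists h, C n h /\ sq h <= dd n + n.+1%:R^-1.
  have [_ [f Cf ->] fe] := inf_adherent (eps0 n) (infV n).
  by exists f; split => //; exact: ltW.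
have sh n : sqint mu D (h n) by exact: sC (hP n).1.
have cauchy (e : R) : 0 < e -> exists N, forall m n, (N <= m)%N -> (N <= n)%N ->
    \int[mu]_(x in D) ((h m x - h n x) ^+ 2) <= e.
  move=> e0; have e80 : 0 < e / 8 by rewrite divr_gt0.
  have /cvgrPdist_le/(_ _ e80)[N1 _ HN1] := dl.
  have /cvgrPdist_le/(_ _ e80)[N2 _ HN2] := @cvg_harmonic R.
  exists (maxn N1 N2) => m n; rewrite !geq_max => /andP[m1 m2] /andP[n1 n2].
  have := HN1 N1 (leqnn N1); rewrite /= => /(le_trans (ler_norm _)) b1.
  have := HN2 m m2; rewrite /= sub0r normrN => /(le_trans (ler_norm _)) b2.
  have := HN2 n n2; rewrite /= sub0r normrN => /(le_trans (ler_norm _)) b3.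
  have mid := dle _ _ (midC _ _ _ (decC _ _ _ m1 (hP m).1) (decC _ _ _ n1 (hP n).1)).
  rewrite sqint_parallelogram//.
  have := (hP m).2; have := (hP n).2; have := lK m; have := lK n.
  move: b2 b3 mid b1; rewrite /harmonic /=; clear -e0 e80.
  move: (m.+1%:R^-1) (n.+1%:R^-1) (sq (h m)) (sq (h n)) (dd N1) (dd m) (dd n) => *.
  by lra.
have [f sf hf] := sqint_complete mD sh cauchy.
exists h, f; split => //; first by move=> n; exact: (hP n).1.
have K0 : 0 <= K.
  apply: le_trans (dK 0%N); apply: lb_le_inf (lbV 0%N); exact: (infV 0%N).1.
have step (e : R) : 0 < e -> sq f <= (1 + e) * (K + e) + e.
  move=> e0; have ei0 : 0 < e^-1 by rewrite invr_gt0.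
  have e'0 : 0 < e / (1 + e^-1) by rewrite divr_gt0// addr_gt0.
  have [N HN] := hf _ e'0.
  have /cvgrPdist_le/(_ _ e0)[N2 _ HN2] := @cvg_harmonic R.
  pose n := maxn N N2.
  have := HN2 n (leq_maxr _ _); rewrite /= sub0r normrN => /(le_trans (ler_norm _)) b.
  apply: le_trans (sqint_young e0 sf (sh n)) _.
  apply: lerD.
    apply: ler_wpM2l; first by rewrite addr_ge0// ltW.
    by apply: le_trans (hP n).2 _; apply: lerD.
  have eE : (1 + e^-1) * (e / (1 + e^-1)) = e.
    by rewrite mulrC divfK// gt_eqF// addr_gt0.
  by rewrite -[leRHS]eE; apply: ler_wpM2l (HN n (leq_maxl _ _)); rewrite addr_ge0// ltW.
apply/ler_addgt0Pr => e e0.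
(* for [d <= 1], [(1 + d) * (K + d) + d <= K + d * (K + 3)] *)
pose d0 := Num.min 1 (e / (K + 3)).
have d00 : 0 < d0 by rewrite lt_min ltr01 divr_gt0//; lra.
have d01 : d0 <= 1 by rewrite ge_min lexx.
have d0e : d0 * (K + 3) <= e.
  by rewrite -ler_pdivlMr; [rewrite ge_min lexx orbT|lra].
apply: le_trans (step _ d00) _; nra.
Qed.

End near_minimizers.

(** * Limits of primitives and of sequences of paths *)

Section limits_of_primitives.
Context (R : realType).
Local Notation leb := (@lebesgue_measure R).
Implicit Types (S T t s : R) (g : R -> R).

Lemma fine_leb_itv s t : s <= t -> fine (leb (`[s, t]%classic : set R)) = t - s.
Proof.
move=> st; rewrite lebesgue_measure_itv /= lte_fin.
by case: ltgtP st => //= -> _; rewrite subrr.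
Qed.

Lemma intg_obnd (a b : R) (f : R -> R) : intg leb `[a, b] f -> intg leb `]a, b] f.
Proof. by apply: integrableS => //; apply: subset_itv; rewrite bnd_simp. Qed.

Lemma Rintegral_split (a b t : R) (f : R -> R) : a <= b -> b <= t ->
  intg leb `[a, t] f ->
  \int[leb]_(s in `[a, t]) f s =
  \int[leb]_(s in `[a, b]) f s + \int[leb]_(s in `[b, t]) f s.
Proof.
move=> ab bt fi; have fi' : intg leb `[b, t] f by exact: intg_subitv fi.
rewrite -(Rintegral_itv_obnd_cbnd (r := b) (intg_obnd fi')).
by rewrite -(@Rintegral_itvB _ f (BLeft a) (BRight t) b fi) ?bnd_simp// addrC subrK.
Qed.

Lemma primitive_increment_le T g s t : sqint leb `[0, T] g ->
  0 <= s -> s <= t -> t <= T ->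
  (\int[leb]_(r in `[0, t]) g r - \int[leb]_(r in `[0, s]) g r) ^+ 2 <=
  (t - s) * \int[leb]_(r in `[0, T]) (g r ^+ 2).
Proof.
move=> sg s0 st tT.
have gi := sqint_intg_itv sg.
have git : intg leb `[0, t] g by exact: intg_subitv gi.
rewrite (Rintegral_split s0 st git) addrAC subrr add0r.
have sub : `[s, t]%classic `<=` (`[0, T]%classic : set R).
  by apply: subset_itvScc; rewrite bnd_simp; lra.
have sgt : sqint leb `[s, t] g.
  split; first by apply: measurable_funS sg.1.
  by apply: intg_subitv sg.2; lra.
have s1 : sqint leb `[s, t] (fun=> 1).
  by apply: sqint_continuous; apply: continuous_subspaceT => x; exact: cst_continuous.
have := sqint_cauchy_schwarz (@mitv R `[s, t]) sgt s1.
under eq_Rintegral do rewrite mulr1.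
move/le_trans; apply.
under [X in _ * X]eq_Rintegral do rewrite expr1n.
rewrite Rintegral_cst// fine_leb_itv// mul1r mulrC ler_wpM2l ?subr_ge0//.
rewrite -lee_fin !EFin_Rintegral//; [|exact: sg.2|exact: sgt.2].
apply: ge0_subset_integral => //.
- by case/integrableP : sg.2.
- by move=> r _; rewrite lee_fin sqr_ge0.
Qed.

(** A weak limit in L^2 of derivatives is the derivative of the limit. The
    limit is produced as the strong limit of near-minimizers of the norm among
    the functions whose primitives stay as close to [y] as a tail of the
    sequence. *)
Lemma primitive_limit T (g_ : nat -> R -> R) (y : R -> R) (K : R) :
  (forall n, sqint leb `[0, T] (g_ n)) ->
  (forall t, t \in `[0, T] -> \int[leb]_(s in `[0, t]) g_ n s @[n --> \oo] --> y t) ->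
  \int[leb]_(s in `[0, T]) (g_ n s ^+ 2) @[n --> \oo] --> K ->
  exists g, [/\ sqint leb `[0, T] g,
    forall t, t \in `[0, T] -> y t = \int[leb]_(s in `[0, t]) g s &
    \int[leb]_(s in `[0, T]) (g s ^+ 2) <= K].
Proof.
move=> sg gy gK.
pose P t g := \int[leb]_(s in `[0, t]) g s.
pose C n g := sqint leb `[0, T] g /\ forall t, t \in `[0, T] -> forall d : R,
  (forall m, (n <= m)%N -> `|P t (g_ m) - y t| <= d) -> `|P t g - y t| <= d.
have mI : measurable (`[0, T]%classic : set (measurableTypeR R)) by exact: mitv.
have ip t g : t \in `[0, T] -> sqint leb `[0, T] g -> intg leb `[0, t] g.
  by move=> tT sg'; exact: sqint_intg_itv (sqint_subitv tT sg').
have [||||h [g [Ch sg' gle hg]]] := @convex_near_minimizers _ _ R leb `[0, T]%classic mI C K.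
- by move=> n g [].
- move=> m n g nm [sg' hg]; split => // t tT d hd; apply: hg => // j mj.
  by apply: hd; exact: leq_trans mj.
- move=> n f g [sf hf] [sg' hg]; split.
    by apply: sqintZ => //; exact: sqintD.
  move=> t tT d hd; have := hf t tT d hd; have := hg t tT d hd.
  have -> : P t (fun x => 2^-1 * (f x + g x)) = 2^-1 * (P t f + P t g).
    rewrite /P RintegralZl//; last by apply: intgD => //; exact: ip.
    by rewrite RintegralD//; exact: ip.
  rewrite !ler_norml => /andP[? ?] /andP[? ?]; apply/andP; split; lra.
- move=> n e e0; have /cvgrPdist_le/(_ _ e0)[N _ HN] := gK.
  exists (g_ (maxn n N)).
    by split => // t tT d; apply; exact: leq_maxl.
  have := HN (maxn n N) (leq_maxr _ _); rewrite /= distrC ler_norml => /andP[_]; lra.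
exists g; split => // t tT; have [t0 tT'] : 0 <= t /\ t <= T.
  by move: tT; rewrite in_itv /= => /andP[].
apply/eqP; rewrite -subr_eq0 -normr_le0; apply/ler_addgt0Pr => e e0; rewrite add0r.
have e20 : 0 < e / 2 by rewrite divr_gt0.
have /cvgrPdist_le/(_ _ e20)[N1 _ HN1] := gy t tT.
have d0 : 0 < (e / 2) ^+ 2 / (T + 1) by rewrite divr_gt0 ?exprn_gt0//; lra.
have [N2 HN2] := hg _ d0.
pose n := maxn N1 N2.
have h1 : `|P t (h n) - y t| <= e / 2.
  apply: (Ch n).2 => // m nm; rewrite distrC; apply: HN1 => /=.
  by apply: leq_trans nm; exact: leq_maxl.
have h2 : (P t (h n) - P t g) ^+ 2 <= (e / 2) ^+ 2.
  have sd := sqintB mI (Ch n).1 sg'.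
  have := primitive_increment_le sd (lexx 0) t0 tT'.
  rewrite set_itv1 Rintegral_set1 !subr0 /P.
  rewrite RintegralB//; [|exact: ip (Ch n).1|exact: ip].
  move=> h2; apply: le_trans h2 _.
  apply: le_trans (ler_wpM2l t0 (HN2 n (leq_maxr _ _))) _.
  rewrite mulrA ler_pdivrMr; last lra.
  by rewrite mulrC ler_wpM2l ?sqr_ge0//; lra.
have {}h2 : `|P t (h n) - P t g| <= e / 2.
  by rewrite -(ler_pXn2r (n := 2))// ?nnegrE ?normr_ge0 ?(ltW e20)// -normrX ger0_norm ?sqr_ge0.
move: h1 h2; rewrite /P !ler_norml => /andP[? ?] /andP[? ?]; apply/andP; split; lra.
Qed.

Lemma ultra_bounded_cvg (X : Type) (U : set_system X) (f : X -> R) (B : R) :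
  UltraFilter U -> U [set x | `|f x| <= B] -> exists l : R, f @ U --> l.
Proof.
move=> UU UB.
have fU : U (f @^-1` `[- B, B]%classic).
  by apply: filterS UB => x /=; rewrite in_itv /= -ler_norml.
have [l [_ cl]] := @segment_compact R (- B) B _ (fmap_proper_filter _ _) fU.
exists l => V Vl; have [//|nV] := in_ultra_setVsetC (f @^-1` V) UU.
have fnV : (f @ U) (~` V) by exact: nV.
by have [z [/= nz Vz]] := cl _ _ fnV Vl.
Qed.

(** Along an ultrafilter every bounded sequence converges; countably many of
    the limits are then realised along one sequence of indices. *)
Lemma diagonal_subsequence (I : countType) (x : nat -> I -> R) (B : I -> R) :
  (forall n i, `|x n i| <= B i) ->
  exists2 phi : nat -> nat, (forall n, (n <= phi n)%N) &
    forall i, cvgn (fun n => x (phi n) i).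
Proof.
move=> xB.
have [U [UU subU]] := ultraFilterLemma (@eventually_filter : ProperFilter \oo).
have /choice[l lP] i : exists l : R, (fun n => x n i) @ U --> l.
  apply: (@ultra_bounded_cvg _ U _ (B i) UU).
  by apply: filterS filterT => n _ /=; exact: xB.
pose A n (j : nat) := [set m | forall i, pickle i = j -> `|l i - x m i| <= n.+1%:R^-1].
have UA n j : U (A n j).
  have e0 : 0 < n.+1%:R^-1 :> R by rewrite invr_gt0.
  case: (pselect (exists i : I, pickle i = j)) => [[i ij]|no].
    have /cvgrPdist_le/(_ _ e0) := lP i; apply: filterS => m hm i' i'j.
    by have -> : i' = i by apply: (pcan_inj pickleK); rewrite i'j.
  by apply: filterS filterT => m _ i ij; case: no; exists i.
have Uall n N : U [set m | forall j, (j < N)%N -> A n j m].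
  elim: N => [|N ih]; first by apply: filterS filterT.
  apply: filterS2 ih (UA n N) => m h1 h2 j; rewrite ltnS leq_eqVlt.
  by case/predU1P => [->|/h1].
have /choice[phi phiP] n : exists m, (n <= m)%N /\ forall j, (j < n)%N -> A n j m.
  have Un : U [set m | (n <= m)%N] by apply: subU; exists n.
  have [m [m1 m2]] := filter_ex (filterI Un (Uall n n)).
  by exists m.
exists phi => [n|i]; first by case: (phiP n).
apply/cvg_ex; exists (l i); apply/cvgrPdist_le => e e0.
have /cvgrPdist_le/(_ _ e0)[N _ HN] := @cvg_harmonic R.
exists (maxn N (pickle i).+1) => // n /=; rewrite geq_max => /andP[Nn inn].
apply: le_trans ((phiP n).2 _ inn i erefl) _.
by have := HN n Nn; rewrite /= sub0r normrN; apply: le_trans; exact: ler_norm.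
Qed.

End limits_of_primitives.

(** * Compactness of trajectories on a fixed time interval *)

Section limits_of_trajectories.
Context (R : realType).
Local Notation leb := (@lebesgue_measure R).
Local Notation freq := (@freq R).
Local Notation wt := (wt R).
Local Notation lam := (lam R).
Implicit Types (c : nat -> R) (u : R -> nat -> R) (F : nat -> R -> R)
  (n k m N : nat) (M E S T t alpha : R).

Lemma ler_norm_sqr (a b : R) : `|a| <= b -> a ^+ 2 <= b ^+ 2.
Proof. by rewrite ler_norml !expr2 => /andP[? ?]; nra. Qed.

(** Arzela and Ascoli: equicontinuity extends convergence from a countable dense
    set of times to all times. *)
Lemma cvgn_of_dense S (C : R) (y : nat -> R -> R) : 0 <= S ->
  (forall n s t, 0 <= s -> s <= t -> t <= S ->
    (y n t - y n s) ^+ 2 <= (t - s) * C) ->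
  (forall q : rat, cvgn (fun n => y n (Num.max 0 (Num.min S (ratr q))))) ->
  forall t, t \in `[0, S] -> cvgn (fun n => y n t).
Proof.
move=> S0 yC yq t; rewrite in_itv /= => /andP[t0 tS].
apply/cauchy_cvgP; apply: cauchy_exP => e e0.
have C0 : 0 <= `|C| + 1 by rewrite addr_ge0.
pose d := (e / 2) ^+ 2 / (`|C| + 1).
have d0 : 0 < d by rewrite divr_gt0 ?exprn_gt0 ?divr_gt0// ltr_wpDl.
have [|q] := @rat_in_itvoo R (t - d) (t + d); first lra.
rewrite in_itv /= => /andP[q1 q2].
set p := Num.max 0 (Num.min S (ratr q)).
have pE : [/\ 0 <= p, p <= S, p - t <= d & t - p <= d].
  rewrite /p; case: (leP S (ratr q)) => h1.
    by rewrite max_r//; split => //; lra.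
  by case: (leP 0 (ratr q)) => h2; split => //; lra.
have [p0 pS pt tp] := pE.
have near_ n : `|y n t - y n p| <= e / 2.
  rewrite -(ler_pXn2r (n := 2))// ?nnegrE ?divr_ge0 ?(ltW e0)//.
  rewrite -normrX ger0_norm ?sqr_ge0//.
  apply: (@le_trans _ _ (d * (`|C| + 1))); last by rewrite divfK// gt_eqF// ltr_wpDl.
  have CC := ler_norm C.
  have [le|lt] := leP p t.
    apply: le_trans (yC n p t p0 le tS) _.
    apply: (@le_trans _ _ ((t - p) * (`|C| + 1))).
      by apply: ler_wpM2l; lra.
    exact: ler_wpM2r.
  rewrite -sqrrN opprB; apply: le_trans (yC n t p t0 (ltW lt) pS) _.
  apply: (@le_trans _ _ ((p - t) * (`|C| + 1))).
    by apply: ler_wpM2l; lra.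
  exact: ler_wpM2r.
have e20 : 0 < e / 2 by rewrite divr_gt0.
exists (limn (fun n => y n p)).
have /cvgrPdist_lt/(_ _ e20) := yq q; apply: filterS => n /=.
rewrite -/p /ball /= => h; have := near_ n; move: h.
rewrite !ltr_norml !ler_norml => /andP[? ?] /andP[? ?]; apply/andP; split; lra.
Qed.

Lemma cst_intg a b (K : R) : intg leb `[a, b] (fun=> K).
Proof.
by apply: intg_continuous; apply: continuous_subspaceT => x; exact: cst_continuous.
Qed.

Lemma Rintegral_sqr_bound S (f : R -> R) (B : R) : 0 <= S ->
  measurable_fun `[0, S] f -> (forall s, s \in `[0, S] -> f s ^+ 2 <= B) ->
  sqint leb `[0, S] f /\ \int[leb]_(s in `[0, S]) (f s ^+ 2) <= B * S.
Proof.
move=> S0 mf fB; have sf : sqint leb `[0, S] f.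
  apply: (@sqint_itv_bounded _ _ _ (1 + B)) => // s sS; have := fB s sS.
  rewrite ler_norml expr2 => h; apply/andP; split; nra.
split => //; apply: (@le_trans _ _ (\int[leb]_(s in `[0, S]) B)).
  by apply: le_Rintegral => //; [exact: sf.2|exact: cst_intg].
by rewrite Rintegral_cst// fine_leb_itv// subr0.
Qed.

(** The three terms bound the mean square of the quadratic term, of the forcing
    and of the linear term in the equation of the mode [k]. *)
Definition modulus alpha S E k : R :=
  4 * (freq k * E) ^+ 2 * S + 4 * apow alpha k ^+ 2 * E +
  2 * lam k ^+ 2 * E * S.

(** The coefficients are Hoelder continuous of exponent 1/2, with one constant
    per mode for all trajectories of bounded action on a given interval. *)
Lemma trajectory_increment alpha S E u F k s t : alpha < 2^-1 ->
  trajectory alpha S E u F -> 0 <= s -> s <= t -> t <= S ->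
  (u t k - u s k) ^+ 2 <= (t - s) * modulus alpha S E k.
Proof.
move=> a1 tr s0 st tS; have S0 : 0 <= S by lra.
have en r rS := fun n => trajectory_energy (t := r) n a1 tr rS.
have [[M uM] mu_ sF FE ueq] := tr.
have sc := traj_convect_sqint S0 tr k.
have sf := traj_forcing_sqint tr k.
have [su us] := @Rintegral_sqr_bound S (u^~ k) E S0 (mu_ k)
  (fun r rS => sum_le_sqr k (en r rS)).
have slu : sqint leb `[0, S] (fun r => - (lam k * u r k)) by apply: sqintN => //; exact: sqintZ.
have scf := sqintD (@mitv R `[0, S]) sc sf.
rewrite !ueq; [|rewrite in_itv /=; lra|rewrite in_itv /=; lra].
have sh := sqintD (@mitv R `[0, S]) scf slu.
apply: le_trans (primitive_increment_le sh s0 st tS) _.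
apply: ler_wpM2l; first by rewrite subr_ge0.
apply: le_trans (sqint_add_le (@mitv R `[0, S]) scf slu) _.
have h1 := sqint_add_le (@mitv R `[0, S]) sc sf.
have [_ h2] := @Rintegral_sqr_bound S (fun r => convect (u r) k) ((freq k * E) ^+ 2) S0 sc.1
  (fun r rS => ler_norm_sqr (convect_bound k (en r rS))).
have h3 : \int[leb]_(r in `[0, S]) ((apow alpha k * F k r) ^+ 2) <= apow alpha k ^+ 2 * E.
  have -> : \int[leb]_(r in `[0, S]) ((apow alpha k * F k r) ^+ 2) =
      apow alpha k ^+ 2 * \int[leb]_(r in `[0, S]) (F k r ^+ 2).
    rewrite -RintegralZl//; last exact: (sF k).2.
    by apply: eq_Rintegral => r _; rewrite exprMn.
  apply: ler_wpM2l; first exact: sqr_ge0.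
  apply: le_trans (FE k.+1); rewrite big_ord_recr /= lerDr.
  by apply: sumr_ge0 => j _; apply: Rintegral_ge0 => r _; exact: sqr_ge0.
have h4 : \int[leb]_(r in `[0, S]) ((- (lam k * u r k)) ^+ 2) <= lam k ^+ 2 * (E * S).
  have -> : \int[leb]_(r in `[0, S]) ((- (lam k * u r k)) ^+ 2) =
      lam k ^+ 2 * \int[leb]_(r in `[0, S]) (u r k ^+ 2).
    rewrite -RintegralZl//; last exact: su.2.
    by apply: eq_Rintegral => r _; rewrite sqrrN exprMn.
  by apply: ler_wpM2l; [exact: sqr_ge0|].
rewrite /modulus; move: h1 h2 h3 h4.
lra.
Qed.

Lemma cvgn_subseq (x : nat -> R) (l : R) (phi : nat -> nat) :
  (forall n, (n <= phi n)%N) -> x @ \oo --> l -> (fun n => x (phi n)) @ \oo --> l.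
Proof.
move=> le_phi xl; apply/cvgrPdist_le => e e0.
have /cvgrPdist_le/(_ _ e0)[N _ HN] := xl.
by exists N => // n /= Nn; apply: HN; exact: leq_trans (le_phi n).
Qed.

Lemma weighted_le_cvg (c_ : nat -> nat -> R) c M :
  (forall n, weighted_le wt M (c_ n)) ->
  (forall k, c_ n k @[n --> \oo] --> c k) -> weighted_le wt M c.
Proof.
move=> cM cv N.
have h : (fun n => \sum_(k < N) wt k * c_ n k ^+ 2) @ \oo --> \sum_(k < N) wt k * c k ^+ 2.
  apply: (@cvg_sum_filter R nat \oo _ N (fun k n => wt k * c_ n k ^+ 2)
    (fun k => wt k * c k ^+ 2)) => k.
  apply: cvgM; first exact: cvg_cst.
  by under eq_fun do rewrite expr2; rewrite expr2; apply: cvgM.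
by apply: (cvgr_to_le h); apply: nearW => n; exact: cM.
Qed.

Lemma convect_cvg (c_ : nat -> nat -> R) c M k :
  (forall n, weighted_le wt M (c_ n)) ->
  (forall k, c_ n k @[n --> \oo] --> c k) ->
  convect (c_ n) k @[n --> \oo] --> convect c k.
Proof.
move=> cM cv; apply: nl_cvg; [by move=> n; exact: sqint_L2|exact: sqint_L2|].
apply: (coef_dist_cvg (M := M)) (weighted_le_cvg cM cv) cv.
by apply: nearW => n; exact: cM.
Qed.

Lemma apow_gt0 alpha k : 0 < apow (R := R) alpha k.
Proof. exact: powR_gt0 (lam_gt0 R k). Qed.

(** A subsequence is chosen along which all coefficients converge at all rational
    times, hence at all times, together with the energies of all modes of the
    forcing. The uniform bound of weight [wt] turns this into convergence in H at
    each time, so the quadratic terms converge. The equation then says that the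
    primitives of the forcings converge, and [primitive_limit] provides the
    forcing of the limit without loss of energy. *)
Lemma trajectory_limit alpha S E (u_ : nat -> R -> nat -> R)
    (F_ : nat -> nat -> R -> R) (x : nat -> R) : alpha < 2^-1 -> 0 <= S ->
  (forall n, trajectory alpha S E (u_ n) (F_ n)) ->
  (forall k, u_ n S k @[n --> \oo] --> x k) ->
  exists u F, trajectory alpha S E u F /\ u S = x.
Proof.
move=> a1 S0 tr ux.
have SS : S \in `[0, S] by rewrite in_itv /= S0 lexx.
have en n t tS := fun m => trajectory_energy (t := t) m a1 (tr n) tS.
have E0 : 0 <= E by have := en 0%N S SS 0%N; rewrite big_ord0.
pose W := 10 * E ^+ 2 + 2 * E.
have uW n t tS : weighted_le wt W (u_ n t) := trajectory_weighted (t := t) a1 (tr n) tS.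
have ub n t k : t \in `[0, S] -> `|u_ n t k| <= 1 + E.
  move=> tS; have := sum_le_sqr k (en n t tS).
  rewrite ler_norml expr2 => h; apply/andP; split; nra.
have sF n k : sqint leb `[0, S] (F_ n k) by case: (tr n).
pose J n k := \int[leb]_(s in `[0, S]) (F_ n k s ^+ 2).
have J0 n k : 0 <= J n k by apply: Rintegral_ge0 => s _; exact: sqr_ge0.
have JE n N : \sum_(k < N) J n k <= E by case: (tr n).
have J1 n k : `|J n k| <= E.
  rewrite ger0_norm//; apply: le_trans (JE n k.+1); rewrite big_ord_recr /= lerDr.
  by apply: sumr_ge0.
(* rational times, projected to the interval *)
pose cl (q : rat) : R := Num.max 0 (Num.min S (ratr q)).
have clS q : cl q \in `[0, S].
  rewrite /cl in_itv /=; case: (leP S (ratr q)) => h1; first by rewrite max_r// S0 lexx.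
  by case: (leP 0 (ratr q)) => h2; rewrite ?lexx ?h2 ?(ltW h1).
pose X n (i : rat * nat + nat) : R :=
  match i with inl p => u_ n (cl p.1) p.2 | inr k => J n k end.
have [phi le_phi Xcv] : exists2 phi : nat -> nat, (forall n, (n <= phi n)%N) &
    forall i, cvgn (fun n => X (phi n) i).
  apply: (@diagonal_subsequence R _ X
    (fun i => match i with inl _ => 1 + E | inr _ => E end)) => n [[q k]|k] /=.
    exact: ub.
  exact: J1.
pose v n := u_ (phi n); pose G n := F_ (phi n).
have vcv t k : t \in `[0, S] -> cvgn (fun n => v n t k).
  apply: (@cvgn_of_dense S (modulus alpha S E k) (fun n t => v n t k) S0).
    by move=> n s r s0 sr rS; exact: trajectory_increment (tr (phi n)) _ _ _.
  by move=> q; exact: (Xcv (inl (q, k))).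
pose u t k := limn (fun n => v n t k).
have vu t k : t \in `[0, S] -> v n t k @[n --> \oo] --> u t k by exact: vcv.
pose K k := limn (fun n => J (phi n) k).
have JK k : J (phi n) k @[n --> \oo] --> K k by exact: (Xcv (inr k)).
have uS : u S = x.
  apply/funext => k.
  have h := @cvgn_subseq (fun n => u_ n S k) _ phi le_phi (ux k).
  exact: (cvg_lim _ h).
have uW' t : t \in `[0, S] -> weighted_le wt W (u t).
  move=> tS; apply: (@weighted_le_cvg (fun n => v n t)) => [n|k]; last exact: vu.
  exact: uW.
have mu_ k : measurable_fun `[0, S] (u^~ k).
  apply: (measurable_fun_cvg (h := fun n t => v n t k)); last by move=> t; exact: vu.
  by move=> n; case: (tr (phi n)) => _ h _ _ _; exact: h.
have mem t s : t \in `[0, S] -> s \in `[0, t] -> s \in `[0, S].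
  by rewrite !in_itv /= => /andP[_ tS] /andP[-> st]; exact: le_trans tS.
have memS t : t \in `[0, S] -> `[0, t]%classic `<=` (`[0, S]%classic : set R).
  by move=> tS s; exact: mem.
have It t : measurable (`[0, t]%classic : set (measurableTypeR R)) by exact: mitv.
have ucv t k : t \in `[0, S] -> intg leb `[0, t] (u^~ k) /\
    \int[leb]_(s in `[0, t]) v n s k @[n --> \oo] --> \int[leb]_(s in `[0, t]) u s k.
  move=> tS; apply: (@Rintegral_dominated _ _ _ leb `[0, t]%classic (It t)
    (fun n s => v n s k) (u^~ k) (fun=> 1 + E)).
  - move=> n; apply: (measurable_funS _ (memS t tS)) => //.
    by case: (tr (phi n)) => _ h _ _ _; exact: h.
  - by move=> s /(mem _ _ tS); exact: vu.
  - exact: cst_intg.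
  - by move=> n s /(mem _ _ tS); exact: ub.
have ccv t k : t \in `[0, S] -> intg leb `[0, t] (fun s => convect (u s) k) /\
    \int[leb]_(s in `[0, t]) convect (v n s) k @[n --> \oo] -->
    \int[leb]_(s in `[0, t]) convect (u s) k.
  move=> tS; apply: (@Rintegral_dominated _ _ _ leb `[0, t]%classic (It t)
    (fun n s => convect (v n s) k) (fun s => convect (u s) k) (fun=> freq k * E)).
  - move=> n; apply: (measurable_funS _ (memS t tS)) => //.
    exact: (traj_convect_sqint S0 (tr (phi n)) k).1.
  - move=> s /(mem _ _ tS) sS; apply: (@convect_cvg (fun n => v n s) _ W).
      by move=> n; exact: uW.
    by move=> j; exact: vu.
  - exact: cst_intg.
  - by move=> n s /(mem _ _ tS) sS; apply: convect_bound; exact: en.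
pose y k t := (apow alpha k)^-1 * (u t k -
  \int[leb]_(s in `[0, t]) convect (u s) k + lam k * \int[leb]_(s in `[0, t]) u s k).
have Gy k t : t \in `[0, S] -> \int[leb]_(s in `[0, t]) G n k s @[n --> \oo] --> y k t.
  move=> tS.
  have GE n : \int[leb]_(s in `[0, t]) G n k s = (apow alpha k)^-1 * (v n t k -
      \int[leb]_(s in `[0, t]) convect (v n s) k +
      lam k * \int[leb]_(s in `[0, t]) v n s k).
    have ic : intg leb `[0, t] (fun s => convect (v n s) k).
      exact: sqint_intg_itv (sqint_subitv tS (traj_convect_sqint S0 (tr (phi n)) k)).
    have iG : intg leb `[0, t] (G n k) by exact: sqint_intg_itv (sqint_subitv tS (sF _ _)).
    have iv : intg leb `[0, t] (fun s => v n s k).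
      exact: sqint_intg_itv (sqint_subitv tS (traj_sqint S0 (tr (phi n)) k)).
    have -> : v n t k = \int[leb]_(s in `[0, t]) convect (v n s) k +
        apow alpha k * \int[leb]_(s in `[0, t]) G n k s -
        lam k * \int[leb]_(s in `[0, t]) v n s k.
      apply: etrans (traj_eq (tr (phi n)) k tS) _.
      have i1 := intgZ (It t) (apow alpha k) iG.
      have i2 := intgZ (It t) (lam k) iv.
      rewrite (RintegralB (It t) (intgD (It t) ic i1) i2) (RintegralD (It t) ic i1).
      by rewrite (RintegralZl _ (It t) iG) (RintegralZl _ (It t) iv).
    by field; rewrite gt_eqF// apow_gt0.
  under eq_fun do rewrite GE.
  apply: cvgM; first exact: cvg_cst.
  apply: cvgD; first by apply: cvgB; [exact: vu|exact: (ccv t k tS).2].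
  by apply: cvgM; [exact: cvg_cst|exact: (ucv t k tS).2].
have /choice[F FP] k : exists g, [/\ sqint leb `[0, S] g,
    forall t, t \in `[0, S] -> y k t = \int[leb]_(s in `[0, t]) g s &
    \int[leb]_(s in `[0, S]) (g s ^+ 2) <= K k].
  apply: (@primitive_limit R S (fun n => G n k)); [by move=> n; exact: sF| |exact: JK].
  by move=> t; exact: Gy.
exists u, F; split => //; split.
- by exists W.
- exact: mu_.
- by move=> k; case: (FP k).
- move=> N; apply: (@le_trans _ _ (\sum_(k < N) K k)).
    by apply: ler_sum => k _; case: (FP k).
  have h : (fun n => \sum_(k < N) J (phi n) k) @ \oo --> \sum_(k < N) K k.
    exact: (@cvg_sum_filter R nat \oo _ N (fun k n => J (phi n) k) K JK).
  by apply: (cvgr_to_le h); apply: nearW => n; exact: JE.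
- move=> t tS k; have [sFk Fy _] := FP k.
  have iF := sqint_intg_itv (sqint_subitv tS sFk).
  have i1 := intgZ (It t) (apow alpha k) iF.
  have i2 := intgZ (It t) (lam k) (ucv t k tS).1.
  rewrite (RintegralB (It t) (intgD (It t) (ccv t k tS).1 i1) i2).
  rewrite (RintegralD (It t) (ccv t k tS).1 i1) (RintegralZl _ (It t) iF).
  rewrite (RintegralZl _ (It t) (ucv t k tS).1) -(Fy t tS) /y.
  by field; rewrite gt_eqF// apow_gt0.
Qed.

End limits_of_trajectories.

(** * Concatenation of trajectories *)

Section concatenation.
Context (R : realType).
Local Notation leb := (@lebesgue_measure R).
Local Notation freq := (@freq R).
Local Notation wt := (wt R).
Local Notation lam := (lam R).
Implicit Types (c : nat -> R) (u : R -> nat -> R) (F : nat -> R -> R)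
  (n k m N : nat) (M E S T t a b alpha : R).

Definition paste b d (f g : R -> R) s : R := if s <= b then f s else g (s - d).

Lemma paste_intg b t0 T (f g : R -> R) : 0 <= b -> t0 <= T ->
  intg leb `[0, b] f -> intg leb `[t0, T] g ->
  intg leb `[0, b + (T - t0)] (paste b (b - t0) f g).
Proof.
move=> b0 tT fi gi; set h := paste _ _ _ _.
have hf : intg leb `[0, b] h.
  by apply: intg_eq fi => // s; rewrite /= in_itv /= /h /paste => /andP[_ ->].
have [gi' _] := Rintegral_shift (b - t0) gi.
have hg : intg leb `]b, b + (T - t0)] h.
  have := intg_obnd gi'.
  rewrite (_ : t0 + (b - t0) = b); last by ring.
  rewrite (_ : T + (b - t0) = b + (T - t0)); last by ring.
  apply: intg_eq => // s; rewrite /= in_itv /= /h /paste => /andP[bs _].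
  by rewrite leNgt bs.
pose A : set (measurableTypeR R) := `[0, b]%classic.
pose B : set (measurableTypeR R) := `]b, b + (T - t0)]%classic.
have mA : measurable A by exact: mitv.
have mB : measurable B by exact: mitv.
have AB : (`[0, b + (T - t0)]%classic : set R) = A `|` B.
  by apply: itv_bndbnd_setU; rewrite bnd_simp; lra.
rewrite /intg AB; apply/integrableP.
have mh : measurable_fun (A `|` B) (EFin \o h).
  apply/measurable_funU => //; split; apply/measurable_EFinP.
    exact: intg_measurable hf.
  exact: intg_measurable hg.
split => //; rewrite ge0_integral_setU//.
- apply: lte_add_pinfty; first by have /integrableP[] := hf.
  by have /integrableP[] := hg.
- exact: measurableT_comp.
- apply/disj_setPS => s []; rewrite /A /B /= !in_itv /= => /andP[_ h1] /andP[h2 _].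
  by have := le_lt_trans h1 h2; rewrite ltxx.
Qed.

Lemma paste_Rintegral b t0 T t (f g : R -> R) : 0 <= b -> t0 <= t -> t <= T ->
  intg leb `[0, b] f -> intg leb `[t0, T] g ->
  \int[leb]_(s in `[0, t + (b - t0)]) paste b (b - t0) f g s =
  \int[leb]_(s in `[0, b]) f s + \int[leb]_(s in `[t0, t]) g s.
Proof.
move=> b0 tt tT fi gi.
have gt : intg leb `[t0, t] g by exact: intg_subitv gi.
have hi := paste_intg b0 tt fi gt.
have e : t + (b - t0) = b + (t - t0) by ring.
rewrite -e in hi.
rewrite (Rintegral_split b0 _ hi); last lra.
congr (_ + _).
  by apply: eq_Rintegral => s /set_mem /=; rewrite in_itv /= /paste => /andP[_ ->].
have [gi' <-] := Rintegral_shift (b - t0) gt.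
rewrite (_ : t0 + (b - t0) = b) in gi' *; last by ring.
rewrite -(Rintegral_itv_obnd_cbnd (r := b) (intg_obnd gi')).
have hb : intg leb `[b, t + (b - t0)] (paste b (b - t0) f g) by exact: intg_subitv hi.
rewrite -(Rintegral_itv_obnd_cbnd (r := b) (intg_obnd hb)).
apply: eq_Rintegral => s /set_mem /=; rewrite in_itv /= /paste => /andP[bs _].
by rewrite leNgt bs.
Qed.

Lemma convect0 k : convect (fun=> 0 : R) k = 0.
Proof.
apply/eqP; rewrite -normr_le0 -[leRHS](mulr0 (freq k)); apply: convect_bound => n.
by rewrite big1// => j _; rewrite /= expr0n.
Qed.

Lemma Rintegral_eq0 (D : set (measurableTypeR R)) (f : R -> R) :
  (forall s, f s = 0) -> \int[leb]_(s in D) f s = 0.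
Proof. by move=> f0; under eq_Rintegral do rewrite f0; rewrite /Rintegral integral0. Qed.

Lemma trajectory0 alpha T : trajectory alpha T 0 (fun=> fun=> 0) (fun=> fun=> 0).
Proof.
split.
- by exists 0 => t _ n; rewrite big1// => j _; rewrite /= expr0n mulr0.
- by move=> k; exact: measurable_cst.
- by move=> k; exact: sqint0.
- move=> n; rewrite big1// => k _; apply: Rintegral_eq0 => s.
  by rewrite expr0n.
- move=> t tT k; apply/esym; apply: Rintegral_eq0 => s.
  by rewrite convect0 !mulr0 addr0 subr0.
Qed.

(** The equation is autonomous, so the part of a path after a time [t0] can be
    attached to any trajectory that ends at its value at [t0]. *)
Lemma trajectory_concat alpha b t0 T e E w G u F : 0 <= b -> 0 <= t0 -> t0 <= T ->
  trajectory alpha b e w G -> trajectory alpha T E u F -> w b = u t0 ->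
  exists u' F', trajectory alpha (b + (T - t0)) (e + E) u' F' /\
    u' (b + (T - t0)) = u T.
Proof.
move=> b0 t00 tT trw tru wu; have T0 := le_trans t00 tT.
have [[M wM] _ sG GE weq] := trw; have [[M' uM] _ sF FE ueq] := tru.
pose S := b + (T - t0).
pose u' s k := paste b (b - t0) (w^~ k) (u^~ k) s.
pose F' k := paste b (b - t0) (G k) (F k).
have u'E s : u' s = if s <= b then w s else u (s - (b - t0)).
  by rewrite /u' /paste; case: ifP.
have sub s : s \in `[0, S] -> (s <= b) = false -> s - (b - t0) \in `[0, T].
  rewrite !in_itv /= /S => /andP[_ sS] /negbT; rewrite -ltNge => bs.
  by apply/andP; split; lra.
have subb s : s \in `[0, S] -> s <= b -> s \in `[0, b].
  by rewrite !in_itv /= => /andP[-> _] ->.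
have rest f : intg leb `[0, T] f -> intg leb `[t0, T] f by exact: intg_subitv.
have F'i k : sqint leb `[0, S] (F' k).
  split.
    apply: (@intg_measurable _ _ _ leb); apply: paste_intg => //.
      exact: sqint_intg_itv.
    by apply: rest; exact: sqint_intg_itv.
  have := paste_intg b0 tT (sG k).2 (rest _ (sF k).2).
  by apply: intg_eq => // s _; rewrite /F' /paste; case: ifP.
exists u', F'; split; last first.
  rewrite u'E; case: ifP => [h|_]; last by congr u; ring.
  have e1 : T = t0 by lra.
  by rewrite e1 subrr addr0 wu.
split.
- exists (Num.max M M') => s sS; rewrite u'E; case: ifP => h n.
    by apply: le_trans (wM s (subb s sS h) n) _; rewrite le_max lexx.
  by apply: le_trans (uM _ (sub s sS h) n) _; rewrite le_max lexx orbT.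
- move=> k; apply: (@intg_measurable _ _ _ leb); apply: paste_intg => //.
    exact: (traj_intg b0 trw k).
  by apply: rest; exact: (traj_intg T0 tru k).
- exact: F'i.
- move=> n; apply: (@le_trans _ _ (\sum_(k < n)
      (\int[leb]_(s in `[0, b]) (G k s ^+ 2) + \int[leb]_(s in `[0, T]) (F k s ^+ 2)))).
    apply: ler_sum => k _.
    have -> : \int[leb]_(s in `[0, S]) (F' k s ^+ 2) =
       \int[leb]_(s in `[0, T + (b - t0)])
         paste b (b - t0) (fun s => G k s ^+ 2) (fun s => F k s ^+ 2) s.
      rewrite /S (_ : b + (T - t0) = T + (b - t0)); last by ring.
      by apply: eq_Rintegral => s _; rewrite /F' /paste; case: ifP.
    rewrite (paste_Rintegral b0 tT (lexx T) (sG k).2 (rest _ (sF k).2)).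
    rewrite lerD2l [leRHS](Rintegral_split t00 tT (sF k).2) lerDr.
    by apply: Rintegral_ge0 => s _; exact: sqr_ge0.
  by rewrite big_split /=; apply: lerD; [exact: GE|exact: FE].
- move=> t tS k; rewrite u'E.
  have iw : intg leb `[0, b] (fun s => convect (w s) k + apow alpha k * G k s - lam k * w s k).
    apply: intgB => //; first exact: sqint_intg_itv (traj_g_sqint b0 trw k).
    by apply: intgZ => //; exact: (traj_intg b0 trw k).
  have iu : intg leb `[0, T] (fun s => convect (u s) k + apow alpha k * F k s - lam k * u s k).
    apply: intgB => //; first exact: sqint_intg_itv (traj_g_sqint T0 tru k).
    by apply: intgZ => //; exact: (traj_intg T0 tru k).
  case: ifP => h.
    rewrite (weq t (subb t tS h)); apply: eq_Rintegral => s /set_mem /=.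
    rewrite in_itv /= => /andP[_ st]; have sb := le_trans st h.
    by rewrite u'E /F' /paste sb.
  have tT' := sub t tS h; have [r0 rT] : t0 <= t - (b - t0) /\ t - (b - t0) <= T.
    move: tS h; rewrite in_itv /= /S => /andP[_ tS] /negbT; rewrite -ltNge.
    by move=> bt; split; lra.
  set r := t - (b - t0) in tT' r0 rT *.
  have -> : \int[leb]_(s in `[0, t]) (convect (u' s) k + apow alpha k * F' k s - lam k * u' s k)
     = \int[leb]_(s in `[0, r + (b - t0)]) paste b (b - t0)
       (fun s => convect (w s) k + apow alpha k * G k s - lam k * w s k)
       (fun s => convect (u s) k + apow alpha k * F k s - lam k * u s k) s.
    rewrite /r subrK; apply: eq_Rintegral => s _.
    by rewrite u'E /F' /paste; case: ifP.
  rewrite (paste_Rintegral b0 r0 rT iw (rest _ iu)) -(weq b); last first.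
    by rewrite in_itv /= b0 lexx.
  rewrite wu (ueq r tT') (ueq t0); last by rewrite in_itv /= t00.
  by rewrite -Rintegral_split//; exact: intg_subitv iu.
Qed.

End concatenation.

(** * Reaching a regular point in unit time *)

Section truncation.
Context (R : realType).
Local Notation leb := (@lebesgue_measure R).
Local Notation ebasis := (@ebasis R).
Local Notation freq := (@freq R).
Local Notation wt := (wt R).
Local Notation lam := (lam R).
Implicit Types (c x : nat -> R) (u w : R -> nat -> R) (F G : nat -> R -> R)
  (n k m N : nat) (M E S T t s a b alpha eta : R).

(** H^1 is an algebra, so the derivative of a square of an element of H^1 is in
    H. *)
Lemma convect_sqr_grad c eta n : weighted_le lam eta c ->
  \sum_(k < n) convect c k ^+ 2 <= 160 * eta ^+ 2.
Proof.
move=> ch; have c2 m : \sum_(k < m) c k ^+ 2 <= eta.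
  apply: le_trans (ch m); apply: ler_sum => k _.
  by rewrite ler_peMl ?sqr_ge0// lam_ge1.
have hc : weighted_le (fun k => k.+1%:R ^+ 2) eta
    (fun k => inner (of_coef c) (ebasis k)).
  move=> m; apply: le_trans (ch m); apply: ler_sum => k _.
  by rewrite (inner_of_coef _ c2) ler_wpM2r ?sqr_ge0// lam_ge.
have := quad_grad_le n (sqint_L2 (of_coef c)) hc => h.
apply: (@le_trans _ _ (\sum_(k < n) 8 * (k.+1%:R * quad (of_coef c) (of_coef c) k) ^+ 2)).
  apply: ler_sum => k _; rewrite /convect nl_sqr; last exact: sqint_L2.
  have f16 : freq k ^+ 2 <= 16 * k.+1%:R ^+ 2.
    rewrite /Defs.freq exprMn mulrC ler_wpM2r ?sqr_ge0//.
    by rewrite expr2; have := pi_ge0 R; have := pihalf_lt2 R; nra.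
  have := ler_wpM2r (sqr_ge0 (quad (of_coef c) (of_coef c) k)) f16.
  rewrite [(k.+1%:R * quad _ _ k) ^+ 2]exprMn.
  move: (freq k ^+ 2) (k.+1%:R ^+ 2) (quad _ _ k ^+ 2) => f K Q.
  lra.
by rewrite -mulr_sumr; lra.
Qed.

(** The path [s |-> s * S(1 - s) x] from 0 to [x]. *)
Definition ramp x s k : R := s * expR (lam k * s) * (expR (- lam k) * x k).

Lemma ramp1 x : ramp x 1 = x.
Proof.
apply/funext => k; rewrite /ramp mul1r mulr1 mulrA -expRD subrr expR0.
exact: mul1r.
Qed.

Lemma ramp_le x s k : 0 <= s -> s <= 1 -> ramp x s k ^+ 2 <= x k ^+ 2.
Proof.
move=> s0 s1; rewrite /ramp.
have -> : s * expR (lam k * s) * (expR (- lam k) * x k) =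
    s * expR (lam k * (s - 1)) * x k.
  by rewrite mulrBr mulr1 expRD; ring.
rewrite exprMn ler_piMl ?sqr_ge0// exprn_ile1//.
  by apply: mulr_ge0.
apply: mulr_ile1 => //.
rewrite -[leRHS]expR0 ler_expR; apply: mulr_ge0_le0; first exact: ltW (lam_gt0 R k).
by rewrite subr_le0.
Qed.

Lemma ramp_weighted x eta (p : nat -> R) s : (forall k, 0 <= p k <= lam k) ->
  weighted_le lam eta x -> s \in `[0, 1] -> weighted_le p eta (ramp x s).
Proof.
move=> pl xh; rewrite in_itv /= => /andP[s0 s1] n.
apply: le_trans (xh n); apply: ler_sum => k _; have /andP[p0 pk] := pl k.
apply: ler_pM => //; first exact: sqr_ge0.
exact: ramp_le.
Qed.

Lemma is_derive_ramp x k s : is_derive s (1 : R) (fun r => ramp x r k)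
  ((1 + lam k * s) * expR (lam k * s) * (expR (- lam k) * x k)).
Proof.
pose K := expR (- lam k) * x k.
have h1 := is_derive_expM (lam k) s.
have h2 := is_deriveM (is_derive_id s (1 : R)) h1.
have h3 := is_deriveZ K h2.
have fE : (fun r => ramp x r k) = K \*: (id * (fun r => expR (lam k * r))).
  by apply/funext => r; rewrite /ramp -/K mulrC.
rewrite fE; apply: (is_derive_eq h3).
by rewrite /GRing.scale /= -/K; ring.
Qed.

(** A point of H^1 is reached in unit time at small cost: the path
    [ramp x] solves the linear equation with a forcing bounded by the H^1 norm of
    [x], and its quadratic term, bounded in H, is cancelled by a second part of
    the forcing. *)
Lemma trajectory_to_H1 alpha x eta : 0 <= alpha -> weighted_le lam eta x ->
  exists G, trajectory alpha 1 (9 * eta + 320 * eta ^+ 2) (ramp x) G.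
Proof.
move=> a0 xh.
have wtl k : 0 <= wt k <= lam k.
  rewrite (ltW (wt_gt0 R k)) /=; apply: le_trans (wt_le_nat R k) _.
  by apply: le_trans (lam_ge R k); rewrite expr2 ler_peMr// natS_ge1.
have laml k : 0 <= lam k <= lam k by rewrite lexx (ltW (lam_gt0 R k)).
have rW s : s \in `[0, 1] -> weighted_le wt eta (ramp x s).
  exact: ramp_weighted.
have rH s : s \in `[0, 1] -> weighted_le lam eta (ramp x s).
  exact: ramp_weighted.
have cr k : continuous (fun s => ramp x s k).
  move=> s; apply: differentiable_continuous; apply/derivable1_diffP.
  exact: (@ex_derive _ _ _ _ _ _ _ (is_derive_ramp x k s)).
have mr k : measurable_fun `[0, (1 : R)] (fun s => ramp x s k).
  apply: within_continuous_measurable; exact: continuous_subspaceT (cr k).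
have mI : measurable (`[0, 1]%classic : set (measurableTypeR R)) by exact: mitv.
have sc k : sqint leb `[0, 1] (fun s => convect (ramp x s) k).
  apply: (@sqint_itv_bounded _ _ _ (freq k * eta)).
    by apply: measurable_convect mr => s sT; exact: weighted_le_sum (rW s sT).
  by move=> s sT; apply: convect_bound; exact: weighted_le_sum (rW s sT).
pose L k s := (1 + 2 * lam k * s) * expR (lam k * s) * (expR (- lam k) * x k).
have cL k : continuous (L k).
  move=> s; apply: cvgM; last exact: cvg_cst.
  apply: cvgM; last exact: continuous_expM.
  apply: cvgD; first exact: cvg_cst.
  by apply: cvgM; [exact: cvg_cst|exact: cvg_id].
have sL k : sqint leb `[0, 1] (L k).
  by apply: sqint_continuous; exact: continuous_subspaceT (cL k).
pose G k s := (apow alpha k)^-1 * (L k s - convect (ramp x s) k).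
have sd k := sqintB mI (sL k) (sc k).
have sG k : sqint leb `[0, 1] (G k) by apply: sqintZ.
have ap1 k : 1 <= apow (R := R) alpha k.
  rewrite -(powRr0 (lam k)) /apow ler_powR ?lam_ge1//; lra.
have Lb k : \int[leb]_(s in `[0, 1]) (L k s ^+ 2) <= 9 / 2 * (lam k * x k ^+ 2).
  have l1 := lam_ge1 R k; have l0 := lam_gt0 R k.
  pose K := 9 / 2 * lam k * (expR (- lam k) * x k) ^+ 2.
  have cE : continuous (fun s => 2 * lam k * expR (2 * lam k * s)).
    by move=> s; apply: cvgM; [exact: cvg_cst|exact: continuous_expM].
  have iE : intg leb `[0, 1] (fun s => 2 * lam k * expR (2 * lam k * s)).
    by apply: intg_continuous; exact: continuous_subspaceT cE.
  apply: (@le_trans _ _ (\int[leb]_(s in `[0, 1])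
      (K * (2 * lam k * expR (2 * lam k * s))))).
    apply: le_Rintegral => //; [exact: (sL k).2|exact: intgZ|].
    move=> s; rewrite /= in_itv /= => /andP[s0 s1].
    have -> : expR (2 * lam k * s) = expR (lam k * s) ^+ 2.
      by rewrite expr2 -expRD; congr expR; ring.
    rewrite /L /K exprMn [in leLHS]exprMn.
    set z := (expR (- lam k) * x k) ^+ 2; set y := expR (lam k * s) ^+ 2.
    have y0 : 0 <= y by exact: sqr_ge0.
    have z0 : 0 <= z by exact: sqr_ge0.
    have -> : 9 / 2 * lam k * z * (2 * lam k * y) = (3 * lam k) ^+ 2 * y * z by field.
    rewrite ler_wpM2r// ler_wpM2r// ler_pXn2r// ?nnegrE.
    + by have := mulr_ge0 (ltW l0) s0; have := ler_wpM2l (ltW l0) s1; lra.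
    + by have := mulr_ge0 (ltW l0) s0; lra.
    + lra.
  rewrite RintegralZl// Rintegral_expM// mulr1.
  have e2 : expR (2 * lam k) = expR (lam k) ^+ 2.
    by rewrite expr2 -expRD; congr expR; ring.
  have e3 : expR (lam k) * expR (- lam k) = 1 by rewrite -expRD subrr expR0.
  rewrite mulrBr mulr1 lerBlDr.
  have -> : K * expR (2 * lam k) = 9 / 2 * (lam k * x k ^+ 2).
    rewrite /K e2 -[RHS]mulr1 -(expr1n _ 2) -e3; ring.
  rewrite lerDl; apply: mulr_ge0; last exact: sqr_ge0.
  by apply: mulr_ge0; [lra|exact: ltW].
exists G; split.
- by exists eta.
- exact: mr.
- exact: sG.
- move=> n.
  apply: (@le_trans _ _ (\sum_(k < n) (2 * \int[leb]_(s in `[0, 1]) (L k s ^+ 2) +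
      2 * \int[leb]_(s in `[0, 1]) (convect (ramp x s) k ^+ 2)))).
    apply: ler_sum => k _.
    apply: (@le_trans _ _ (\int[leb]_(s in `[0, 1]) ((L k s - convect (ramp x s) k) ^+ 2))).
      apply: le_Rintegral => //; [exact: (sG k).2|exact: (sd k).2|].
      move=> s _; rewrite /G exprMn ler_piMl ?sqr_ge0// exprn_ile1//.
        by rewrite invr_ge0 (le_trans _ (ap1 k)).
      by rewrite invf_le1 ?ap1// (lt_le_trans _ (ap1 k)).
    have := sqint_add_le mI (sL k) (sqintN mI (sc k)).
    by under [X in _ <= _ + 2 * X]eq_Rintegral do rewrite sqrrN.
  rewrite big_split /= -!mulr_sumr; apply: lerD.
    apply: (@le_trans _ _ (2 * \sum_(k < n) (9 / 2 * (lam k * x k ^+ 2)))).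
      by apply: ler_wpM2l => //; apply: ler_sum => k _; exact: Lb.
    by rewrite -mulr_sumr; have := xh n; lra.
  rewrite -Rintegral_sum//; last by move=> k; exact: (sc k).2.
  have : \int[leb]_(s in `[0, 1]) (\sum_(k < n) convect (ramp x s) k ^+ 2) <=
      \int[leb]_(s in `[0, 1]) (160 * eta ^+ 2).
    apply: le_Rintegral => //.
    + by apply: intg_sum => // k; exact: (sc k).2.
    + exact: cst_intg.
    + by move=> s sT; apply: convect_sqr_grad; exact: rH.
  rewrite Rintegral_cst// fine_leb_itv// subr0 mulr1; lra.
- move=> t; rewrite in_itv /= => /andP[t0 t1] k.
  have -> : \int[leb]_(s in `[0, t])
      (convect (ramp x s) k + apow alpha k * G k s - lam k * ramp x s k) =
    \int[leb]_(s in `[0, t])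
      ((1 + lam k * s) * expR (lam k * s) * (expR (- lam k) * x k)).
    apply: eq_Rintegral => s _.
    rewrite /G mulVKf; last by rewrite gt_eqF// (lt_le_trans _ (ap1 k)).
    by rewrite /L /ramp; ring.
  rewrite (Rintegral_FTC t0 (is_derive_ramp x k)).
    by rewrite {3}/ramp !mul0r subr0.
  move=> s; apply: cvgM; last exact: cvg_cst.
  apply: cvgM; last exact: continuous_expM.
  apply: cvgD; first exact: cvg_cst.
  by apply: cvgM; [exact: cvg_cst|exact: cvg_id].
Qed.

End truncation.

(** * Reduction to a fixed time interval *)

Section fixed_horizon.
Context (R : realType).
Local Notation leb := (@lebesgue_measure R).
Local Notation lam := (lam R).
Implicit Types (u : R -> nat -> R) (F : nat -> R -> R) (k n : nat)
  (M E T t alpha : R).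

Lemma trajectory_start alpha T E u F : 0 <= T -> trajectory alpha T E u F ->
  u 0 = fun=> 0.
Proof.
move=> T0 [_ _ _ _ ueq]; apply/funext => k.
by rewrite ueq ?set_itv1 ?Rintegral_set1// in_itv /= lexx.
Qed.

(** By dissipation, the last [M] units of time contain a time at which the squared
    H^1 norm is of order [1 / M]; a shorter path starts at 0, where it vanishes. *)
Lemma regular_time alpha T E u F M : alpha < 2^-1 -> 0 <= T -> 0 < M ->
  trajectory alpha T E u F ->
  exists t, [/\ 0 <= t, t <= T, T - t <= M & weighted_le lam ((E + 1) / M) (u t)].
Proof.
move=> a1 T0 M0 tr; have E0 : 0 <= E.
  by case: (tr) => _ _ _ /(_ 0%N) + _; rewrite big_ord0.
pose K := (E + 1) / M; have K0 : 0 < K by rewrite divr_gt0// ltr_wpDl.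
have [TM|MT] := leP T M.
  exists 0; split => //; first by rewrite subr0.
  move=> n; rewrite (trajectory_start T0 tr) big1 ?(ltW K0)// => k _.
  by rewrite expr0n mulr0.
apply: contrapT => no.
pose S n t := \sum_(k < n) lam k * u t k ^+ 2.
have Smono t n m : (n <= m)%N -> S n t <= S m t.
  move=> nm; rewrite /S -(subnKC nm) big_split_ord /= lerDl; apply: sumr_ge0 => k _.
  by apply: mulr_ge0; [exact: ltW (lam_gt0 R _)|exact: sqr_ge0].
have S0 t n : 0 <= S n t by have := Smono t 0%N n (leq0n n); rewrite /S big_ord0.
have big t : t \in `[T - M, T] -> exists n, K < S n t.
  rewrite in_itv /= => /andP[t1 t2]; apply: contrapT => h; apply: no.
  exists t; split => //; [lra|lra|] => n; rewrite leNgt; apply/negP => lt.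
  by apply: h; exists n.
have sub : `[T - M, T]%classic `<=` (`[0, T]%classic : set R).
  by apply: subset_itvScc; rewrite bnd_simp; lra.
have mD : measurable (`[T - M, T]%classic : set (measurableTypeR R)) by exact: mitv.
have mI : measurable (`[0, T]%classic : set (measurableTypeR R)) by exact: mitv.
have iu k : intg leb `[0, T] (fun t => lam k * u t k ^+ 2).
  by apply: intgZ => //; exact: (traj_sqint T0 tr k).2.
have iS n : intg leb `[0, T] (S n) by apply: intg_sum.
have iSD n : intg leb `[T - M, T] (S n) by apply: intg_subitv (iS n); lra.
have mf n : measurable_fun `[T - M, T] (fun t => Num.min (S n t) K).
  by apply: measurable_minr => //; exact: intg_measurable (iSD n).
(* if the bound fails everywhere then the truncated sums increase to the constant
   [K], whose integral [E + 1] exceeds the dissipation *)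
have fK t : `[T - M, T]%classic t -> Num.min (S n t) K @[n --> \oo] --> K.
  move=> /big[N hN]; apply: cvg_near_cst; exists N => // n /= Nn.
  by apply: min_r; apply: le_trans (ltW hN) (Smono _ _ _ Nn).
have fb n t : `[T - M, T]%classic t -> `|Num.min (S n t) K| <= K.
  by rewrite ger0_norm ?le_min ?S0 ?(ltW K0)// ge_min lexx orbT.
have [_ cv] := @Rintegral_dominated _ _ _ leb _ mD (fun n t => Num.min (S n t) K)
    (fun=> K) (fun=> K) mf fK (cst_intg _ _ _) fb.
have le_E n : \int[leb]_(t in `[T - M, T]) Num.min (S n t) K <= E.
  have iD : intg leb `[T - M, T] (fun t => Num.min (S n t) K).
    apply: (intg_le mD (mf n) (iSD n)) => t _.
    by rewrite ger0_norm ?le_min ?S0 ?(ltW K0)// ge_min lexx.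
  apply: (@le_trans _ _ (\int[leb]_(t in `[T - M, T]) S n t)).
    by apply: le_Rintegral => //; [exact: iSD|move=> t _; rewrite ge_min lexx].
  apply: (@le_trans _ _ (\int[leb]_(t in `[0, T]) S n t)).
    rewrite (Rintegral_split (b := T - M) _ _ (iS n)); [|lra|lra].
    by rewrite lerDr; apply: Rintegral_ge0 => t _; exact: S0.
  rewrite Rintegral_sum//; apply: le_trans (trajectory_dissipation n a1 T0 tr).
  apply: ler_sum => k _; rewrite RintegralZl//; exact: (traj_sqint T0 tr k).2.
have : \int[leb]_(t in `[T - M, T]) K <= E.
  by apply: (cvgr_to_le cv); apply: nearW => n; exact: le_E.
rewrite Rintegral_cst// fine_leb_itv; last lra.
rewrite subKr /K divfK ?gt_eqF//; lra.
Qed.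

(** Any trajectory can be replaced, at small cost, by one on a prescribed long
    time interval with the same end point: its distant past is forgotten from
    a regular time on. *)
Lemma trajectory_truncate alpha T E u F M : 0 <= alpha -> alpha < 2^-1 ->
  0 <= T -> 1 <= M -> trajectory alpha T E u F ->
  exists u' F', trajectory alpha (M + 1)
      (E + (9 * ((E + 1) / M) + 320 * ((E + 1) / M) ^+ 2)) u' F' /\
    u' (M + 1) = u T.
Proof.
move=> a0 a1 T0 M1 tr; have M0 : 0 < M by lra.
have [t0 [t00 tT TM hx]] := regular_time a1 T0 M0 tr.
set eta := (E + 1) / M in hx *; set e := 9 * eta + 320 * eta ^+ 2.
have [G trG] := trajectory_to_H1 a0 hx.
pose a := M - (T - t0); have a00 : 0 <= a by rewrite subr_ge0.
have r0 : (fun=> fun=> 0) a = ramp (u t0) 0.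
  by apply/funext => k; rewrite /ramp !mul0r.
have [w [Gw [trw we]]] := trajectory_concat a00 (lexx 0) ler01 (trajectory0 alpha a) trG r0.
have b0 : 0 <= a + (1 - 0) by lra.
have we' : w (a + (1 - 0)) = u t0 by rewrite we ramp1.
have [u' [F' [tru ue]]] := trajectory_concat b0 t00 tT trw tr we'.
have lE : a + (1 - 0) + (T - t0) = M + 1 by rewrite /a; ring.
exists u', F'; rewrite -lE; split => //.
by have <- : 0 + e + E = E + e by ring.
Qed.

End fixed_horizon.

(** * Compact sublevel sets *)

Section lower_semicontinuity.
Context (R : realType) (alpha : R).
Hypotheses (alpha0 : 0 <= alpha) (alpha1 : alpha < 2^-1).
Local Notation mu := (mu01 R).
Local Notation wt := (wt R).
Local Notation U := (fun phi : L2 R => quasi_potential alpha (coef phi)).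
Implicit Types (phi psi : L2 R) (r e E M T : R) (k n : nat).

Lemma trajectory_le T E E' (u : R -> nat -> R) (F : nat -> R -> R) : E <= E' ->
  trajectory alpha T E u F -> trajectory alpha T E' u F.
Proof.
move=> EE' [h1 h2 h3 h4 h5]; split => // n; exact: le_trans (h4 n) EE'.
Qed.

Lemma quasi_potential_trajectory r e phi : (U phi <= r%:E)%E -> 0 < e ->
  exists T u F, [/\ 0 < T, trajectory alpha T (2 * (r + e)) u F & u T = coef phi].
Proof.
move=> Ur e0; have : (U phi < (r + e)%:E)%E.
  by apply: le_lt_trans Ur _; rewrite lte_fin ltrDl.
move=> /ereal_inf_lt[_ [T [u [T0 _ u0 uT ->]]]] /ereal_inf_lt[_ [f ff <-]] lt.
exists T, u, (fun k s => coef (f s) k); split => //.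
apply: trajectory_le (forcing_trajectory alpha1 T0 u0 ff).
have [[_ finf] _] := ff; have S0 : (0 <= sqr_int_L2 T f)%E.
  by apply: integral_ge0 => s _; rewrite lee_fin sqr_ge0.
move: lt; rewrite -[X in (_ * X < _)%E]fineK ?ge0_fin_numE//.
by rewrite -EFinM lte_fin => lt; lra.
Qed.

Lemma sublevel_weighted r phi : (U phi <= r%:E)%E ->
  weighted_le wt (10 * (2 * (r + 1)) ^+ 2 + 2 * (2 * (r + 1))) (coef phi).
Proof.
move=> Ur; have [T [u [F [T0 tr <-]]]] := quasi_potential_trajectory Ur ltr01.
by apply: trajectory_weighted tr _ => //; rewrite in_itv /= lexx ltW.
Qed.

(** Lower semicontinuity along sequences: nearly optimal paths to [phi_ n] are
    brought to one common time interval, where they have a limit point. *)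
Lemma quasi_potential_cvg r (phi_ : nat -> L2 R) phi :
  (forall n, (U (phi_ n) <= r%:E)%E) ->
  (forall k, coef (phi_ n) k @[n --> \oo] --> coef phi k) ->
  (U phi <= r%:E)%E.
Proof.
move=> Ur cv; apply/lee_addgt0Pr => d d0.
pose E := 2 * (r + d / 2); have d20 : 0 < d / 2 by rewrite divr_gt0.
have E0 : 0 <= E.
  have [T [u [F [_ [_ _ _ FE _] _]]]] := quasi_potential_trajectory (Ur 0%N) d20.
  by have := FE 0%N; rewrite big_ord0.
(* the cost of the truncation is [9 * eta + 320 * eta ^ 2], at most [329 * eta]
   when [eta <= 1] *)
pose M := Num.max 1 (329 * (E + 1) / Num.min 1 d).
have m0 : 0 < Num.min 1 d by rewrite lt_min ltr01.
have M1 : 1 <= M by rewrite le_max lexx.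
have M0 : 0 < M by lra.
pose eta := (E + 1) / M.
have eta0 : 0 <= eta by rewrite divr_ge0; lra.
have eta_le : 329 * eta <= Num.min 1 d.
  rewrite /eta mulrA ler_pdivrMr// [leRHS]mulrC -ler_pdivrMr//.
  by rewrite le_max lexx orbT.
have err : 9 * eta + 320 * eta ^+ 2 <= d.
  have [e1 ed] : 329 * eta <= 1 /\ 329 * eta <= d.
    by split; apply: le_trans eta_le _; rewrite ge_min lexx ?orbT.
  by rewrite expr2; nra.
have /choice[uF uFP] n : exists uF : (R -> nat -> R) * (nat -> R -> R),
    trajectory alpha (M + 1) (E + d) uF.1 uF.2 /\ uF.1 (M + 1) = coef (phi_ n).
  have [T [u [F [T0 tr uT]]]] := quasi_potential_trajectory (Ur n) d20.
  have [u' [F' [tr' u'T]]] := trajectory_truncate alpha0 alpha1 (ltW T0) M1 tr.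
  exists (u', F') => /=; split; last by rewrite u'T.
  by apply: trajectory_le tr'; rewrite lerD2l.
have S0 : 0 <= M + 1 by lra.
have [n|k|u [F [tr uS]]] := @trajectory_limit R alpha (M + 1) (E + d)
    (fun n => (uF n).1) (fun n => (uF n).2) (coef phi) alpha1 S0.
- exact: (uFP n).1.
- by under eq_fun do rewrite (uFP _).2; exact: cv.
rewrite -uS; apply: le_trans (trajectory_quasi_potential alpha0 alpha1 _ tr) _.
  lra.
by rewrite -EFinD lee_fin /E; lra.
Qed.

Lemma coef_sub_le phi psi k : `|coef phi k - coef psi k| <= mdist phi psi.
Proof.
rewrite -(ler_pXn2r (n := 2))// ?nnegrE ?mdist_ge0// -normrX ger0_norm ?sqr_ge0//.
rewrite L2distE -innerBl; try exact: sqint_L2; last exact: sqint_ebasis.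
rewrite -inner_sqr.
apply: le_trans (bessel k.+1 (sqintB measurableT (sqint_L2 phi) (sqint_L2 psi))).
rewrite big_ord_recr /= lerDr; apply: sumr_ge0 => j _; exact: sqr_ge0.
Qed.

(** Coefficients are continuous on H, so this is [quasi_potential_cvg]. *)
Lemma closed_sublevel r : closed (sublevel alpha r).
Proof.
move=> phi clphi.
have /choice[phi_ phiP] n : exists psi, sublevel alpha r psi /\ mdist phi psi < n.+1%:R^-1.
  have n0 : 0 < n.+1%:R^-1 :> R by rewrite invr_gt0.
  have [psi [h1 h2]] := clphi _ (nbhsx_ballx phi _ n0).
  by exists psi; split => //; move: h2; rewrite ballEmdist.
apply: (@quasi_potential_cvg r phi_) => [n|k]; first exact: (phiP n).1.
apply/cvgrPdist_le => e e0.
have /cvgrPdist_le/(_ _ e0)[N _ HN] := @cvg_harmonic R.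
exists N => // n Nn; apply: le_trans (coef_sub_le _ _ _) _.
apply: le_trans (ltW (phiP n).2) _.
by have := HN n Nn; rewrite /= sub0r normrN; apply: le_trans; exact: ler_norm.
Qed.

(** By [sublevel_weighted] the coefficients are bounded on the sublevel set, so
    they converge along any ultrafilter on it; by [coef_dist_cvg] the ultrafilter
    converges in H, and the limit stays in the closed sublevel set. *)
Lemma compact_sublevel r : compact (sublevel alpha r).
Proof.
rewrite compact_ultra => X UX XA.
pose W := 10 * (2 * (r + 1)) ^+ 2 + 2 * (2 * (r + 1)).
have XW : X [set phi | weighted_le wt W (coef phi)].
  by apply: filterS XA => phi; exact: sublevel_weighted.
have /choice[c cP] k : exists l : R, (fun phi => coef phi k) @ X --> l.
  apply: (@ultra_bounded_cvg R _ X _ (1 + W)); apply: filterS XW => phi hphi /=.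
  have := sum_le_sqr k (weighted_le_sum hphi).
  rewrite ler_norml expr2 => h; apply/andP; split; nra.
have cW : weighted_le wt W c.
  move=> n.
  have h : (fun phi => \sum_(k < n) wt k * coef phi k ^+ 2) @ X -->
      \sum_(k < n) wt k * c k ^+ 2.
    apply: (@cvg_sum_filter R _ X _ n (fun k phi => wt k * coef phi k ^+ 2)
      (fun k => wt k * c k ^+ 2)) => k.
    apply: cvgM; first exact: cvg_cst.
    by under eq_fun do rewrite expr2; rewrite expr2; apply: cvgM.
  by apply: (cvgr_to_le h); apply: filterS XW => phi; exact.
have Xc : X --> of_coef c.
  move=> V /nbhs_ballP[e e0 eV].
  have e20 : 0 < (e / 2) ^+ 2 by rewrite exprn_gt0// divr_gt0.
  have dc : (fun phi => coef_dist (coef phi) c) @ X --> 0 by exact: coef_dist_cvg XW cW cP.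
  have /cvgrPdist_le/(_ _ e20) := dc.
  apply: filterS => phi; rewrite sub0r normrN => h; apply: eV.
  rewrite ballEmdist /= metric_sym.
  have {}h : mdist phi (of_coef c) ^+ 2 <= (e / 2) ^+ 2.
    move: h; rewrite ger0_norm ?coef_dist_ge0// /coef_dist of_coef_coef.
    by rewrite L2distE.
  move: h; rewrite ler_pXn2r ?nnegrE ?mdist_ge0 ?divr_ge0 ?(ltW e0)//.
  by move=> h; move: e0 => /= e0; lra.
exists (of_coef c); split => //.
apply: closed_sublevel => V Vc.
have [psi [h1 h2]] := filter_ex (filterI XA (Xc V Vc)).
by exists psi.
Qed.

End lower_semicontinuity.

Theorem theorem4p11 (R : realType) (alpha : R)
    (halpha0 : 0 <= alpha) (halpha : alpha < 2^-1) :
  (forall r : R, 0 < r -> compact (sublevel alpha r)) /\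
  lower_semicontinuous (fun phi : L2 R => quasi_potential alpha (coef phi)).
Proof.
split=> [r _|phi a aU]; first exact: compact_sublevel.
exists (~` sublevel alpha a).
  apply: open_nbhs_nbhs; split; first by apply: closed_openC; exact: closed_sublevel.
  by rewrite /sublevel /=; apply/negP; rewrite -ltNge.
by move=> psi /= /negP; rewrite -ltNge.
Qed.
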